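(* Suppose the Centering, Mixing, Factor, Loading, Noise-decomposition, Noise-dynamics and Rate assumptions listed in the context hold for the MEFM, and let $\widehat k_r,\widehat k_c$ be the eigenvalue-ratio estimators \begin{align*} \widehat k_r&:=\operatorname*{arg\,min}_{j\in[\lfloor p/2\rfloor]}\frac{\lambda_{j+1}\big(T^{-1}\sum_{t=1}^T\widehat{\mathbf{L}}_t\widehat{\mathbf{L}}_t'\big)+\xi_r}{\lambda_j\big(T^{-1}\sum_{t=1}^T\widehat{\mathbf{L}}_t\widehat{\mathbf{L}}_t'\big)+\xi_r},\qquad \xi_r\asymp pq\big[(Tq)^{-1/2}+p^{-1/2}\big],\\ \widehat k_c&:=\operatorname*{arg\,min}_{j\in[\lfloor q/2\rfloor]}\frac{\lambda_{j+1}\big(T^{-1}\sum_{t=1}^T\widehat{\mathbf{L}}_t'\widehat{\mathbf{L}}_t\big)+\xi_c}{\lambda_j\big(T^{-1}\sum_{t=1}^T\widehat{\mathbf{L}}_t'\widehat{\mathbf{L}}_t\big)+\xi_c},\qquad \xi_c\asymp pq\big[(Tp)^{-1/2}+q^{-1/2}\big]. \end{align*} Then, as $T,p,q\to\infty$: 1. $\widehat k_r$ is a consistent estimator of $k_r$ if $$\begin{cases}p^{1-\delta_{r,k_r}}q^{1-\delta_{c,1}}[(Tq)^{-1/2}+p^{-1/2}]=o(p^{\delta_{r,j+1}-\delta_{r,j}}),& j\in[k_r-1]\text{ with }k_r\ge2;\\ p^{1-\delta_{r,1}}q^{1-\delta_{c,1}}[(Tq)^{-1/2}+p^{-1/2}]=o(1),&k_r=1.\end{cases}$$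 2. $\widehat k_c$ is a consistent estimator of $k_c$ if $$\begin{cases}q^{1-\delta_{c,k_c}}p^{1-\delta_{r,1}}[(Tp)^{-1/2}+q^{-1/2}]=o(q^{\delta_{c,j+1}-\delta_{c,j}}),& j\in[k_c-1]\text{ with }k_c\ge2;\\ q^{1-\delta_{c,1}}p^{1-\delta_{r,1}}[(Tp)^{-1/2}+q^{-1/2}]=o(1),&k_c=1.\end{cases}$$
   Context: Notation: $[m]=\{1,\dots,m\}$; $\mathbf{1}_m$ is the vector of $m$ ones; $\mathbf{M}_m=\mathbf{I}_m-m^{-1}\mathbf{1}_m\mathbf{1}_m'$; $'$ is transpose; $\lambda_j(\cdot)$ is the $j$-th largest eigenvalue; $\|\mathbf{A}\|_1=\max_j\sum_i|A_{ij}|$; $\circ$ is the Hadamard product; $\mathrm{diag}(\mathbf{A})$ is the diagonal matrix with the diagonal of $\mathbf{A}$; $a\asymp b$ means $a=O(b)$ and $b=O(a)$. Asymptotics are as $T,p,q\to\infty$ with $k_r,k_c$ fixed. Model (MEFM): for $t\in[T]$, the observed $\mathbf{Y}_t\in\mathbb{R}^{p\times q}$ satisfies $$\mathbf{Y}_t=\mu_t\mathbf{1}_p\mathbf{1}_q'+\boldsymbol{\alpha}_t\mathbf{1}_q'+\mathbf{1}_p\boldsymbol{\beta}_t'+\mathbf{C}_t+\mathbf{E}_t,\qquad \mathbf{C}_t=\mathbf{A}_r\mathbf{F}_t\mathbf{A}_c',$$ with scalar $\mu_t$, $\boldsymbol{\alpha}_t\in\mathbb{R}^p$, $\boldsymbol{\beta}_t\in\mathbb{R}^q$,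 latent core factor $\mathbf{F}_t\in\mathbb{R}^{k_r\times k_c}$, loadings $\mathbf{A}_r\in\mathbb{R}^{p\times k_r}$, $\mathbf{A}_c\in\mathbb{R}^{q\times k_c}$, noise $\mathbf{E}_t\in\mathbb{R}^{p\times q}$. Put $\mathbf{Z}_r=\mathrm{diag}(\mathbf{A}_r'\mathbf{A}_r)$, $\mathbf{Z}_c=\mathrm{diag}(\mathbf{A}_c'\mathbf{A}_c)$, and $\widehat{\mathbf{L}}_t=\mathbf{M}_p\mathbf{Y}_t\mathbf{M}_q$. Assumptions. Centering: for every $t$, $\mathbf{1}_p'\boldsymbol{\alpha}_t=\mathbf{1}_q'\boldsymbol{\beta}_t=0$, $\mathbf{1}_p'\mathbf{A}_r=\mathbf{0}$, $\mathbf{1}_q'\mathbf{A}_c=\mathbf{0}$. Mixing: the elements of $\mathrm{vec}(\mathbf{F}_t)$ and $\mathrm{vec}(\mathbf{E}_t)$ are $\alpha$-mixing, where a process $\{\mathbf{x}_t\}$ is $\alpha$-mixing if for some $\gamma>2$, $\sum_{h\ge1}\alpha(h)^{1-2/\gamma}<\infty$, with $\alpha(h)=\sup_\tau\sup_{A\in\mathcal{H}_{-\infty}^\tau,B\in\mathcal{H}_{\tau+h}^\infty}|\mathbb{P}(A\cap B)-\mathbb{P}(A)\mathbb{P}(B)|$ and $\mathcal{H}_\tau^s$ the $\sigma$-field generated by $\{\mathbf{x}_t:\tau\le t\le s\}$. Factor: $\mathbf{F}_t=\sum_{w\ge0}a_{f,w}\mathbf{X}_{f,t-w}$, where $\{\mathbf{X}_{f,t}\}$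 (same dimension as $\mathbf{F}_t$) has i.i.d. elements with mean $0$, variance $1$ and uniformly bounded fourth moments; $\sum_{w\ge0}a_{f,w}^2=1$ and $\sum_{w\ge0}|a_{f,w}|\le c$ for a constant $c$. Loading: $\mathbf{A}_r,\mathbf{A}_c$ are of full rank and independent of the factor and error series. As $p,q\to\infty$, $\mathbf{Z}_r^{-1/2}\mathbf{A}_r'\mathbf{A}_r\mathbf{Z}_r^{-1/2}\to\boldsymbol{\Sigma}_{A,r}$ and $\mathbf{Z}_c^{-1/2}\mathbf{A}_c'\mathbf{A}_c\mathbf{Z}_c^{-1/2}\to\boldsymbol{\Sigma}_{A,c}$, both positive definite with eigenvalues bounded away from $0$ and infinity; $(\mathbf{Z}_r)_{jj}\asymp p^{\delta_{r,j}}$, $j\in[k_r]$, $1/2<\delta_{r,k_r}\le\dots\le\delta_{r,1}\le1$; $(\mathbf{Z}_c)_{jj}\asymp q^{\delta_{c,j}}$, $j\in[k_c]$, $1/2<\delta_{c,k_c}\le\dots\le\delta_{c,1}\le1$. Noise-decomposition: $\mathbf{E}_t=\mathbf{A}_{e,r}\mathbf{F}_{e,t}\mathbf{A}_{e,c}'+\boldsymbol{\Sigma}_\epsilon\circ\boldsymbol{\epsilon}_t$, where $\mathbf{F}_{e,t}\in\mathbb{R}^{k_{e,r}\times k_{e,c}}$ and $\boldsymbol{\epsilon}_t\in\mathbb{R}^{p\times q}$ each have independent elements with mean $0$ and variance $1$, $\{\boldsymbol{\epsilon}_t\}$ is independent of $\{\mathbf{F}_{e,t}\}$, the (standard deviation)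 matrix $\boldsymbol{\Sigma}_\epsilon$ has elements uniformly bounded away from $0$ and infinity, $\|\mathbf{A}_{e,r}\|_1,\|\mathbf{A}_{e,c}\|_1=O(1)$, and $k_{e,r},k_{e,c}=O(1)$. Noise-dynamics: $\mathbf{F}_{e,t}=\sum_{w\ge0}a_{e,w}\mathbf{X}_{e,t-w}$, $\boldsymbol{\epsilon}_t=\sum_{w\ge0}a_{\epsilon,w}\mathbf{X}_{\epsilon,t-w}$, with $\{\mathbf{X}_{e,t}\},\{\mathbf{X}_{\epsilon,t}\}$ independent of each other and of $\{\mathbf{X}_{f,t}\}$, each having independent elements with mean $0$, variance $1$ and uniformly bounded fourth moments; $\sum a_{e,w}^2=\sum a_{\epsilon,w}^2=1$, $\sum|a_{e,w}|,\sum|a_{\epsilon,w}|\le c$. Rate: $T^{-1}p^{2(1-\delta_{r,k_r})}q^{1-2\delta_{c,1}}$, $p^{1-2\delta_{r,k_r}}q^{2(1-\delta_{c,1})}$, $T^{-1}q^{2(1-\delta_{c,k_c})}p^{1-2\delta_{r,1}}$, $q^{1-2\delta_{c,k_c}}p^{2(1-\delta_{r,1})}$ are all $o(1)$. *)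

(* Defs.v *)
From mathcomp Require Import all_boot all_order all_algebra.
From mathcomp Require Import all_classical all_reals all_analysis.

Set Implicit Arguments.
Unset Strict Implicit.
Unset Printing Implicit Defensive.

Import Order.TTheory GRing.Theory Num.Theory.
Import numFieldNormedType.Exports.

Local Open Scope classical_set_scope.
Local Open Scope ring_scope.

Definition asymp {R : realType} (a b : nat -> R) : Prop :=
  a =O_\oo b /\ b =O_\oo a.

(* The matrix I_m - m^-1 1 1'. *)
Definition centering_mx (R : realType) (m : nat) : 'M[R]_m :=
  1%:M - m%:R^-1 *: const_mx 1.

Definition diag_part {R : realType} {m : nat} (A : 'M[R]_m) : 'M[R]_m :=
  diag_mx (\row_j A j j).

(* D^{-1/2} for a diagonal matrix D with positive diagonal entries. *)
Definition diag_inv_sqrt {R : realType} {m : nat} (D : 'M[R]_m) : 'M[R]_m :=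
  diag_mx (\row_j (Num.sqrt (D j j))^-1).

Definition norm1_mx {R : realType} {m n : nat} (A : 'M[R]_(m, n)) : R :=
  \big[Num.max/0]_j \sum_i `|A i j|.

Definition posdef_mx {R : realType} {m : nat} (S : 'M[R]_m) : Prop :=
  S^T = S /\ forall x : 'rV[R]_m, x != 0 -> 0 < (x *m S *m x^T) 0 0.

(* s lists the eigenvalues of A with algebraic multiplicity, in nonincreasing
   order; such an s is unique, and it exists whenever A is symmetric. *)
Definition is_spectrum {R : realType} {m : nat} (A : 'M[R]_m) (s : seq R) :
    Prop :=
  sorted >=%R s /\ char_poly A = \prod_(x <- s) ('X - x%:P).

(* The j-th largest eigenvalue, j starting from 1. *)
Definition lambda {R : realType} {m : nat} (j : nat) (A : 'M[R]_m) : R :=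
  nth 0 (xget [::] [set s | is_spectrum A s]) j.-1.

Definition eig_ratio {R : realType} {m : nat} (A : 'M[R]_m) (xi : R) (j : nat) :
    R :=
  (lambda j.+1 A + xi) / (lambda j A + xi).

(* k is a minimizer of f over {1, ..., m}; ties may be broken arbitrarily. *)
Definition is_argmin {R : realType} (f : nat -> R) (m k : nat) : Prop :=
  (1 <= k <= m)%N /\ forall j, (1 <= j <= m)%N -> f k <= f j.

Definition sigma_rv {R : realType} {d} {Omega : measurableType d}
    (Xs : set (Omega -> R)) : set_system Omega :=
  <<s [set A | exists2 X, Xs X & exists2 B, measurable B & A = X @^-1` B] >>.

Definition independent_rvs {R : realType} {d} {Omega : measurableType d}
    (P : probability Omega R) (Xs Zs : set (Omega -> R)) : Prop :=
  forall A B, sigma_rv Xs A -> sigma_rv Zs B -> P (A `&` B) = (P A * P B)%E.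

Definition mutually_independent {R : realType} {d} {Omega : measurableType d}
    (P : probability Omega R) (I : eqType) (X : I -> Omega -> R) : Prop :=
  forall (s : seq I) (B : I -> set R), uniq s -> (forall i, measurable (B i)) ->
    P (\big[setI/setT]_(i <- s) (X i @^-1` B i)) =
    (\prod_(i <- s) P (X i @^-1` B i))%E.

Definition alpha_coef {R : realType} {d} {Omega : measurableType d}
    (P : probability Omega R) (x : int -> Omega -> R) (h : nat) : R :=
  sup [set r | exists (tau : int) (A B : set Omega),
    [/\ sigma_rv [set x t | t in [set t | t <= tau]] A,
        sigma_rv [set x t | t in [set t | tau + h%:Z <= t]] B &
        r = `|fine (P (A `&` B)) - fine (P A) * fine (P B)|]].

Definition alpha_mixing {R : realType} {d} {Omega : measurableType d}
    (P : probability Omega R) (x : int -> Omega -> R) : Prop :=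
  exists2 g : R, 2 < g &
    (\sum_(1 <= h <oo) (alpha_coef P x h `^ (1 - 2 / g))%:E < +oo)%E.

Definition random_mx {R : realType} {d} {Omega : measurableType d}
    (P : probability Omega R) (m n : nat) : Type := 'I_m -> 'I_n -> {RV P >-> R}.

Definition mx_at {R : realType} {d} {Omega : measurableType d}
    {P : probability Omega R} {m n : nat} (X : random_mx P m n) (w : Omega) :
    'M[R]_(m, n) :=
  \matrix_(i, j) X i j w.

Definition entries {R : realType} {d} {Omega : measurableType d}
    {P : probability Omega R} {m n : nat} (X : random_mx P m n) : set (Omega -> R) :=
  [set f | exists i j, f = X i j :> (Omega -> R)].

Definition series_entries {R : realType} {d} {Omega : measurableType d}
    {P : probability Omega R} {m n : nat} (X : int -> random_mx P m n) :
    set (Omega -> R) :=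
  \bigcup_t entries (X t).

Definition standardized {R : realType} {d} {Omega : measurableType d}
    (P : probability Omega R) (X : {RV P >-> R}) : Prop :=
  ('E_P[X] = 0)%E /\ ('V_P[X] = 1)%E.

(* Independence holds across the two matrix indices and across time. *)
Definition innovations {R : realType} {d} {Omega : measurableType d}
    (P : probability Omega R) {m n : nat} (X : int -> random_mx P m n) : Prop :=
  mutually_independent P
    (fun u : int * 'I_m * 'I_n => X u.1.1 u.1.2 u.2 : Omega -> R) /\
  forall t i j, standardized (X t i j).

Definition identically_distributed {R : realType} {d} {Omega : measurableType d}
    (P : probability Omega R) {m n : nat} (X : int -> random_mx P m n) : Prop :=
  forall t i j t' i' j' (B : set R), measurable B ->
    P (X t i j @^-1` B) = P (X t' i' j' @^-1` B).

Definition fourth_moment_le {R : realType} {d} {Omega : measurableType d}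
    (P : probability Omega R) {m n : nat} (X : int -> random_mx P m n) (b : R) :
    Prop :=
  forall t i j, ('E_P[(fun w => X t i j w ^+ 4)%R] <= b%:E)%E.

(* Z_t = \sum_(w >= 0) a_w X_(t-w), the series converging almost surely. *)
Definition linear_process {R : realType} {d} {Omega : measurableType d}
    (P : probability Omega R) {m n : nat} (a : nat -> R)
    (X Z : int -> random_mx P m n) : Prop :=
  forall t i j, {ae P, forall w,
    (fun N => \sum_(0 <= v < N) a v * X (t - v%:Z) i j w) @ \oo
      --> Z t i j w}.

Definition coefficients {R : realType} (a : nat -> R) (c : R) : Prop :=
  (\sum_(0 <= v <oo) (a v ^+ 2)%:E = 1)%E /\
  (\sum_(0 <= v <oo) `|a v|%:E <= c%:E)%E.

(* The data of the model for one pair of dimensions (p, q).  Asymptotics are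
   taken along a sequence of such models, with kr and kc fixed.  The factor and
   noise series run over all integer times; the observations Y t are used only
   for t = 1, ..., T.  Random loadings are allowed. *)
Record mefm {R : realType} {d} {Omega : measurableType d} (P : probability Omega R)
    (kr kc p q : nat) : Type := Mefm {
  Y : nat -> random_mx P p q;
  mu : nat -> {RV P >-> R};
  alpha : nat -> random_mx P p 1;
  beta : nat -> random_mx P q 1;
  Ar : random_mx P p kr;
  Ac : random_mx P q kc;
  F : int -> random_mx P kr kc;
  E : int -> random_mx P p q;
  af : nat -> R;
  Xf : int -> random_mx P kr kc;
  ker : nat;
  kec : nat;
  Aer : 'M[R]_(p, ker);
  Aec : 'M[R]_(q, kec);
  Fe : int -> random_mx P ker kec;
  Sigma_eps : 'M[R]_(p, q);
  eps : int -> random_mx P p q;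
  ae : nat -> R;
  Xe : int -> random_mx P ker kec;
  aeps : nat -> R;
  Xeps : int -> random_mx P p q }.

Arguments Fe {R d Omega P kr kc p q} _ _ _ _.
Arguments Xe {R d Omega P kr kc p q} _ _ _ _.

Section Assumptions.
Context {R : realType} {d : measure_display} {Omega : measurableType d}.
Context {P : probability Omega R} {kr kc : nat} {p q : nat -> nat}.
Implicit Types (T : nat -> nat) (M : forall n, mefm P kr kc (p n) (q n)).
Implicit Types (delta_r delta_c : nat -> R).

Definition model_equation T M : Prop :=
  forall n t, (1 <= t <= T n)%N -> {ae P, forall w,
    mx_at (Y (M n) t) w =
      mu (M n) t w *: (const_mx 1 *m (const_mx 1 : 'cV[R]_(q n))^T)
      + mx_at (alpha (M n) t) w *m (const_mx 1 : 'cV[R]_(q n))^T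
      + (const_mx 1 : 'cV[R]_(p n)) *m (mx_at (beta (M n) t) w)^T
      + mx_at (Ar (M n)) w *m mx_at (F (M n) t%:Z) w *m (mx_at (Ac (M n)) w)^T
      + mx_at (E (M n) t%:Z) w}.

Definition centering_assumption T M : Prop :=
  forall n, {ae P, forall w,
    [/\ forall t, (1 <= t <= T n)%N ->
          (const_mx 1 : 'rV[R]_(p n)) *m mx_at (alpha (M n) t) w = 0 /\
          (const_mx 1 : 'rV[R]_(q n)) *m mx_at (beta (M n) t) w = 0,
        (const_mx 1 : 'rV[R]_(p n)) *m mx_at (Ar (M n)) w = 0 &
        (const_mx 1 : 'rV[R]_(q n)) *m mx_at (Ac (M n)) w = 0]}.

Definition mixing_assumption M : Prop :=
  forall n,
    (forall i j, alpha_mixing P (fun t => F (M n) t i j : Omega -> R)) /\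
    (forall i j, alpha_mixing P (fun t => E (M n) t i j : Omega -> R)).

Definition factor_assumption M : Prop :=
  [/\ forall n, linear_process (af (M n)) (Xf (M n)) (F (M n)),
      forall n, innovations (Xf (M n)) /\ identically_distributed (Xf (M n)),
      exists b, forall n, fourth_moment_le (Xf (M n)) b &
      exists c, forall n, coefficients (af (M n)) c].

(* Strength conditions on a sequence of k-column random loading matrices with
   s n rows; delta is indexed from 1, so column j : 'I_k has strength
   delta j.+1. *)
Definition loading_strength (k : nat) (s : nat -> nat)
    (A : forall n, random_mx P (s n) k) (delta : nat -> R) : Prop :=
  let gram n w := (mx_at (A n) w)^T *m mx_at (A n) w in
  let Z n w := diag_part (gram n w) in
  [/\ {ae P, forall w, \forall n \near \oo, \rank (mx_at (A n) w) = k},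
      exists S : 'M[R]_k,
        [/\ posdef_mx S,
            exists lo hi : R, 0 < lo /\
              forall x, eigenvalue S x -> lo <= x <= hi &
            {ae P, forall w,
              (fun n => diag_inv_sqrt (Z n w) *m gram n w
                          *m diag_inv_sqrt (Z n w)) @ \oo --> S}],
      {ae P, forall w, forall j : 'I_k,
        asymp (fun n => Z n w j j) (fun n => (s n)%:R `^ delta j.+1)} &
      [/\ 1 / 2 < delta k,
          forall i j, (1 <= i <= j)%N -> (j <= k)%N -> delta j <= delta i &
          delta 1%N <= 1]].

Definition loading_assumption M delta_r delta_c : Prop :=
  [/\ forall n, independent_rvs P
        (entries (Ar (M n)) `|` entries (Ac (M n)))
        (series_entries (F (M n)) `|` series_entries (E (M n))),
      loading_strength (fun n => Ar (M n)) delta_r &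
      loading_strength (fun n => Ac (M n)) delta_c].

Definition noise_decomposition_assumption M : Prop :=
  [/\ forall n t, {ae P, forall w,
        mx_at (E (M n) t) w =
          Aer (M n) *m mx_at (Fe (M n) t) w *m (Aec (M n))^T
          + map2_mx *%R (Sigma_eps (M n)) (mx_at (eps (M n) t) w)},
      forall n t,
        [/\ mutually_independent P
              (fun u : 'I__ * 'I__ => Fe (M n) t u.1 u.2 : Omega -> R),
            forall i j, standardized (Fe (M n) t i j),
            mutually_independent P
              (fun u : 'I__ * 'I__ => eps (M n) t u.1 u.2 : Omega -> R) &
            forall i j, standardized (eps (M n) t i j)],
      forall n, independent_rvs P (series_entries (eps (M n)))
                  (series_entries (Fe (M n))),
      exists lo hi : R, 0 < lo /\
        forall n i j, lo <= Sigma_eps (M n) i j <= hi &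
      [/\ (fun n => norm1_mx (Aer (M n))) =O_\oo (fun=> 1 : R),
          (fun n => norm1_mx (Aec (M n))) =O_\oo (fun=> 1 : R),
          (fun n => (ker (M n))%:R : R) =O_\oo (fun=> 1 : R) &
          (fun n => (kec (M n))%:R : R) =O_\oo (fun=> 1 : R)]].

Definition noise_dynamics_assumption M : Prop :=
  [/\ forall n, linear_process (ae (M n)) (Xe (M n)) (Fe (M n)) /\
                linear_process (aeps (M n)) (Xeps (M n)) (eps (M n)),
      forall n,
        independent_rvs P (series_entries (Xe (M n)))
          (series_entries (Xeps (M n))) /\
        independent_rvs P (series_entries (Xf (M n)))
          (series_entries (Xe (M n)) `|` series_entries (Xeps (M n))),
      forall n, innovations (Xe (M n)) /\ innovations (Xeps (M n)),
      exists b, forall n,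
        fourth_moment_le (Xe (M n)) b /\ fourth_moment_le (Xeps (M n)) b &
      exists c, forall n,
        coefficients (ae (M n)) c /\ coefficients (aeps (M n)) c].

End Assumptions.

Definition rate_assumption {R : realType} (kr kc : nat) (T p q : nat -> nat)
    (delta_r delta_c : nat -> R) : Prop :=
  let Tn n := (T n)%:R : R in
  let pn n := (p n)%:R : R in
  let qn n := (q n)%:R : R in
  [/\ (fun n => (Tn n)^-1 * pn n `^ (2 * (1 - delta_r kr))
                * qn n `^ (1 - 2 * delta_c 1%N)) =o_\oo (fun=> 1 : R),
      (fun n => pn n `^ (1 - 2 * delta_r kr)
                * qn n `^ (2 * (1 - delta_c 1%N))) =o_\oo (fun=> 1 : R),
      (fun n => (Tn n)^-1 * qn n `^ (2 * (1 - delta_c kc))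
                * pn n `^ (1 - 2 * delta_r 1%N)) =o_\oo (fun=> 1 : R) &
      (fun n => qn n `^ (1 - 2 * delta_c kc)
                * pn n `^ (2 * (1 - delta_r 1%N))) =o_\oo (fun=> 1 : R)].

(* (T q)^{-1/2} + p^{-1/2} *)
Definition noise_rate (R : realType) (T p q : nat) : R :=
  (T%:R * q%:R) `^ (- (1 / 2)) + p%:R `^ (- (1 / 2)).

(* The condition on the row factor strengths; exchanging the roles of rows and
   columns gives the one on the column factor strengths. *)
Definition strength_gap {R : realType} (kr : nat) (T p q : nat -> nat)
    (delta_r delta_c : nat -> R) : Prop :=
  let pn n := (p n)%:R : R in
  let qn n := (q n)%:R : R in
  ((2 <= kr)%N -> forall j, (1 <= j <= kr.-1)%N ->
     (fun n => pn n `^ (1 - delta_r kr) * qn n `^ (1 - delta_c 1%N)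
               * noise_rate R (T n) (p n) (q n))
     =o_\oo (fun n => pn n `^ (delta_r j.+1 - delta_r j))) /\
  (kr = 1%N ->
     (fun n => pn n `^ (1 - delta_r 1%N) * qn n `^ (1 - delta_c 1%N)
               * noise_rate R (T n) (p n) (q n))
     =o_\oo (fun=> 1 : R)).

Definition Lhat {R : realType} {d} {Omega : measurableType d}
    {P : probability Omega R} {kr kc p q : nat} (M : mefm P kr kc p q)
    (t : nat) (w : Omega) : 'M[R]_(p, q) :=
  centering_mx R p *m mx_at (Y M t) w *m centering_mx R q.

Definition row_cov {R : realType} {d} {Omega : measurableType d}
    {P : probability Omega R} {kr kc p q : nat} (T : nat)
    (M : mefm P kr kc p q) (w : Omega) : 'M[R]_p :=
  T%:R^-1 *: \sum_(1 <= t < T.+1) Lhat M t w *m (Lhat M t w)^T.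

Definition col_cov {R : realType} {d} {Omega : measurableType d}
    {P : probability Omega R} {kr kc p q : nat} (T : nat)
    (M : mefm P kr kc p q) (w : Omega) : 'M[R]_q :=
  T%:R^-1 *: \sum_(1 <= t < T.+1) (Lhat M t w)^T *m Lhat M t w.

(* khat n minimizes the perturbed eigenvalue ratio of S n over
   {1, ..., floor (s n / 2)}, which is nonempty only if s n >= 2. *)
Definition eig_ratio_estimator {R : realType} {d} {Omega : measurableType d}
    (P : probability Omega R) (s : nat -> nat) (S : forall n, Omega -> 'M[R]_(s n))
    (xi : nat -> R) (khat : nat -> {RV P >-> nat}) : Prop :=
  forall n w, (2 <= s n)%N ->
    is_argmin (eig_ratio (S n w) (xi n)) (s n)./2 (khat n w).

Definition consistent {R : realType} {d} {Omega : measurableType d}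
    (P : probability Omega R) (khat : nat -> {RV P >-> nat}) (k : nat) : Prop :=
  forall e : R, 0 < e ->
    (fun n => P [set w | e <= `|(khat n w)%:R - k%:R|]) @ \oo --> 0%E.

(* Main.v *)
(* Centring kills the means and fixes the loadings, so Lhat_t = C_t + M_p E_t M_q.
   By Courant-Fischer the j-th eigenvalue of the sample row covariance is, up to
   constants, that of its factor part, give or take the norm of the noise part.
   Time averages of products of core factor entries tend to those of orthonormal
   variables, so the factor part is close to ||A_c||_F^2 A_r A_r', whose j-th
   eigenvalue has exact order q^delta_c1 p^delta_rj for j <= k_r and vanishes
   beyond k_r.  The noise part is O_P(xi_r): the idiosyncratic sample covariance
   is its diagonal mean, of order q, plus a fluctuation controlled in Frobenius
   norm.  That fluctuation is a sum over pairs of lags (v, w), weighted by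
   a_v a_w, of averages of products of innovations.  The products are pairwise
   orthogonal, which bounds the second moment of each average; Jensen's inequality
   sums over the lags because sum |a_v| is finite, and Fatou's lemma passes to the
   infinite series.  On an event of probability close to one the ratio at k_r is
   therefore smaller than every other ratio as soon as the gap condition holds.
   Columns follow by transposing the model. *)
Require Import Defs.
From mathcomp Require Import all_boot all_order all_algebra.
From mathcomp Require Import complex.
From mathcomp Require Import all_classical all_reals all_analysis.
From mathcomp Require Import measurable_realfun.
From mathcomp Require Import zify ring lra.
Import Order.TTheory GRing.Theory Num.Theory.
Import numFieldNormedType.Exports.
Import HBSimple HBNNSimple.
Set Implicit Arguments.
Unset Strict Implicit.
Unset Printing Implicit Defensive.
Local Open Scope classical_set_scope.
Local Open Scope ring_scope.

(** * Symmetric real matrices and their ordered eigenvalues *)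

(** Probability is confined to a few estimates sharing one constant [K]: each fails with small
    probability once [K] is large, and outside these failures only inequalities between fixed
    matrices are used. The tolerance drawn from the gap condition may depend on [K], because that
    condition is a little-o. Factor and noise are separated inside the quadratic form at the cost of
    factors of two, so their cross products are never estimated. The two summands of the noise rate
    have distinct sources. The squared Frobenius norm of the fluctuation adds p^2 squared entries of
    mean O(q/T), and the root p sqrt(q/T) equals pq (Tq)^(-1/2). The diagonal mean, of order q, is
    absorbed by pq p^(-1/2). The loadings are random and their asymptotics hold only almost surely,
    so the constants and the starting index depend on the outcome; continuity of the measure along
    increasing events makes them uniform up to small probability. *)

Definition sqn {R : realType} {n} (x : 'rV[R]_n) : R := \sum_i x 0 i ^+ 2.

Definition qform {R : realType} {n} (A : 'M[R]_n) (x : 'rV[R]_n) : R :=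
  (x *m A *m x^T) 0 0.

Lemma sqnE (R : realType) n (x : 'rV[R]_n) : sqn x = (x *m x^T) 0 0.
Proof. by rewrite mxE; apply: eq_bigr => i _; rewrite mxE expr2. Qed.

Lemma sqn_ge0 (R : realType) n (x : 'rV[R]_n) : 0 <= sqn x.
Proof. by apply: sumr_ge0 => i _; exact: sqr_ge0. Qed.

Lemma sqn_eq0 (R : realType) n (x : 'rV[R]_n) : (sqn x == 0) = (x == 0).
Proof.
rewrite psumr_eq0; last by move=> i _; exact: sqr_ge0.
apply/allP/eqP => [h|-> i _]; last by rewrite /= mxE expr0n eqxx.
by apply/rowP => i; rewrite mxE; apply/eqP; rewrite -sqrf_eq0; exact: (h i (mem_index_enum _)).
Qed.

(** * Counting eigenvalues by quadratic forms on subspaces *)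

Section HermitianCount.
Variable C : numClosedFieldType.
Local Notation "M ^t*" := (map_mx Num.conj (M^T)) (at level 30).

(** The sign [e] covers both halves of Courant-Fischer: [e = 1] counts the eigenvalues that are at
    least [c], [e = -1] those that are at most [-c]. Counting keeps the ordering of the spectrum out
    of the argument. *)
Lemma hermitian_form_count n r (A : 'M[C]_n) (V : 'M[C]_(r, n)) (e c : C) :
  A \is hermsymmx -> e \is Num.real -> c \is Num.real -> row_free V ->
  (forall u : 'rV_r, c * (u *m V *m (u *m V) ^t*) 0 0
     <= e * (u *m V *m A *m (u *m V) ^t*) 0 0) ->
  (r <= #|[pred i | (c <= e * spectral_diag A 0 i)%R]|)%N.
Proof.
move=> hA eR cR Vfree hV; rewrite leqNgt; apply/negP => lt_r.
set I := [pred i | _] in lt_r.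
set U := spectralmx A; set D := spectral_diag A.
have U1 : U *m U ^t* = 1%:M by apply/unitarymxP; exact: spectral_unitarymx.
have U2 : U ^t* *m U = 1%:M by rewrite -invmx_unitary ?spectral_unitarymx // mulVmx ?spectral_unit.
have AE : A = U ^t* *m diag_mx D *m U.
  rewrite -invmx_unitary ?spectral_unitarymx //.
  by apply/orthomx_spectralP; exact: hermitian_normalmx.
have DR i : e * D 0 i \is Num.real.
  by rewrite realM //; have /mxOverP := hermitian_spectral_diag_real hA; exact.
pose K := \matrix_(i < n, j < #|I|) (U ^t*) i (enum_val j).
(* Otherwise some vector of the row space of V is orthogonal to all the
   eigenvectors indexed by I. *)
have : kermx (V *m K) != 0.
  rewrite kermx_eq0 /row_free; apply/eqP => rk.
  by have := rank_leq_col (V *m K); rewrite rk leqNgt lt_r.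
case/rowV0Pn => u /sub_kermxP uK u0.
set x := u *m V.
have [y yE] : {y | y = x *m U ^t*} by exists (x *m U ^t*).
have x0 : x != 0 by rewrite mulmx_free_eq0.
have yI i : i \in I -> y 0 i = 0.
  move=> iI; have /matrixP/(_ 0 (enum_rank_in iI i)) := uK.
  rewrite mulmxA mxE [RHS]mxE => <-; rewrite yE mxE; apply: eq_bigr => k _.
  by rewrite [K _ _]mxE enum_rankK_in.
have xy : x = y *m U by rewrite yE -mulmxA U2 mulmx1.
have E1 : (x *m x ^t*) 0 0 = \sum_i `|y 0 i| ^+ 2.
  rewrite {1}xy [in X in _ *m X]xy trmx_mul map_mxM /= mulmxA -(mulmxA y) U1 mulmx1 mxE.
  by apply: eq_bigr => i _; rewrite !mxE normCK.
have E2 : (x *m A *m x ^t*) 0 0 = \sum_i D 0 i * `|y 0 i| ^+ 2.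
  rewrite AE !mulmxA -yE -mulmxA; have -> : U *m x ^t* = y ^t*.
    by rewrite yE [in RHS]trmx_mul [in RHS]map_mxM trmxCK.
  rewrite mxE; apply: eq_bigr => i _.
  by rewrite !mxE (bigD1 i) //= big1 => [|j /negPf ji]; rewrite !mxE ?eqxx ?ji ?mulr0 // mulr1n addr0 normCK; ring.
have := hV u; rewrite -/x E1 E2 !mulr_sumr => le_c.
(* In the eigenbasis the coordinates in [I] vanish and every index outside [I] has strictly smaller
   weight; since [y] is nonzero, one term is strict. *)
suff lt_c : \sum_i e * (D 0 i * `|y 0 i| ^+ 2) < \sum_i c * `|y 0 i| ^+ 2 by rewrite (lt_geF lt_c) in le_c.
have lei i : e * (D 0 i * `|y 0 i| ^+ 2) <= c * `|y 0 i| ^+ 2.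
  have [iI|iI] := boolP (i \in I); first by rewrite yI // normr0 expr0n /= !mulr0.
  by rewrite mulrA ler_wpM2r ?exprn_ge0 //; move: iI; rewrite inE -real_ltNge // => /ltW.
have y0 : y != 0 by apply: contraNneq x0 => y0; rewrite xy y0 mul0mx.
have [i yi] : exists i, y 0 i != 0.
  apply/existsP; apply: contraNT y0; rewrite negb_exists => /forallP h.
  by apply/eqP/rowP => i; have := h i; rewrite mxE negbK => /eqP.
rewrite (bigD1 i) //= [ltRHS](bigD1 i) //= ltr_leD //; last by apply: ler_sum.
rewrite mulrA ltr_pM2r ?exprn_gt0 ?normr_gt0 // real_ltNge //.
by apply: contraNN yi => ci; rewrite yI // inE.
Qed.

End HermitianCount.

Section RealSpectral.
Variable R : realType.
Local Notation C := R[i].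
Local Notation rc := (real_complex R).

Lemma map_rc_real m n (A : 'M[R]_(m, n)) : map_mx rc A \is a realmx.
Proof. by apply/mxOverP => i j; rewrite mxE; apply/complex_realP; exists (A i j). Qed.

Lemma rc_conj (a : R) : (rc a)^* = rc a.
Proof. by apply/CrealP/complex_realP; exists a. Qed.

Lemma complex_row n (u : 'rV[C]_n) :
  exists a b : 'rV[R]_n, u = map_mx rc a + 'i *: map_mx rc b.
Proof.
exists (map_mx (@complex.Re R) u), (map_mx (@complex.Im R) u).
by apply/rowP => i; rewrite !mxE {1}[u 0 i]complexE.
Qed.

(* The library's spectral theorem is over a closed field; real forms are
   transferred to R[i] by splitting vectors into real and imaginary parts. *)
Lemma complex_form n (A : 'M[R]_n) (a b : 'rV[R]_n) : A^T = A ->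
  let x := map_mx rc a + 'i *: map_mx rc b in
  (x *m map_mx rc A *m map_mx Num.conj x^T) 0 0 = rc (qform A a + qform A b).
Proof.
move=> sA x.
have -> : map_mx Num.conj x^T = map_mx rc a^T - 'i *: map_mx rc b^T.
  by apply/matrixP => i j; rewrite !mxE rmorphD rmorphM /= conjCi !rc_conj mulNr.
rewrite /x mulmxDl mulmxDl !mulmxBr -!scalemxAl -!scalemxAr -!map_mxM scalerA -expr2 sqrCi.
have tr1 (B : 'M[R]_1) : B^T = B by apply/matrixP => i j; rewrite mxE !ord1.
have -> : a *m A *m b^T = b *m A *m a^T by rewrite -[LHS]tr1 !trmx_mul trmxK sA mulmxA.
set M := map_mx rc (b *m A *m a^T).
have -> : map_mx rc (a *m A *m a^T) - 'i *: M + ('i *: M - -1 *: map_mx rc (b *m A *m b^T))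
  = map_mx rc (a *m A *m a^T) + map_mx rc (b *m A *m b^T).
  by rewrite scaleN1r opprK addrA subrK.
by rewrite /qform !mxE -rmorphD.
Qed.

Lemma char_poly_conj (F : fieldType) n (U A : 'M[F]_n) : U \in unitmx ->
  char_poly (invmx U *m A *m U) = char_poly A.
Proof.
move=> uU; have uUp : map_mx polyC U \in unitmx.
  by rewrite unitmxE det_map_mx rmorph_unit // -unitmxE.
rewrite /char_poly -[RHS](mulKr (uUp : \det (map_mx polyC U) \is a GRing.unit)).
rewrite [_ * \det (char_poly_mx A)]mulrC mulrA -det_inv -!det_mulmx; congr (\det _).
rewrite /char_poly_mx mulmxBr mulmxBl !map_mxM /= map_invmx; congr (_ - _).
by rewrite scalar_mxC -mulmxA mulVmx // mulmx1.
Qed.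

(** Both properties are stated for the same family [d]: the characteristic polynomial identifies [d]
    with the list behind [lambda], and the count then bounds the entries of that list. *)
Theorem symmetric_spectrum n (A : 'M[R]_n) : A^T = A ->
  exists d : 'I_n -> R,
    char_poly A = \prod_i ('X - (d i)%:P) /\
    forall r (V : 'M[R]_(r, n)) (e c : R), row_free V ->
      (forall u : 'rV_r, c * sqn (u *m V) <= e * qform A (u *m V)) ->
      (r <= #|[pred i | (c <= e * d i)%R]|)%N.
Proof.
move=> sA; set A' := map_mx rc A.
have hA : A' \is hermsymmx.
  apply: realsym_hermsym; last exact: map_rc_real.
  by apply/is_hermitianmxP; rewrite expr0 scale1r map_mx_id // map_trmx sA.
set D := spectral_diag A'.
have DR i : D 0 i = rc (complex.Re (D 0 i)).
  by rewrite RRe_real //; have /mxOverP := hermitian_spectral_diag_real hA; exact.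
exists (fun i => complex.Re (D 0 i)); split.
  apply: (map_inj_poly (@complexI R)) => //.
  rewrite map_char_poly rmorph_prod /= -/A'.
  have /orthomx_spectralP -> := hermitian_normalmx hA.
  rewrite char_poly_conj ?spectral_unit // -/D char_poly_trig ?diag_mx_is_trig //.
  apply: eq_bigr => i _.
  by rewrite rmorphB /= map_polyX map_polyC /= -DR mxE eqxx mulr1n.
move=> r V e c Vfree hV.
suff : (r <= #|[pred i | (rc c <= rc e * D 0 i)%R]|)%N.
  by rewrite (@eq_card _ _ [pred i | (c <= e * complex.Re (D 0 i))%R]) // => i; rewrite !inE [in LHS]DR -rmorphM lecR.
apply: (@hermitian_form_count _ _ _ A' (map_mx rc V)) => //.
- by apply/complex_realP; exists e.
- by apply/complex_realP; exists c.
- by rewrite row_free_map.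
move=> u; have [a [b ->]] := complex_row u.
have -> : (map_mx rc a + 'i *: map_mx rc b) *m map_mx rc V =
  map_mx rc (a *m V) + 'i *: map_mx rc (b *m V).
  by rewrite mulmxDl -scalemxAl -!map_mxM.
(* At the identity matrix [complex_form] computes squared norms, so the hypothesis can be used for
   the real and imaginary parts separately and added up. *)
have := complex_form (a *m V) (b *m V) (trmx1 R n).
rewrite /= map_mx1 mulmx1 => ->; rewrite complex_form //.
by rewrite -!rmorphM /= lecR !mulrDr lerD // (le_trans _ (hV _)) // /qform mulmx1 sqnE.
Qed.
End RealSpectral.

(** * The ordered eigenvalues and the min-max bounds *)

Section Lambda.
Variable R : realType.

Lemma nth_sorted_ge (s : seq R) c j : sorted >=%R s ->
  (j < count (fun x : R => (c <= x)%R) s)%N -> c <= nth 0 s j.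
Proof.
move=> ss jc; rewrite leNgt; apply/negP => lt_c.
have : (count (fun x : R => (c <= x)%R) (drop j s) = 0)%N.
  apply/eqP; rewrite -leqn0 leqNgt -has_count; apply/hasPn => /= x xs; have [i lti ix] := elimT (nthP (0 : R)) xs.
  rewrite size_drop in lti; rewrite -ix nth_drop -ltNge (le_lt_trans _ lt_c) //.
  have lt1 : (j + i < size s)%N by move: lti; rewrite ltn_subRL addnC.
  by apply: (sorted_leq_nth ge_trans ge_refl) => //; rewrite ?inE ?leq_addr // (leq_ltn_trans _ lt1) ?leq_addr.
have := count_cat (fun x : R => (c <= x)%R) (take j s) (drop j s); rewrite cat_take_drop => e e0.
have := count_size (fun x : R => (c <= x)%R) (take j s); rewrite size_take; case: ifP; lia.
Qed.

Lemma nth_sorted_le (s : seq R) c j : sorted >=%R s -> (j < size s)%N ->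
  (size s - j <= count (fun x : R => (x <= c)%R) s)%N -> nth 0 s j <= c.
Proof.
move=> ss js jc; rewrite leNgt; apply/negP => lt_c.
have : (count (fun x : R => (x <= c)%R) (take j.+1 s) = 0)%N.
  apply/eqP; rewrite -leqn0 leqNgt -has_count; apply/hasPn => /= x xs; have [i lti ix] := elimT (nthP (0 : R)) xs.
  rewrite size_take in lti; have lt1 : (i < j.+1)%N by move: lti; case: (ltnP j.+1 (size s)) => // h /leq_trans; exact.
  rewrite -ix nth_take // -ltNge (lt_le_trans lt_c) //.
  by apply: (sorted_leq_nth ge_trans ge_refl) => //; rewrite ?inE // (leq_ltn_trans _ js).
have := count_cat (fun x : R => (x <= c)%R) (take j.+1 s) (drop j.+1 s); rewrite cat_take_drop => e e0.
have := count_size (fun x : R => (x <= c)%R) (drop j.+1 s); rewrite size_drop; lia.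
Qed.

(** A product of monic linear factors determines its roots, so the list selected by [xget] is a
    permutation of the family given by the spectral theorem and inherits its counting property. *)
Lemma lambda_spectrum n (A : 'M[R]_n) : A^T = A ->
  exists s : seq R,
  [/\ sorted >=%R s, size s = n, forall j, lambda j A = nth 0 s j.-1,
     forall x, x \in s -> eigenvalue A x &
     forall r (V : 'M[R]_(r, n)) (e c : R), row_free V ->
      (forall u : 'rV_r, c * sqn (u *m V) <= e * qform A (u *m V)) ->
      (r <= count (fun x : R => (c <= e * x)%R) s)%N].
Proof.
move=> sA; have [d [hd hc]] := symmetric_spectrum sA.
have ex : is_spectrum A (sort >=%R (codom d)).
  split; first by apply: sort_sorted => x y; exact: ge_total.
  by rewrite (perm_big _ (permEl (perm_sort _ _))) /= big_map enumT hd.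
have [ss sp] : is_spectrum A (xget [::] [set s | is_spectrum A s]).
  by apply: (@xgetPex _ [::] [set s | is_spectrum A s]); exists (sort >=%R (codom d)).
set s := xget _ _ in ss sp *.
have ps : perm_eq s (codom d).
  by apply: prod_XsubC_eq; rewrite -sp hd big_map enumT.
exists s; split=> //.
- by rewrite (perm_size ps) size_codom card_ord.
- by move=> x xs; rewrite eigenvalue_root_char sp root_prod_XsubC.
- move=> r V e c Vf hV; rewrite (permP ps) count_map.
  by have := hc r V e c Vf hV; rewrite cardE size_filter enumT.
Qed.

Lemma lambda_ge n (A : 'M[R]_n) r (V : 'M[R]_(r, n)) (c : R) : (0 < r)%N -> A^T = A ->
  row_free V -> (forall u : 'rV_r, c * sqn (u *m V) <= qform A (u *m V)) ->
  c <= lambda r A.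
Proof.
move=> r0 sA Vf hV; have [s [ss _ -> _ h]] := lambda_spectrum sA.
apply: nth_sorted_ge => //; rewrite prednK // (eq_count (_ : _ =1 (fun x => c <= 1 * x))).
  by apply: (h _ V) => // u; rewrite mul1r.
by move=> x /=; rewrite mul1r.
Qed.

(** The count with [e = -1] puts at least [r] eigenvalues at or below [c]; since [n < r + j], fewer
    than [j] remain above it. *)
Lemma lambda_le n (A : 'M[R]_n) r (V : 'M[R]_(r, n)) (j : nat) (c : R) :
  (0 < j <= n)%N -> A^T = A -> (n < r + j)%N ->
  row_free V -> (forall u : 'rV_r, qform A (u *m V) <= c * sqn (u *m V)) ->
  lambda j A <= c.
Proof.
move=> jn sA nr Vf hV; have [s [ss szs -> _ h]] := lambda_spectrum sA.
apply: nth_sorted_le => //; first by rewrite szs; lia.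
rewrite (eq_count (_ : _ =1 (fun x => (- c <= -1 * x)%R))); last first.
  by move=> x /=; rewrite mulN1r lerN2.
apply: (leq_trans _ (h r V (-1) (- c) Vf _)); first by rewrite szs; lia.
by move=> u; rewrite mulN1r mulNr lerN2.
Qed.

Lemma qformZ n (A : 'M[R]_n) a x : qform A (a *: x) = a ^+ 2 * qform A x.
Proof. by rewrite /qform linearZ /= -scalemxAl -scalemxAl -scalemxAr !mxE mulrA. Qed.

Lemma sqnZ n a (x : 'rV[R]_n) : sqn (a *: x) = a ^+ 2 * sqn x.
Proof. by rewrite /sqn mulr_sumr; apply: eq_bigr => i _; rewrite mxE exprMn. Qed.

(** The count on the line spanned by [x] yields an eigenvalue that does not exceed the Rayleigh
    quotient of [x]. *)
Lemma eigen_qform_ge n (A : 'M[R]_n) c : A^T = A ->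
  (forall x, eigenvalue A x -> c <= x) -> forall x, c * sqn x <= qform A x.
Proof.
move=> sA hc x; have [->|x0] := eqVneq x 0.
  by rewrite -(scale0r 0) sqnZ qformZ expr0n !mul0r mulr0.
have sx : 0 < sqn x by rewrite lt_neqAle sqn_ge0 eq_sym sqn_eq0 x0.
rewrite leNgt -ltr_pdivrMr //; apply/negP => lt_c.
have [s [_ _ _ hs h]] := lambda_spectrum sA.
have xf : row_free x by rewrite /row_free rank_rV x0.
have /(h _ _ _ _ xf) : forall u : 'rV_1,
    - (qform A x / sqn x) * sqn (u *m x) <= -1 * qform A (u *m x).
  move=> u; rewrite [u]mx11_scalar mul_scalar_mx qformZ sqnZ.
  by rewrite mulN1r mulNr lerN2 mulrCA divfK ?gt_eqF.
rewrite -has_count => /hasP [y /hs /hc cy]; rewrite mulN1r lerN2 => ya.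
by have := lt_le_trans lt_c cy; rewrite ltNge ya.
Qed.
End Lambda.

(** * Elementary inequalities for finite sums *)

Section FiniteSums.
Variable R : realType.

(** Lagrange's identity: twice the gap is the double sum of the squares of
    [a i * b j - a j * b i]. *)
Lemma cauchy_schwarz_sum (I : finType) (Pr : pred I) (a b : I -> R) :
  (\sum_(i | Pr i) a i * b i) ^+ 2
    <= (\sum_(i | Pr i) a i ^+ 2) * (\sum_(i | Pr i) b i ^+ 2).
Proof.
rewrite -subr_ge0 -(pmulr_rge0 _ (ltr0n _ 2)).
suff -> : 2 * ((\sum_(i | Pr i) a i ^+ 2) * (\sum_(i | Pr i) b i ^+ 2)
    - (\sum_(i | Pr i) a i * b i) ^+ 2)
  = \sum_(i | Pr i) \sum_(j | Pr j) (a i * b j - a j * b i) ^+ 2.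
  by apply: sumr_ge0 => i _; apply: sumr_ge0 => j _; exact: sqr_ge0.
transitivity (\sum_(i | Pr i) \sum_(j | Pr j) (a i ^+ 2 * b j ^+ 2 + a j ^+ 2 * b i ^+ 2
    - 2 * (a i * b i) * (a j * b j))); last first.
  by apply: eq_bigr => i _; apply: eq_bigr => j _; ring.
under [RHS]eq_bigr do rewrite sumrB big_split /= -!mulr_sumr -mulr_suml.
by rewrite sumrB big_split /= -!mulr_suml -!mulr_sumr; ring.
Qed.

Lemma sqr_sum_le (I : finType) (a : I -> R) :
  (\sum_i a i) ^+ 2 <= #|I|%:R * \sum_i a i ^+ 2.
Proof.
have := cauchy_schwarz_sum predT (fun=> 1) a.
under eq_bigr do rewrite mul1r.
by under [X in X * _]eq_bigr do rewrite expr1n; rewrite sumr_const cardT -cardE.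
Qed.

(** The deviation is at most [eta] times the squared sum of the absolute values of [z], and
    Cauchy-Schwarz trades that square for [#|I|] times the sum of squares. *)
Lemma form_near_sqn (I : finType) (G : I -> I -> R) (eta : R) (z : I -> R) :
  0 <= eta -> (forall a b, `|G a b - (a == b)%:R| <= eta) ->
  `|\sum_a \sum_b z a * z b * G a b - \sum_a z a ^+ 2|
    <= eta * #|I|%:R * \sum_a z a ^+ 2.
Proof.
move=> eta0 hG.
have -> : \sum_a \sum_b z a * z b * G a b - \sum_a z a ^+ 2 =
  \sum_a \sum_b z a * z b * (G a b - (a == b)%:R).
  rewrite -sumrB; apply: eq_bigr => a _.
  under [RHS]eq_bigr do rewrite mulrBr; rewrite sumrB; congr (_ - _).
  rewrite (bigD1 a) //= eqxx mulr1 big1 ?addr0 ?expr2 // => b /negPf.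
  by rewrite eq_sym => ->; rewrite mulr0.
rewrite (le_trans (ler_norm_sum _ _ _)) //.
apply: (@le_trans _ _ (\sum_a \sum_b eta * (`|z a| * `|z b|))).
  apply: ler_sum => a _; rewrite (le_trans (ler_norm_sum _ _ _)) //.
  apply: ler_sum => b _; rewrite !normrM mulrC ler_wpM2r ?mulr_ge0 //.
under eq_bigr do rewrite -!mulr_sumr.
rewrite -mulr_sumr -mulr_suml -mulrA ler_wpM2l // -expr2.
rewrite (le_trans (sqr_sum_le _)) // ler_wpM2l //.
by apply: ler_sum => a _; rewrite real_normK ?num_real.
Qed.

Lemma sqrD_le (a b : R) : (a + b) ^+ 2 <= 2 * a ^+ 2 + 2 * b ^+ 2.
Proof. by rewrite -subr_ge0 (_ : _ - _ = (a - b) ^+ 2) ?sqr_ge0 //; ring. Qed.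

(** The gap equals [2 * (a / 2 + b) ^+ 2]. Giving up half of the main term removes the cross
    term. *)
Lemma sqrD_ge (a b : R) : 2^-1 * a ^+ 2 - b ^+ 2 <= (a + b) ^+ 2.
Proof.
by have := sqr_ge0 (2^-1 * a + b); nra.
Qed.

End FiniteSums.

(** * Frobenius norm and the centering projection *)

Section Forms.
Variable R : realType.

Definition fro m n (A : 'M[R]_(m, n)) : R := \sum_i \sum_j A i j ^+ 2.

Lemma fro_ge0 m n (A : 'M[R]_(m, n)) : 0 <= fro A.
Proof. by apply: sumr_ge0 => i _; apply: sumr_ge0 => j _; exact: sqr_ge0. Qed.

Lemma sqn_mul_le m n (x : 'rV[R]_m) (A : 'M[R]_(m, n)) : sqn (x *m A) <= fro A * sqn x.
Proof.
rewrite /fro exchange_big /= mulr_suml; apply: ler_sum => j _.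
by rewrite mxE (le_trans (cauchy_schwarz_sum _ _ _)) // mulrC.
Qed.

Lemma fro_rows m n (A : 'M[R]_(m, n)) : fro A = \sum_i sqn (row i A).
Proof. by apply: eq_bigr => i _; apply: eq_bigr => j _; rewrite mxE. Qed.

Lemma fro_mul_le m n k (A : 'M[R]_(m, n)) (B : 'M[R]_(n, k)) : fro (A *m B) <= fro A * fro B.
Proof.
rewrite !(fro_rows (_ *m _)) (fro_rows A) mulr_suml; apply: ler_sum => i _.
by rewrite row_mul mulrC sqn_mul_le.
Qed.

Lemma fro_tr m n (A : 'M[R]_(m, n)) : fro A^T = fro A.
Proof. by rewrite /fro exchange_big; apply: eq_bigr => i _; apply: eq_bigr => j _; rewrite mxE. Qed.

Lemma sqnD_le n (x y : 'rV[R]_n) : sqn (x + y) <= 2 * sqn x + 2 * sqn y.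
Proof. by rewrite /sqn !mulr_sumr -big_split /=; apply: ler_sum => i _; rewrite mxE sqrD_le. Qed.

Lemma sqnD_ge n (x y : 'rV[R]_n) : 2^-1 * sqn x - sqn y <= sqn (x + y).
Proof. by rewrite /sqn !mulr_sumr -sumrB /=; apply: ler_sum => i _; rewrite mxE sqrD_ge. Qed.

Lemma centering_tr m : (centering_mx R m)^T = centering_mx R m.
Proof. by rewrite /centering_mx linearB linearZ /= trmx1 trmx_const. Qed.

(** Centering is symmetric and idempotent, so it lowers the squared norm by the squared sum of the
    entries of [x] divided by the dimension. *)
Lemma sqn_centering_le m (x : 'rV[R]_m) : sqn (x *m centering_mx R m) <= sqn x.
Proof.
case: m x => [|m] x; first by rewrite /sqn !big_ord0.
rewrite !sqnE trmx_mul centering_tr mulmxA -(mulmxA x).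
have -> : centering_mx R m.+1 *m centering_mx R m.+1 = centering_mx R m.+1.
  rewrite /centering_mx mulmxBl mul1mx mulmxBr mulmx1 -scalemxAl -scalemxAr scalerA.
  set J : 'M[R]_m.+1 := const_mx 1; have -> : J *m J = m.+1%:R *: J.
    apply/matrixP => i j; rewrite !mxE; under eq_bigr do rewrite !mxE mulr1.
    by rewrite sumr_const card_ord mulr1.
  by rewrite scalerA -mulrA mulVf ?pnatr_eq0 // mulr1 subrr subr0.
rewrite mulmxBr mulmx1 mulmxBl [leLHS]mxE [X in _ + X <= _]mxE lerBlDr lerDl.
have -> : (const_mx 1 : 'M[R]_m.+1) = (const_mx 1 : 'rV[R]_m.+1)^T *m const_mx 1.
  by apply/matrixP => i j; rewrite !mxE big_ord1 !mxE mulr1.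
rewrite -scalemxAr -scalemxAl mxE mulr_ge0 ?invr_ge0 // mulmxA -(mulmxA (x *m _)).
rewrite -[const_mx 1 *m x^T]trmxK trmx_mul trmxK.
by rewrite -sqnE sqn_ge0.
Qed.

End Forms.

(** * Eigenvalues of the sample covariance of a factor plus noise *)

Section SampleCovariance.
Variables (R : realType) (T : nat).

Definition tavg (f : nat -> R) : R := T%:R^-1 * \sum_(1 <= t < T.+1) f t.

Lemma ler_tavg (f g : nat -> R) :
  (forall t, (1 <= t <= T)%N -> f t <= g t) -> tavg f <= tavg g.
Proof.
move=> fg; rewrite ler_wpM2l ?invr_ge0 // big_nat [leRHS]big_nat.
by apply: ler_sum => t; exact: fg.
Qed.

Lemma eq_tavg (f g : nat -> R) :
  (forall t, (1 <= t <= T)%N -> f t = g t) -> tavg f = tavg g.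
Proof. by move=> fg; apply/eqP; rewrite eq_le !ler_tavg // => t /fg ->. Qed.

Lemma tavg0 : tavg (fun=> 0) = 0.
Proof. by rewrite /tavg big1 ?mulr0. Qed.

Lemma tavg_ge0 (f : nat -> R) :
  (forall t, (1 <= t <= T)%N -> 0 <= f t) -> 0 <= tavg f.
Proof. by move=> f0; rewrite -tavg0; exact: ler_tavg. Qed.

Lemma tavgD (f g : nat -> R) : tavg (fun t => f t + g t) = tavg f + tavg g.
Proof. by rewrite /tavg big_split mulrDr. Qed.

Lemma tavgZ c (f : nat -> R) : tavg (fun t => c * f t) = c * tavg f.
Proof. by rewrite /tavg -mulr_sumr mulrCA. Qed.

Lemma tavgZr c (f : nat -> R) : tavg (fun t => f t * c) = tavg f * c.
Proof. by rewrite /tavg -mulr_suml mulrA. Qed.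

Lemma tavg_sum (I : finType) (f : I -> nat -> R) :
  tavg (fun t => \sum_i f i t) = \sum_i tavg (f i).
Proof. by rewrite /tavg exchange_big /= mulr_sumr. Qed.

Lemma tavg_cst c : (0 < T)%N -> tavg (fun=> c) = c.
Proof.
by move=> T0; rewrite /tavg sumr_const_nat subSS subn0 -[c *+ T]mulr_natl mulKf // pnatr_eq0 -lt0n.
Qed.

(** Unfolds to the same term as [row_cov] once [L t] is [Lhat M t w], so results for fixed matrices
    apply to each outcome by conversion. *)
Definition scov p q (L : nat -> 'M[R]_(p, q)) : 'M[R]_p :=
  T%:R^-1 *: \sum_(1 <= t < T.+1) L t *m (L t)^T.

Lemma scov_tr p q (L : nat -> 'M[R]_(p, q)) : (scov L)^T = scov L.
Proof.
rewrite /scov linearZ /= linear_sum /=; congr (_ *: _).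
by apply: eq_bigr => t _; rewrite trmx_mul trmxK.
Qed.

Lemma qform_scov p q (L : nat -> 'M[R]_(p, q)) x :
  qform (scov L) x = tavg (fun t => sqn (x *m L t)).
Proof.
rewrite /qform /scov -scalemxAr -scalemxAl mxE; congr (_ * _).
rewrite mulmx_sumr mulmx_suml summxE; apply: eq_bigr => t _.
by rewrite sqnE trmx_mul !mulmxA.
Qed.

Lemma lambda_scov_ge0 p q (L : nat -> 'M[R]_(p, q)) j : 0 <= lambda j (scov L).
Proof.
have [s [ss szs -> _ h]] := lambda_spectrum (scov_tr L).
(* Indices beyond the dimension read the default 0 of [nth], so the bound holds for every [j]. *)
have [js|js] := ltnP j.-1 (size s); last by rewrite nth_default.
apply: nth_sorted_ge => //; apply: (leq_trans js); rewrite szs.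
rewrite (eq_count (_ : _ =1 (fun x => 0 <= 1 * x))); last by move=> x; rewrite mul1r.
apply: (h _ 1%:M); first by rewrite row_free_unit unitmx1.
move=> u; rewrite mul0r mul1r qform_scov tavg_ge0 // => t _; exact: sqn_ge0.
Qed.

(** The [i]-th diagonal entry of [A^T *m A], whose growth is the strength of column [i]. *)
Definition colsq p k (A : 'M[R]_(p, k)) (i : 'I_k) : R := \sum_l A l i ^+ 2.

Lemma sqn_loading_ge p k (A : 'M[R]_(p, k)) (s m : R) (y : 'rV[R]_k) (Q : pred 'I_k) :
  0 < s -> 0 < m -> (forall i, Q i -> m <= colsq A i) -> (forall i, ~~ Q i -> y 0 i = 0) ->
  s * (\sum_i y 0 i ^+ 2 * colsq A i) <= sqn (y *m A^T) ->
  s * m * sqn (y *m A^T) <= sqn (y *m A^T *m A).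
Proof.
move=> s0 m0 hm hy hs; set x := y *m A^T in hs *.
set u := \sum_i _ in hs.
have uE : u = \sum_(i | Q i) y 0 i ^+ 2 * colsq A i.
  rewrite [RHS]big_mkcond; apply: eq_bigr => i _.
  by case: ifPn => // /hy ->; rewrite expr0n mul0r.
have xE : sqn x = \sum_(i | Q i) y 0 i * (x *m A) 0 i.
  rewrite sqnE {2}/x trmx_mul trmxK mulmxA [LHS]mxE [RHS]big_mkcond; apply: eq_bigr => i _.
  by rewrite [y^T i 0]mxE mulrC; case: ifPn => // /hy ->; rewrite mul0r.
have w0 : 0 <= \sum_(i | Q i) (x *m A) 0 i ^+ 2 by apply: sumr_ge0 => i _; exact: sqr_ge0.
have le1 : \sum_(i | Q i) (x *m A) 0 i ^+ 2 <= sqn (x *m A).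
  by rewrite /sqn [leRHS](bigID Q) /= lerDl sumr_ge0 // => i _; exact: sqr_ge0.
have le2 : m * \sum_(i | Q i) y 0 i ^+ 2 <= u.
  rewrite uE mulr_sumr; apply: ler_sum => i Qi.
  by rewrite mulrC ler_wpM2l ?sqr_ge0 ?hm.
have := cauchy_schwarz_sum Q (y 0) ((x *m A) 0); rewrite -xE => cs.
have [->|x0] := eqVneq (sqn x) 0; first by rewrite mulr0 sqn_ge0.
have sx : 0 < sqn x by rewrite lt_neqAle sqn_ge0 eq_sym x0.
rewrite -(ler_pM2r sx) (le_trans _ (ler_wpM2r (ltW sx) le1)) //.
rewrite -(mulrA (s * m)) -expr2 (le_trans (ler_wpM2l (ltW (mulr_gt0 s0 m0)) cs)) //.
rewrite mulrA [leRHS]mulrC ler_wpM2r //.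
by rewrite -mulrA (le_trans _ hs) // ler_wpM2l // ltW.
Qed.

Lemma sqn_loading_le p k (A : 'M[R]_(p, k)) (x : 'rV[R]_p) (Q : pred 'I_k) :
  (forall i, ~~ Q i -> (x *m A) 0 i = 0) ->
  sqn (x *m A) <= (\sum_(i | Q i) colsq A i) * sqn x.
Proof.
move=> hx; rewrite /sqn (bigID Q) /= [X in _ + X]big1 ?addr0; last first.
  by move=> i /hx ->; rewrite expr0n.
rewrite mulr_suml; apply: ler_sum => i _.
by rewrite mxE mulrC cauchy_schwarz_sum.
Qed.

(** * Eigenvalue bounds for fixed loadings, factors and noise *)

Section FactorPlusNoise.
Variables (p q k l : nat) (A : 'M[R]_(p, k)) (C : 'M[R]_(q, l)).
Variables (F : nat -> 'M[R]_(k, l)) (N L : nat -> 'M[R]_(p, q)) (lo hi nu : R).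
Hypothesis LE : forall t, (1 <= t <= T)%N -> L t = A *m F t *m C^T + N t.
Hypothesis Flo : forall y, lo * sqn y <= tavg (fun t => sqn (y *m F t *m C^T)).
Hypothesis Fhi : forall y, tavg (fun t => sqn (y *m F t *m C^T)) <= hi * sqn y.
Hypothesis Nle : forall x, tavg (fun t => sqn (x *m N t)) <= nu * sqn x.

Lemma scov_qform_ge x : 2^-1 * (lo * sqn (x *m A)) - nu * sqn x <= qform (scov L) x.
Proof.
have h0 : 0 <= 2^-1 :> R by rewrite invr_ge0.
rewrite qform_scov; apply: le_trans (lerB (ler_wpM2l h0 (Flo (x *m A))) (Nle x)) _.
rewrite -mulN1r -!tavgZ -tavgD; apply: ler_tavg => t tT.
by rewrite LE // mulmxDr !mulmxA mulN1r sqnD_ge.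
Qed.

Lemma scov_qform_le x : qform (scov L) x <= 2 * (hi * sqn (x *m A)) + 2 * (nu * sqn x).
Proof.
rewrite qform_scov (le_trans _ (lerD (ler_wpM2l _ (Fhi (x *m A))) (ler_wpM2l _ (Nle x)))) //.
rewrite -!tavgZ -tavgD; apply: ler_tavg => t tT.
by rewrite LE // mulmxDr !mulmxA sqnD_le.
Qed.

(** The test space is spanned by the first [j] columns of [A]: [J] embeds [j] coordinates into [k],
    and the last hypothesis makes these columns independent. On this space [sqn_loading_ge] bounds
    the factor part from below. *)
Lemma lambda_factor_ge (s m : R) j : 0 <= lo -> (1 <= j <= k)%N -> 0 < s -> 0 < m ->
  (forall i : 'I_k, (i < j)%N -> m <= colsq A i) ->
  (forall y : 'rV_k, s * (\sum_i y 0 i ^+ 2 * colsq A i) <= sqn (y *m A^T)) ->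
  2^-1 * lo * (s * m) - nu <= lambda j (scov L).
Proof.
move=> lo0 /andP[j1 jk] s0 m0 hm hs.
pose J : 'M[R]_(j, k) := \matrix_(a, b) ((a : nat) == b)%:R.
have uJ (u : 'rV_j) (i : 'I_k) : ~~ (i < j)%N -> (u *m J) 0 i = 0.
  move=> ij; rewrite mxE big1 // => a _; rewrite mxE; case: eqP => [e|]; last by rewrite mulr0.
  by move: ij; rewrite -e ltn_ord.
have uJ1 (u : 'rV_j) (a : 'I_j) : (u *m J) 0 (widen_ord jk a) = u 0 a.
  rewrite mxE (bigD1 a) //= mxE eqxx mulr1 big1 ?addr0 // => b ba; rewrite mxE /=.
  by rewrite (negPf ba : ((b : nat) == a) = false) mulr0.
have main (u : 'rV_j) := sqn_loading_ge s0 m0 hm (uJ u) (hs (u *m J)).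
apply: (@lambda_ge _ _ _ _ (J *m A^T)) => //; first exact: scov_tr.
  apply: inj_row_free => u; rewrite mulmxA => uA; apply/rowP => a; rewrite mxE.
  have := hs (u *m J); rewrite uA (_ : sqn 0 = 0) => [h|]; last by apply/eqP; rewrite sqn_eq0.
  have nn i : 0 <= (u *m J) 0 i ^+ 2 * colsq A i.
    by rewrite mulr_ge0 ?sqr_ge0 // sumr_ge0 // => b _; exact: sqr_ge0.
  have : (u *m J) 0 (widen_ord jk a) ^+ 2 * colsq A (widen_ord jk a) <= 0.
    move: h; rewrite pmulr_rle0 // (bigD1 (widen_ord jk a)) //=; apply: le_trans.
    by rewrite lerDl sumr_ge0.
  have zp : 0 < colsq A (widen_ord jk a) by apply: lt_le_trans m0 (hm _ _) => /=.
  by rewrite pmulr_lle0 // uJ1 real_exprn_even_le0 ?num_real //= => /eqP.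
move=> u; rewrite mulmxA (le_trans _ (scov_qform_ge _)) // mulrBl lerD2r -!mulrA ler_wpM2l ?invr_ge0 //.
by rewrite ler_wpM2l // mulrA.
Qed.

(** The test space is the orthogonal complement of the first [j.-1] columns of [A], of dimension at
    least [p - j.-1]. Only columns with ordinal at least [j.-1] survive on it, and none does once
    [j] exceeds [k]. *)
Lemma lambda_factor_le j : 0 <= hi -> (1 <= j <= p)%N ->
  lambda j (scov L) <= 2 * hi * (\sum_(i < k | (j.-1 <= i)%N) colsq A i) + 2 * nu.
Proof.
move=> hi0 jp.
pose J : 'M[R]_(k, j.-1) := \matrix_(a, b) ((a : nat) == b)%:R.
apply: (@lambda_le _ _ _ _ (row_base (kermx (A *m J)))) => //.
- exact: scov_tr.
- by have := rank_leq_col (A *m J); rewrite mxrank_ker; lia.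
- exact: row_base_free.
move=> u; set x := u *m _.
have xJ : x *m A *m J = 0.
  by rewrite -mulmxA /x; apply/sub_kermxP; rewrite (submx_trans (submxMl _ _)) // eq_row_base.
have hx (i : 'I_k) : ~~ (j.-1 <= i)%N -> (x *m A) 0 i = 0.
  rewrite -ltnNge => ij; have /rowP/(_ (Ordinal ij)) := xJ.
  rewrite mxE [RHS]mxE (bigD1 i) //= [J _ _]mxE /= eqxx mulr1 big1 ?addr0 // => b bi.
  rewrite [J _ _]mxE /=.
  by rewrite (negPf bi : ((b : nat) == i) = false) mulr0.
apply: le_trans (scov_qform_le _) _.
rewrite [leRHS]mulrDl -(mulrA 2 nu) lerD2r -2!(mulrA 2) -(mulrA hi) !ler_wpM2l //.
exact: (@sqn_loading_le _ _ _ _ (fun i => (j.-1 <= i)%N)).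
Qed.

End FactorPlusNoise.
End SampleCovariance.

(** * Quadratic forms of the factor and noise parts *)

Section EventBounds.
Variable R : realType.

(** Coordinate [c] of [y *m F t *m C^T] is linear in the entries of [F t], with coefficients [z c],
    the tensor product of [y] and row [c] of [C]. Applying [form_near_sqn] to each [c] and adding
    the squared norms of the [z c] produces [fro C * sqn y]. *)
Lemma factor_form_near (T k l q : nat) (F : nat -> 'M[R]_(k, l)) (C : 'M[R]_(q, l)) (eta : R)
    (y : 'rV[R]_k) :
  0 <= eta ->
  (forall i j i' j', `|tavg T (fun t => F t i j * F t i' j') - ((i, j) == (i', j'))%:R| <= eta) ->
  `|tavg T (fun t => sqn (y *m F t *m C^T)) - fro C * sqn y|
    <= eta * (k * l)%:R * (fro C * sqn y).
Proof.
move=> eta0 hF.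
pose z (c : 'I_q) (a : 'I_k * 'I_l) := y 0 a.1 * C c a.2.
pose G (a b : 'I_k * 'I_l) := tavg T (fun t => F t a.1 a.2 * F t b.1 b.2).
have zE c : \sum_a z c a ^+ 2 = sqn y * sqn (row c C).
  rewrite -(pair_bigA _ (fun i j => z c (i, j) ^+ 2)) mulr_suml /=.
  apply: eq_bigr => i _; rewrite mulr_sumr; apply: eq_bigr => j _.
  by rewrite /z /= exprMn mxE.
have avE : tavg T (fun t => sqn (y *m F t *m C^T)) =
    \sum_c \sum_a \sum_b z c a * z c b * G a b.
  rewrite tavg_sum; apply: eq_bigr => c _.
  under [RHS]eq_bigr => a _ do under eq_bigr => b _ do rewrite -tavgZ.
  under [RHS]eq_bigr => a _ do rewrite -tavg_sum.
  rewrite -tavg_sum; apply: eq_tavg => t _.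
  have -> : (y *m F t *m C^T) 0 c = \sum_(a : 'I_k * 'I_l) z c a * F t a.1 a.2.
    rewrite -(pair_bigA _ (fun i j => z c (i, j) * F t i j)) /= exchange_big /= mxE.
    apply: eq_bigr => j _; rewrite mxE mulr_suml; apply: eq_bigr => i _.
    by rewrite /z /= !mxE mulrAC.
  rewrite expr2 mulr_suml; apply: eq_bigr => a _; rewrite mulr_sumr; apply: eq_bigr => b _.
  by rewrite mulrACA.
have fE : fro C * sqn y = \sum_c \sum_a z c a ^+ 2.
  by rewrite fro_rows mulr_suml; apply: eq_bigr => c _; rewrite zE mulrC.
rewrite avE fE -sumrB (le_trans (ler_norm_sum _ _ _)) // mulr_sumr; apply: ler_sum => c _.
have -> : (k * l)%N = #|{: 'I_k * 'I_l}| by rewrite card_prod !card_ord.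
apply: form_near_sqn => // -[i j] [i' j'].
exact: hF.
Qed.

(* The diagonal part of the noise sample covariance has order q; only its
   centred part is averaged out over time. *)
Lemma noise_form_le (T p q k l : nat) (B : 'M[R]_(p, k)) (D : 'M[R]_(q, l))
    (Fe : nat -> 'M[R]_(k, l)) (S : 'M[R]_(p, q)) (e : nat -> 'M[R]_(p, q)) (hi v : R)
    (x : 'rV[R]_p) :
  (0 < T)%N -> 0 <= v -> (forall i j, 0 <= S i j <= hi) ->
  \sum_i \sum_i' (tavg T (fun t => \sum_j S i j * S i' j *
      (e t i j * e t i' j - (i == i')%:R))) ^+ 2 <= v ^+ 2 ->
  tavg T (fun t => sqn (x *m (centering_mx R p *m
      (B *m Fe t *m D^T + map2_mx *%R S (e t)) *m centering_mx R q)))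
  <= (2 * (fro B * fro D * tavg T (fun t => fro (Fe t))) + 2 * (hi ^+ 2 * q%:R + v)) * sqn x.
Proof.
move=> T0 v0 hS hV; set z := x *m centering_mx R p.
have zx : sqn z <= sqn x by exact: sqn_centering_le.
pose V i i' := tavg T (fun t => \sum_j S i j * S i' j * (e t i j * e t i' j - (i == i')%:R)).
have {}hV : \sum_i \sum_i' V i i' ^+ 2 <= v ^+ 2 := hV.
have c0 : 0 <= 2 * (fro B * fro D * tavg T (fun t => fro (Fe t))) + 2 * (hi ^+ 2 * q%:R + v).
  have := tavg_ge0 (fun t (_ : (1 <= t <= T)%N) => fro_ge0 (Fe t)).
  have := fro_ge0 B; have := fro_ge0 D => ? ? ?.
  apply: addr_ge0; apply: mulr_ge0 => //; first by do 2! apply: mulr_ge0 => //.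
  by rewrite addr_ge0 // mulr_ge0 ?sqr_ge0.
apply: le_trans (ler_wpM2l c0 zx).
(* Subtracting [(i == i')%:R], the mean product of standardized uncorrelated entries, splits the
   form into the fluctuation [V] and a diagonal part. *)
have idio : tavg T (fun t => sqn (z *m map2_mx *%R S (e t))) =
  \sum_i \sum_i' z 0 i * z 0 i' * V i i' + \sum_i z 0 i ^+ 2 * \sum_j S i j ^+ 2.
  have -> : \sum_i z 0 i ^+ 2 * \sum_j S i j ^+ 2 =
    \sum_i \sum_i' z 0 i * z 0 i' * ((i == i')%:R * \sum_j S i j * S i' j).
    apply: eq_bigr => i _; rewrite (bigD1 i) //= eqxx mul1r [X in _ = _ + X]big1 ?addr0.
      by rewrite -expr2; under [in RHS]eq_bigr do rewrite -expr2.
    by move=> i' /negPf ii'; rewrite eq_sym ii' mul0r mulr0.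
  rewrite -big_split /=.
  under [RHS]eq_bigr => i _ do rewrite -big_split /=.
  under [RHS]eq_bigr => i _ do under eq_bigr => i' _ do
    rewrite -mulrDr -(tavg_cst (_ * \sum_j _) T0) -tavgD -tavgZ.
  under [RHS]eq_bigr => i _ do rewrite -tavg_sum.
  rewrite -tavg_sum; apply: eq_tavg => t _.
  transitivity (\sum_j \sum_i \sum_i' z 0 i * z 0 i' * (S i j * e t i j * (S i' j * e t i' j))).
    apply: eq_bigr => j _; rewrite mxE expr2 mulr_suml; apply: eq_bigr => i _.
    by rewrite mulr_sumr; apply: eq_bigr => i' _; rewrite !mxE mulrACA.
  rewrite exchange_big /=; apply: eq_bigr => i _; rewrite exchange_big /=.
  apply: eq_bigr => i' _; rewrite mulr_sumr -big_split mulr_sumr /=; apply: eq_bigr => j _.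
  by congr (_ * _); ring.
have common : tavg T (fun t => sqn (z *m (B *m Fe t *m D^T))) <=
    fro B * fro D * tavg T (fun t => fro (Fe t)) * sqn z.
  rewrite -tavgZ -tavgZr; apply: ler_tavg => t _.
  rewrite (le_trans (sqn_mul_le _ _)) // ler_wpM2r ?sqn_ge0 //.
  rewrite (le_trans (fro_mul_le _ _)) // fro_tr mulrAC ler_wpM2r ?fro_ge0 //.
  exact: fro_mul_le.
have diag : \sum_i z 0 i ^+ 2 * \sum_j S i j ^+ 2 <= hi ^+ 2 * q%:R * sqn z.
  rewrite mulr_sumr; apply: ler_sum => i _; rewrite mulrC ler_wpM2r ?sqr_ge0 //.
  rewrite -[q in leRHS]card_ord mulr_natr -sumr_const; apply: ler_sum => j _.
  by have /andP[? ?] := hS i j; rewrite lerXn2r // nnegrE // (le_trans _ (_ : S i j <= _)).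
(* Cauchy-Schwarz over pairs of indices: a quadratic form is at most the Frobenius norm of its
   matrix times [sqn z]. *)
have offd : \sum_i \sum_i' z 0 i * z 0 i' * V i i' <= v * sqn z.
  rewrite pair_bigA /=; set W := (X in X <= _).
  have := cauchy_schwarz_sum predT (fun a : 'I_p * 'I_p => z 0 a.1 * z 0 a.2) (fun a => V a.1 a.2).
  rewrite -/W -(pair_bigA _ (fun i i' => V i i' ^+ 2)) /=.
  rewrite -(pair_bigA _ (fun i i' => (z 0 i * z 0 i') ^+ 2)) /=.
  have -> : \sum_i \sum_i' (z 0 i * z 0 i') ^+ 2 = sqn z ^+ 2.
    rewrite /sqn [RHS]expr2 mulr_suml; apply: eq_bigr => i _; rewrite mulr_sumr.
    by apply: eq_bigr => i' _; rewrite exprMn.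
  move=> h; rewrite (le_trans (ler_norm _)) // -ler_sqr ?nnegrE ?mulr_ge0 ?sqn_ge0 //.
  rewrite real_normK ?num_real // (le_trans h) // exprMn mulrC ler_wpM2r ?sqr_ge0 //.
apply: (@le_trans _ _ (2 * tavg T (fun t => sqn (z *m (B *m Fe t *m D^T)))
    + 2 * tavg T (fun t => sqn (z *m map2_mx *%R S (e t))))).
  rewrite -!tavgZ -tavgD; apply: ler_tavg => t _.
  rewrite !mulmxA -/z; apply: le_trans (sqn_centering_le _) _; by rewrite mulmxDr !(mulmxA z) sqnD_le.
rewrite [leRHS]mulrDl -2!(mulrA 2) lerD // ler_wpM2l //.
by rewrite idio [leRHS]mulrDl addrC lerD.
Qed.

End EventBounds.

(** * Moments of weighted sums of products of independent variables *)

Section RealExpectation.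
Context {R : realType} {d : measure_display} {Omega : measurableType d}.
Variable P : probability Omega R.

Definition intg (f : Omega -> R) := P.-integrable setT (fun w => (f w)%:E).

Lemma intg_cst c : intg (fun=> c).
Proof. by apply: finite_measure_integrable_cst. Qed.

Lemma intgD f g : intg f -> intg g -> intg (fun w => f w + g w).
Proof. by move=> hf hg; apply: eq_integrable (integrableD _ hf hg). Qed.

Lemma intgZ c f : intg f -> intg (fun w => c * f w).
Proof. by move=> hf; apply: eq_integrable (integrableZl _ c hf). Qed.

Lemma intgB f g : intg f -> intg g -> intg (fun w => f w - g w).
Proof. by move=> hf hg; apply: eq_integrable (integrableB _ hf hg). Qed.

Lemma intg_sum (K : Type) (s : seq K) (f : K -> Omega -> R) :
  (forall k, intg (f k)) -> intg (fun w => \sum_(k <- s) f k w).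
Proof.
move=> hf; elim: s => [|k s IH].
  by under eq_fun do rewrite big_nil; exact: intg_cst.
by under eq_fun do rewrite big_cons; exact: intgD.
Qed.

Lemma intg_le (f g : Omega -> R) : measurable_fun setT f ->
  (forall w, `|f w| <= g w) -> intg g -> intg f.
Proof.
move=> mf fg; apply: le_integrable => //; first exact/measurable_EFinP.
by move=> w _ /=; rewrite lee_fin (le_trans (fg w)) // ler_norm.
Qed.

Lemma RintgD f g : intg f -> intg g ->
  \int[P]_w (f w + g w) = \int[P]_w f w + \int[P]_w g w.
Proof. by move=> hf hg; rewrite RintegralD. Qed.

Lemma RintgB f g : intg f -> intg g ->
  \int[P]_w (f w - g w) = \int[P]_w f w - \int[P]_w g w.
Proof. by move=> hf hg; rewrite RintegralB. Qed.

Lemma RintgZ c f : intg f -> \int[P]_w (c * f w) = c * \int[P]_w f w.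
Proof. by move=> hf; rewrite RintegralZl. Qed.

Lemma Rintegral_sum (K : Type) (s : seq K) (f : K -> Omega -> R) :
  (forall k, intg (f k)) ->
  \int[P]_w (\sum_(k <- s) f k w) = \sum_(k <- s) \int[P]_w f k w.
Proof.
move=> hf; elim: s => [|k s IH].
  by under eq_Rintegral do rewrite big_nil; rewrite big_nil Rintegral_cst // mul0r.
under eq_Rintegral do rewrite big_cons; rewrite big_cons RintegralD ?IH //.
  exact: hf.
exact: (intg_sum s hf).
Qed.

Lemma Rintegral_pcst c : \int[P]_w c = c.
Proof.
rewrite Rintegral_cst // (_ : fine _ = 1) ?mulr1 //.
exact: (congr1 fine (@probability_setT _ _ _ P)).
Qed.

End RealExpectation.

(** * Expectations of products of independent variables *)

Section IndependentProducts.
Context {R : realType} {d : measure_display} {Omega : measurableType d}.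
Variable P : probability Omega R.

(** The identity passes from indicators to simple functions by linearity and to [f] by monotone
    convergence. Any nonnegative measurable [h] is allowed, so [h] can collect all the other
    variables. *)
Lemma integral_comp_ge0_eq (h X : Omega -> R) (r : R) :
  measurable_fun setT h -> measurable_fun setT X -> (forall w, 0 <= h w) -> 0 <= r ->
  (forall B, measurable B ->
    (\int[P]_w (\1_B (X w) * h w)%:E = r%:E * P (X @^-1` B))%E) ->
  forall f : R -> R, measurable_fun setT f -> (forall x, 0 <= f x) ->
    (\int[P]_w (f (X w) * h w)%:E = r%:E * \int[P]_w (f (X w))%:E)%E.
Proof.
move=> mh mX h0 r0 hB f mf f0.
have mf' : measurable_fun [set: R] (EFin \o f) by exact/measurable_EFinP.
pose g := nnsfun_approx measurableT mf'.
have g0 n x : 0 <= g n x by exact: fun_ge0.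
have mg n : measurable_fun setT (g n \o X) by apply: measurableT_comp.
have gf x : (g n x)%:E @[n --> \oo] --> (f x)%:E.
  by apply: cvg_nnsfun_approx => // y _; rewrite lee_fin.
have ndg x : {homo (fun n => g n x) : m n / (m <= n)%N >-> m <= n}.
  by move=> m n mn; have /lefP := nd_nnsfun_approx measurableT mf' mn; exact.
have step n : (\int[P]_w (g n (X w) * h w)%:E = r%:E * \int[P]_w (g n (X w))%:E)%E.
  pose s : seq R := finmap.enum_fset (fset_set (range (g n))).
  (* On the range of [g n] the absolute value changes nothing; it makes each summand nonnegative for
     every [y], as integration of nonnegative sums requires. *)
  have e1 w : g n (X w) = \sum_(y <- s) `|y| * \1_(g n @^-1` [set y]) (X w).
    rewrite {1}(fimfunE (g n)) fsbig_finite //=; apply: eq_big_seq => y.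
    by rewrite in_fset_set // inE => -[x _ <-]; rewrite ger0_norm.
  have mB y : measurable (g n @^-1` [set y]) by exact: measurable_sfunP.
  have mi y : measurable_fun setT (fun w => \1_(g n @^-1` [set y]) (X w) : R).
    by apply: measurableT_comp => //; exact: measurable_indic.
  have i0 y w : 0 <= (\1_(g n @^-1` [set y]) (X w) : R) by rewrite indicE ler0n.
  under eq_integral => w _ do rewrite e1 mulr_suml -sumEFin.
  under [in RHS]eq_integral => w _ do rewrite e1 -sumEFin.
  rewrite !ge0_integral_sum //.
  - rewrite ge0_sume_distrr; last by move=> y _; apply: integral_ge0 => w _; rewrite lee_fin mulr_ge0 // indicE ler0n.
    apply: eq_bigr => y _.
    under eq_integral => w _ do rewrite -mulrA EFinM.
    under [in RHS]eq_integral => w _ do rewrite EFinM.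
    rewrite !ge0_integralZl_EFin //.
    + rewrite hB // muleCA; congr (_ * (_ * _))%E.
      have mA : measurable (X @^-1` (g n @^-1` [set y])).
        by rewrite -[_ @^-1` _]setTI; exact: mX.
      by have := integral_indic P measurableT mA; rewrite setIT => <-.
    + by apply/measurable_EFinP.
    + by move=> w _; rewrite lee_fin mulr_ge0.
    + by apply/measurable_EFinP; apply: measurable_funM.
  - by move=> y; apply/measurable_EFinP; apply: measurable_funM.
  - by move=> y; apply/measurable_EFinP; apply: measurable_funM => //; apply: measurable_funM.
  - by move=> y w _; rewrite lee_fin !mulr_ge0.
have c1 : (\int[P]_w (g n (X w) * h w)%:E @[n --> \oo] --> \int[P]_w (f (X w) * h w)%:E)%E.
  have lim1 w : limn (fun n => (g n (X w) * h w)%:E) = (f (X w) * h w)%:E.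
    apply/cvg_lim => //; under eq_fun do rewrite EFinM; rewrite EFinM.
    by apply: cvgeZr.
  under [X in _ --> X]eq_integral => w _ do rewrite -lim1.
  apply: (@cvg_monotone_convergence _ _ _ P setT measurableT (fun n w => (g n (X w) * h w)%:E)).
  - by move=> n; apply/measurable_EFinP; apply: measurable_funM => //; exact: mg.
  - by move=> n w _; rewrite lee_fin mulr_ge0.
  - by move=> w _ m n mn; rewrite lee_fin ler_wpM2r // ndg.
have c2 : (\int[P]_w (g n (X w))%:E @[n --> \oo] --> \int[P]_w (f (X w))%:E)%E.
  have lim2 w : limn (fun n => (g n (X w))%:E) = (f (X w))%:E by apply/cvg_lim => //.
  under [X in _ --> X]eq_integral => w _ do rewrite -lim2.
  apply: (@cvg_monotone_convergence _ _ _ P setT measurableT (fun n w => (g n (X w))%:E)).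
  - by move=> n; apply/measurable_EFinP; exact: mg.
  - by move=> n w _; rewrite lee_fin.
  - by move=> w _ m n mn; rewrite lee_fin ndg.
have c3 := cvgeZl (isT : r%:E \is a fin_num) c2.
have e : (fun n => \int[P]_w (g n (X w) * h w)%:E)%E = (fun n => r%:E * \int[P]_w (g n (X w))%:E)%E.
  by apply/funext => n; exact: step.
rewrite e in c1; exact: cvg_unique c1 c3.
Qed.

Section Product.
Variables (I : eqType) (X : I -> Omega -> R).
Hypothesis mX : forall i, measurable_fun setT (X i).
Hypothesis indX : mutually_independent P X.

(** Induction on [s1] replaces indicators by functions one variable at a time. When [s1] is empty
    the identity is the definition of independence; in the inductive step the remaining factors form
    the [h] of [integral_comp_ge0_eq]. *)
Lemma expectation_prod_ge0_indic (s1 s2 : seq I) (f : I -> R -> R) (B : I -> set R) :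
  uniq (s1 ++ s2) -> (forall i, measurable (B i)) ->
  (forall i, measurable_fun setT (f i)) -> (forall i x, 0 <= f i x) ->
  (forall i, i \in s1 -> P.-integrable setT (fun w => (f i (X i w))%:E)) ->
  (\int[P]_w ((\prod_(i <- s1) f i (X i w)) * \prod_(i <- s2) \1_(B i) (X i w))%:E =
   ((\prod_(i <- s1) \int[P]_w f i (X i w))%R * (\prod_(i <- s2) fine (P (X i @^-1` B i)))%R)%:E)%E.
Proof.
move=> + + mf f0; elim: s1 s2 B => [|i s1 IH] s2 B us mB fint.
  rewrite big_nil mul1r.
  under eq_integral => w _ do rewrite big_nil mul1r.
  have mpre i : measurable (X i @^-1` B i) by rewrite -[_ @^-1` _]setTI; exact: mX.
  have -> : (fun w => (\prod_(i <- s2) \1_(B i) (X i w))%:E) =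
      (fun w => (\1_(\big[setI/setT]_(i <- s2) (X i @^-1` B i)) w : R)%:E).
    apply/funext => w; congr (_%:E); elim: s2 {us} => [|j s2 IH]; first by rewrite !big_nil indicT.
    by rewrite !big_cons indicI IH.
  rewrite integral_indic //; last by apply: bigsetI_measurable => j _; exact: mpre.
  rewrite setIT -prodEFin; apply: (etrans (indX us mB)); apply: eq_bigr => j _.
  by rewrite /= fineK // fin_num_measure.
have us' : uniq (s1 ++ i :: s2).
  by rewrite -(perm_uniq (permEl (perm_catCA [:: i] s1 s2))).
have iNs1 : i \notin s1 by move: us => /= /andP[]; rewrite mem_cat negb_or => /andP[].
have iNs2 : i \notin s2 by move: us => /= /andP[]; rewrite mem_cat negb_or => /andP[].
have int1 j : j \in s1 -> P.-integrable setT (fun w => (f j (X j w))%:E).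
  by move=> js; apply: fint; rewrite inE js orbT.
pose h w := (\prod_(j <- s1) f j (X j w)) * \prod_(j <- s2) \1_(B j) (X j w).
pose r := (\prod_(j <- s1) \int[P]_w f j (X j w)) * \prod_(j <- s2) fine (P (X j @^-1` B j)).
have r0 : 0 <= r.
  rewrite mulr_ge0 // prodr_ge0 // => j _; first by apply: Rintegral_ge0.
  by rewrite fine_ge0.
have mh : measurable_fun setT h.
  apply: measurable_funM; apply: measurable_prod => j _.
    by apply: measurableT_comp.
  by apply: measurableT_comp => //; exact: measurable_indic.
have h0 w : 0 <= h w.
  by rewrite mulr_ge0 // prodr_ge0 // => j _; rewrite indicE ler0n.
have step C : measurable C -> (\int[P]_w (\1_C (X i w) * h w)%:E = r%:E * P (X i @^-1` C))%E.
  (* Variable [i] is moved to the indicators with the set [C]; the other sets are unaffected because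
     [i] does not occur in [s2]. *)
  move=> mC; pose B' j := if j == i then C else B j.
  have mB' j : measurable (B' j) by rewrite /B'; case: ifP.
  have B'i : B' i = C by rewrite /B' eqxx.
  have B'E j : j \in s2 -> B' j = B j.
    by rewrite /B'; case: eqP => // ->; rewrite (negPf iNs2).
  have := IH (i :: s2) B' us' mB' int1.
  rewrite big_cons B'i.
  under [X in _ = (_ * (_ * X))%:E]eq_big_seq => j js do rewrite B'E //.
  rewrite [X in _ = X%:E]mulrCA mulrC EFinM -/r fineK ?fin_num_measure // => [<-|].
    apply: eq_integral => w _; rewrite big_cons B'i mulrCA.
    by congr (_ * (_ * _))%:E; apply: eq_big_seq => j js; rewrite B'E.
  by rewrite -[_ @^-1` _]setTI; exact: mX.
under eq_integral => w _ do rewrite big_cons -mulrA -/(h w).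
rewrite (integral_comp_ge0_eq mh (mX i) h0 r0 step (mf i) (f0 i)).
rewrite big_cons -mulrA -/r EFinM muleC; congr (_ * _)%E.
rewrite /Rintegral fineK //; apply: integrable_fin_num => //; apply: fint.
by rewrite inE eqxx.
Qed.

Lemma expectation_prod_ge0 (s : seq I) (f : I -> R -> R) : uniq s ->
  (forall i, measurable_fun setT (f i)) -> (forall i, i \in s -> forall x, 0 <= f i x) ->
  (forall i, i \in s -> P.-integrable setT (fun w => (f i (X i w))%:E)) ->
  (\int[P]_w (\prod_(i <- s) f i (X i w))%:E = (\prod_(i <- s) \int[P]_w f i (X i w))%:E)%E.
Proof.
move=> us mf f0 fint.
have nE w : \prod_(i <- s) f i (X i w) = \prod_(i <- s) `|f i (X i w)|.
  by apply: eq_big_seq => i si; rewrite ger0_norm ?f0.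
have us' : uniq (s ++ [::]) by rewrite cats0.
have := @expectation_prod_ge0_indic s [::] (fun i x => `|f i x|) (fun=> setT) us'.
rewrite big_nil mulr1 => h; under eq_integral => w _ do rewrite nE.
rewrite -(_ : \prod_(i <- s) \int[P]_w `|f i (X i w)| = \prod_(i <- s) \int[P]_w f i (X i w)); last first.
  by apply: eq_big_seq => i si; apply: eq_Rintegral => w _; rewrite ger0_norm ?f0.
rewrite -h //.
- by apply: eq_integral => w _; rewrite big_nil mulr1.
- by move=> i; apply: measurableT_comp.
- move=> i si; apply: eq_integrable (fint i si) => // w _.
  by rewrite ger0_norm ?f0.
Qed.

Lemma integrable_prod (s : seq I) (f : I -> R -> R) : uniq s ->
  (forall i, measurable_fun setT (f i)) ->
  (forall i, i \in s -> P.-integrable setT (fun w => (f i (X i w))%:E)) ->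
  P.-integrable setT (fun w => (\prod_(i <- s) f i (X i w))%:E).
Proof.
move=> us mf fint; apply/integrableP; split.
  apply/measurable_EFinP; apply: measurable_prod => i _.
  by apply: measurableT_comp.
under eq_integral => w _ do rewrite /= normr_prod.
rewrite (@expectation_prod_ge0 s (fun i x => `|f i x|)) ?ltry //.
  by move=> i; apply: measurableT_comp.
by move=> i si; have /integrable_norm := fint i si.
Qed.

(** Functions listed in [s1] may change sign, those in [s2] may not. Each step of the induction
    splits one signed function into positive and negative parts and moves both to the nonnegative
    side. *)
Lemma expectation_prod (s : seq I) (f : I -> R -> R) : uniq s ->
  (forall i, measurable_fun setT (f i)) ->
  (forall i, i \in s -> P.-integrable setT (fun w => (f i (X i w))%:E)) ->
  \int[P]_w (\prod_(i <- s) f i (X i w)) = \prod_(i <- s) \int[P]_w f i (X i w).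
Proof.
suff main (s1 s2 : seq I) (g : I -> R -> R) :
    (forall i, i \in s2 -> forall x, 0 <= g i x) -> uniq (s1 ++ s2) ->
    (forall i, measurable_fun setT (g i)) ->
    (forall i, i \in s1 ++ s2 -> P.-integrable setT (fun w => (g i (X i w))%:E)) ->
    \int[P]_w (\prod_(i <- s1 ++ s2) g i (X i w)) = \prod_(i <- s1 ++ s2) \int[P]_w g i (X i w).
  by have := main s [::] f; rewrite cats0; apply.
move: {s f} g; elim: s1 s2 => [|i s1 IH] s2 f f0 us mf fint.
  by rewrite /Rintegral expectation_prod_ge0.
have us' : uniq (s1 ++ i :: s2).
  by rewrite -(perm_uniq (permEl (perm_catCA [:: i] s1 s2))).
have mem_eq : s1 ++ i :: s2 =i (i :: s1) ++ s2.
  by apply/perm_mem; rewrite perm_sym (permEl (perm_catCA [:: i] s1 s2)).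
have iN : i \notin s1 ++ s2 by move: us => /= /andP[].
have iNs2 : i \notin s2 by move: iN; rewrite mem_cat negb_or => /andP[].
(* For [e = 1] and [e = -1] this replaces [f i] by its positive and its negative part. *)
pose g (e : R) j x := if j == i then Num.max (e * f j x) 0 else f j x.
have gi e x : g e i x = Num.max (e * f i x) 0 by rewrite /g eqxx.
have gj e j : j != i -> g e j = f j by move=> /negPf ji; apply/funext => x; rewrite /g ji.
have mg e j : measurable_fun setT (g e j).
  rewrite /g; case: eqP => // _; apply: measurable_maxr => //.
  exact: measurable_funM.
have g0 e j : j \in i :: s2 -> forall x, 0 <= g e j x.
  rewrite inE /g; case: eqP => [_ _ x|_ /= js2 x]; last exact: f0.
  by rewrite le_max lexx orbT.
have gint e j : `|e| = 1 -> j \in s1 ++ i :: s2 -> P.-integrable setT (fun w => (g e j (X j w))%:E).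
  move=> e1; rewrite mem_eq => /fint fj; rewrite /g; case: eqP => // ji.
  apply: (le_integrable _ _ _ fj) => //.
    apply/measurable_EFinP; apply: measurable_maxr => //.
    by apply: measurable_funM => //; apply: measurableT_comp.
  move=> w _; rewrite lee_fin /= -[leRHS]mul1r -e1 -normrM.
  by rewrite /Num.max; case: ifP => // _; rewrite normr0.
have IHe e : `|e| = 1 -> \int[P]_w (\prod_(j <- s1 ++ i :: s2) g e j (X j w)) =
    (\int[P]_w Num.max (e * f i (X i w)) 0) * \prod_(j <- s1 ++ s2) \int[P]_w f j (X j w).
  move=> e1; rewrite (IH (i :: s2) (g e)) //; [|exact: g0|by move=> j; exact: gint].
  rewrite (perm_big _ (permEl (perm_catCA s1 [:: i] s2))) /= big_cons; congr (_ * _).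
    by under eq_Rintegral => w _ do rewrite gi.
  apply: eq_big_seq => j js; rewrite gj //.
  by apply: contraNneq iN => <-.
have prodE e w : \prod_(j <- s1 ++ i :: s2) g e j (X j w) =
    Num.max (e * f i (X i w)) 0 * \prod_(j <- s1 ++ s2) f j (X j w).
  rewrite (perm_big _ (permEl (perm_catCA s1 [:: i] s2))) /= big_cons gi; congr (_ * _).
  apply: eq_big_seq => j js; rewrite gj //.
  by apply: contraNneq iN => <-.
have split (x : R) : x = Num.max (1 * x) 0 - Num.max (-1 * x) 0.
  rewrite mul1r mulN1r /Num.max oppr_lt0; case: ltgtP => [x0|x0|->]; rewrite ?oppr0 ?subr0 ?opprK ?add0r ?addr0 //.
have n1 : `|-1 : R| = 1 by rewrite normrN normr1.
have intP e : `|e| = 1 -> P.-integrable setT (fun w => (\prod_(j <- s1 ++ i :: s2) g e j (X j w))%:E).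
  by move=> e1; apply: integrable_prod => // j; exact: gint.
rewrite cat_cons big_cons.
have -> : (fun w => \prod_(j <- i :: s1 ++ s2) f j (X j w)) =
    (fun w => \prod_(j <- s1 ++ i :: s2) g 1 j (X j w) - \prod_(j <- s1 ++ i :: s2) g (-1) j (X j w)).
  by apply/funext => w; rewrite !prodE -mulrBl -split big_cons.
rewrite RintegralB //; [|by apply: intP; rewrite normr1|exact: intP].
rewrite !IHe ?normr1 // -mulrBl -RintegralB //.
- by congr (_ * _); apply: eq_Rintegral => w _; rewrite -split.
- have := gint 1 i (normr1 R); rewrite mem_cat inE eqxx orbT => /(_ isT).
  by apply: eq_integrable => // w _; rewrite gi.
- have := gint (-1) i n1; rewrite mem_cat inE eqxx orbT => /(_ isT).
  by apply: eq_integrable => // w _; rewrite gi.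
Qed.

(** * Orthogonality of centred products *)

Section Moments.
Variable b : R.
Hypothesis X1 : forall i, \int[P]_w X i w = 0.
Hypothesis X2 : forall i, \int[P]_w X i w ^+ 2 = 1.
Hypothesis X4 : forall i, (\int[P]_w (X i w ^+ 4)%:E <= b%:E)%E.

Let intg4 i : intg P (fun w => X i w ^+ 4).
Proof.
apply/integrableP; split; first by apply/measurable_EFinP; exact: measurable_funX.
under eq_integral => w _ do rewrite gee0_abs ?lee_fin ?exprn_even_ge0 //.
by rewrite (le_lt_trans (X4 i)) // ltry.
Qed.

Let intg_pow i k : (k <= 4)%N -> intg P (fun w => X i w ^+ k).
Proof.
move=> k4; apply: (@intg_le _ _ _ _ _ (fun w => 1 + X i w ^+ 4)).
- exact: measurable_funX.
- move=> w; rewrite normrX -[X in _ + X]ger0_norm ?exprn_even_ge0 // normrX.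
  have [le1|/ltW ge1] := leP `|X i w| 1.
    by rewrite (le_trans (exprn_ile1 _ (normr_ge0 _) le1)) // lerDl exprn_ge0.
  by rewrite (le_trans (ler_weXn2l ge1 k4)) // lerDr.
- by apply: intgD => //; exact: intg_cst.
Qed.

(** Repeated indices are merged into powers, since independence speaks of distinct variables
    only. *)
Let prod_count (l : seq I) w :
  \prod_(a <- l) X a w = \prod_(i <- undup l) X i w ^+ count_mem i l.
Proof. by rewrite -big_undup_iterop_count. Qed.

Let intg_mono (l : seq I) : (size l <= 4)%N -> intg P (fun w => \prod_(a <- l) X a w).
Proof.
move=> l4; under eq_fun do rewrite prod_count.
apply: (@integrable_prod (undup l) (fun i x => x ^+ count_mem i l)) => [|i|i _].
- exact: undup_uniq.
- exact: measurable_funX.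
- by apply: intg_pow; rewrite (leq_trans _ l4) // count_size.
Qed.

Let E_mono (l : seq I) : (size l <= 4)%N ->
  \int[P]_w (\prod_(a <- l) X a w) = \prod_(i <- undup l) \int[P]_w X i w ^+ count_mem i l.
Proof.
move=> l4; under eq_Rintegral do rewrite prod_count.
apply: (@expectation_prod (undup l) (fun i x => x ^+ count_mem i l)) => [|i|i _].
- exact: undup_uniq.
- exact: measurable_funX.
- by apply: intg_pow; rewrite (leq_trans _ l4) // count_size.
Qed.

Let E_single (l : seq I) a : (size l <= 4)%N -> count_mem a l = 1%N ->
  \int[P]_w (\prod_(a <- l) X a w) = 0.
Proof.
move=> l4 a1; rewrite E_mono // (bigD1_seq a) ?undup_uniq //=.
  by rewrite a1; under eq_Rintegral do rewrite expr1; rewrite X1 mul0r.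
by rewrite mem_undup -has_pred1 has_count a1.
Qed.

Let E2 u v : \int[P]_w (X u w * X v w) = (u == v)%:R.
Proof.
have [<-|uv] := eqVneq u v; first by rewrite -[RHS](X2 u); apply: eq_Rintegral => w _; rewrite expr2.
rewrite /= mulr0n -(@E_single [:: u; v] u) //=; last by rewrite eqxx eq_sym (negPf uv).
by apply: eq_Rintegral => w _; rewrite !big_cons big_nil mulr1.
Qed.

(** Unless the two unordered pairs agree, either [u = v] and [s = t] are distinct and two second
    moments multiply to 1, or some index occurs exactly once and its zero mean annihilates the
    product. *)
Let E4 u v s t : ~~ (((u == s) && (v == t)) || ((u == t) && (v == s))) ->
  \int[P]_w (X u w * X v w * (X s w * X t w)) = (u == v)%:R * (s == t)%:R.
Proof.
have -> : \int[P]_w (X u w * X v w * (X s w * X t w)) =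
    \int[P]_w (\prod_(a <- [:: u; v; s; t]) X a w).
  by apply: eq_Rintegral => w _; rewrite !big_cons big_nil mulr1 !mulrA.
have [<-|uv] := eqVneq u v; have [<-|st] := eqVneq s t; rewrite /= ?mulr1n ?mulr0n.
- rewrite orbb andbb mulr1 => us.
  have us' := negPf us; have su' : (s == u) = false by rewrite eq_sym.
  have -> := @E_mono [:: u; u; s; s] isT.
  have -> : undup [:: u; u; s; s] = [:: u; s] by rewrite /= !inE !eqxx us' ?orbT.
  by rewrite !big_cons big_nil /= !eqxx us' su' /= !X2 !mulr1.
- move=> _; rewrite mulr0; have [us|us] := eqVneq u s.
    apply: (@E_single _ t) => //=; rewrite us eqxx.
    by rewrite (negPf st).
  by apply: (@E_single _ s) => //=; rewrite eqxx (negPf us) (eq_sym t) (negPf st).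
- move=> _; rewrite mul0r; have [us|us] := eqVneq u s.
    apply: (@E_single _ v) => //=; rewrite -us eqxx.
    by rewrite (negPf uv).
  by apply: (@E_single _ u) => //=; rewrite eqxx (eq_sym v) (negPf uv) (eq_sym s) (negPf us).
move=> h; rewrite mulr0; have [us|us] := eqVneq u s.
  move: h; rewrite us eqxx /= negb_or => /andP[vt _].
  apply: (@E_single _ v) => //=; rewrite eqxx -us (negPf uv) (eq_sym t) (negPf vt) /=.
  by [].
have [ut|ut] := eqVneq u t.
  move: h; rewrite ut eqxx /= negb_or => /andP[_ vs].
  apply: (@E_single _ v) => //=; rewrite eqxx -ut (negPf uv) (eq_sym s) (negPf vs) /=.
  by [].
apply: (@E_single _ u) => //=; rewrite eqxx (eq_sym v) (negPf uv) (eq_sym s) (negPf us) (eq_sym t).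
by rewrite (negPf ut).
Qed.

Let Y u v w := X u w * X v w - (u == v)%:R.

Let intg2 u v : intg P (fun w => X u w * X v w).
Proof.
have := @intg_mono [:: u; v] isT.
by under eq_fun do rewrite !big_cons big_nil mulr1.
Qed.

Let intg22 u v s t : intg P (fun w => X u w * X v w * (X s w * X t w)).
Proof.
have := @intg_mono [:: u; v; s; t] isT.
by under eq_fun do rewrite !big_cons big_nil mulr1 !mulrA -mulrA.
Qed.

Let YYE u v s t w : Y u v w * Y s t w = X u w * X v w * (X s w * X t w)
  - (s == t)%:R * (X u w * X v w) - ((u == v)%:R * (X s w * X t w) - (u == v)%:R * (s == t)%:R).
Proof. by rewrite /Y; ring. Qed.

Let intgYY u v s t : intg P (fun w => Y u v w * Y s t w).
Proof.
under eq_fun do rewrite YYE.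
apply: intgB; first by apply: intgB => //; exact: intgZ.
by apply: intgB; [exact: intgZ|exact: intg_cst].
Qed.

Let EYY u v s t : \int[P]_w (Y u v w * Y s t w) =
  \int[P]_w (X u w * X v w * (X s w * X t w)) - (u == v)%:R * (s == t)%:R.
Proof.
under eq_Rintegral do rewrite YYE.
have i1 : intg P (fun w => (s == t)%:R * (X u w * X v w)) by exact: intgZ.
have i2 : intg P (fun w => (u == v)%:R * (X s w * X t w)) by exact: intgZ.
have i3 := intg_cst P ((u == v)%:R * (s == t)%:R).
rewrite RintgB; [|exact: intgB|exact: intgB].
rewrite (RintgB (intg22 _ _ _ _) i1) (RintgB i2 i3) !(RintgZ _ (intg2 _ _)) !E2 Rintegral_pcst.
by ring.
Qed.

Let EY_orth u v s t : ~~ (((u == s) && (v == t)) || ((u == t) && (v == s))) ->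
  \int[P]_w (Y u v w * Y s t w) = 0.
Proof. by move=> h; rewrite EYY E4 // subrr. Qed.

Let EY_sq u v : \int[P]_w (Y u v w * Y u v w) <= b.
Proof.
have b4 i : \int[P]_w X i w ^+ 4 <= b.
  rewrite -lee_fin /Rintegral fineK //; apply: integrable_fin_num => //; exact: intg4.
rewrite EYY (@le_trans _ _ (\int[P]_w (X u w * X v w * (X u w * X v w)))) //.
  by rewrite gerBl -natrM.
(* A product of two squares is at most the mean of the fourth powers; this covers [u = v] as
   well. *)
apply: (@le_trans _ _ (\int[P]_w (2^-1 * X u w ^+ 4 + 2^-1 * X v w ^+ 4))).
  apply: (le_Rintegral measurableT (intg22 _ _ _ _) (intgD (intgZ _ (intg4 _)) (intgZ _ (intg4 _)))) => w _.
  rewrite -subr_ge0; have := sqr_ge0 (X u w ^+ 2 - X v w ^+ 2); nra.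
rewrite (RintgD (intgZ _ (intg4 _)) (intgZ _ (intg4 _))) !(RintgZ _ (intg4 _)).
by have := b4 u; have := b4 v; lra.
Qed.

(** Different [k] carry different unordered pairs, so the centred products are pairwise orthogonal
    and only the diagonal of the expanded square remains, each term at most [b]. *)
Lemma quadratic_sum_second_moment (K : finType) (c : K -> R) (u v : K -> I) :
  (forall k l, k != l ->
    ~~ (((u k == u l) && (v k == v l)) || ((u k == v l) && (v k == u l)))) ->
  (\int[P]_w ((\sum_k c k * (X (u k) w * X (v k) w - (u k == v k)%:R)) ^+ 2)%:E
    <= (b * \sum_k c k ^+ 2)%:E)%E.
Proof.
move=> huv; pose g k l w := c k * c l * (Y (u k) (v k) w * Y (u l) (v l) w).
have sqE w : (\sum_k c k * (X (u k) w * X (v k) w - (u k == v k)%:R)) ^+ 2 =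
    \sum_k \sum_l g k l w.
  rewrite expr2 mulr_suml; apply: eq_bigr => k _; rewrite mulr_sumr.
  by apply: eq_bigr => l _; rewrite mulrACA.
have ig k l : intg P (g k l) by exact: intgZ.
have igk k : intg P (fun w => \sum_l g k l w) by exact: intg_sum.
under eq_integral do rewrite sqE.
rewrite -[leLHS]fineK; last by apply: integrable_fin_num => //; exact: intg_sum.
rewrite lee_fin -/(Rintegral P setT (fun w => \sum_k \sum_l g k l w)).
rewrite (Rintegral_sum _ igk) mulr_sumr; apply: ler_sum => k _.
rewrite (Rintegral_sum _ (ig k)) (bigD1 k) //= big1 ?addr0 => [|l lk].
  by rewrite (RintgZ _ (intgYY _ _ _ _)) -expr2 mulrC ler_wpM2r ?sqr_ge0.
by rewrite (RintgZ _ (intgYY _ _ _ _)) EY_orth ?mulr0 // huv // eq_sym.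
Qed.

End Moments.
End Product.
End IndependentProducts.

(** * Linear processes *)

(** Fatou's lemma off the null set where convergence fails: a uniform bound for the truncated series
    passes to its almost sure limit. *)
Lemma ae_fatou_le (R : realType) (d : measure_display) (Omega : measurableType d)
    (P : probability Omega R) (f : nat -> Omega -> R) (g : Omega -> R) (B : R) :
  (forall n, measurable_fun setT (f n)) -> measurable_fun setT g ->
  (forall n w, 0 <= f n w) -> (forall w, 0 <= g w) ->
  {ae P, forall w, (f ^~ w) @ \oo --> g w} ->
  (forall n, (\int[P]_w (f n w)%:E <= B%:E)%E) ->
  (\int[P]_w (g w)%:E <= B%:E)%E.
Proof.
move=> mf mg f0 g0 [N [mN N0 subN]] fB.
have mf' n D : measurable_fun D (fun w => (f n w)%:E).
  by apply/measurable_EFinP; apply: measurable_funS (mf n).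
have mC : measurable (~` N) by exact: measurableC.
rewrite (ge0_negligible_integral mN) //; first last.
- by move=> w _; rewrite lee_fin.
- exact/measurable_EFinP.
rewrite setTD.
have fg w : (~` N) w -> limn_einf (fun n => (f n w)%:E) = (g w)%:E.
  move=> Nw; have cv : (f ^~ w) @ \oo --> g w.
    by apply: contrapT => h; apply: Nw; exact: subN.
  have cvE : (fun n => (f n w)%:E) @ \oo --> (g w)%:E by apply: cvg_EFin => //; exact: nearW.
  by have [-> _] := cvg_limn_einf_sup cvE.
under eq_integral => w /set_mem Nw do rewrite -fg //.
apply: le_trans (fatou P mC _ _) _ => //.
  by move=> n w _; rewrite lee_fin.
rewrite limn_einf_lim; apply: lime_le; first exact: is_cvg_einfs.
apply: nearW => n; apply: (@le_trans _ _ (\int[P]_(w in ~` N) (f n w)%:E)%E).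
  by apply: ereal_inf_lbound; exists n => /=.
apply: le_trans (fB n); apply: ge0_subset_integral => //.
by move=> w _; rewrite lee_fin.
Qed.

Lemma cvg_seq_sum (R : realType) (K : Type) (s : seq K) (f : K -> nat -> R) (l : K -> R) :
  (forall k, f k @ \oo --> l k) ->
  (fun n => \sum_(k <- s) f k n) @ \oo --> \sum_(k <- s) l k.
Proof.
move=> fl; elim: s => [|k s IH].
  by rewrite big_nil; under eq_fun do rewrite big_nil; exact: cvg_cst.
by rewrite big_cons; under eq_fun do rewrite big_cons; exact: cvgD.
Qed.

(** Cauchy-Schwarz after splitting each [c k] into two factors of modulus [Num.sqrt |c k|], the sign
    staying with [y k]. *)
Lemma jensen_sum (R : realType) (K : finType) (c y : K -> R) :
  (\sum_k c k * y k) ^+ 2 <= (\sum_k `|c k|) * \sum_k `|c k| * y k ^+ 2.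
Proof.
have := cauchy_schwarz_sum predT (fun k => Num.sqrt `|c k|)
  (fun k => Num.sqrt `|c k| * (Num.sg (c k) * y k)).
under eq_bigr do rewrite mulrA -expr2 sqr_sqrtr // mulrA [`|_| * _]mulrC -numEsg.
under [X in X * _]eq_bigr do rewrite sqr_sqrtr //.
move=> h; apply: (le_trans h); rewrite ler_wpM2l ?sumr_ge0 //.
apply: ler_sum => k _; rewrite exprMn sqr_sqrtr // exprMn ler_wpM2l //.
by rewrite sqr_sg ler_piMl ?sqr_ge0 // lern1 leq_b1.
Qed.

Lemma integral_weighted_sum_le (R : realType) (d : measure_display) (Omega : measurableType d)
    (P : probability Omega R) (K : finType) (k : K -> R) (f : K -> Omega -> R) (B : R) :
  (forall i, 0 <= k i) -> (forall i, measurable_fun setT (f i)) -> (forall i w, 0 <= f i w) ->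
  (forall i, (\int[P]_w (f i w)%:E <= B%:E)%E) ->
  (\int[P]_w (\sum_i k i * f i w)%:E <= ((\sum_i k i) * B)%:E)%E.
Proof.
move=> k0 mf f0 fB; under eq_integral do rewrite -sumEFin.
rewrite ge0_integral_sum //; first last.
- by move=> i w _; rewrite lee_fin mulr_ge0.
- by move=> i; apply/measurable_EFinP; apply: measurable_funM.
rewrite mulr_suml -sumEFin; apply: lee_sum => i _.
under eq_integral do rewrite EFinM; rewrite ge0_integralZl_EFin //.
- by rewrite EFinM lee_wpmul2l // lee_fin.
- by move=> w _; rewrite lee_fin.
- exact/measurable_EFinP.
Qed.

Section LinearProcess.
Context {R : realType} {d : measure_display} {Omega : measurableType d}.
Variable P : probability Omega R.
Variables (J : eqType) (x z : int -> J -> Omega -> R) (a : nat -> R) (c b : R).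
Hypothesis mx : forall t j, measurable_fun setT (x t j).
Hypothesis mz : forall t j, measurable_fun setT (z t j).
Hypothesis indx : mutually_independent P (fun u : int * J => x u.1 u.2).
Hypothesis x1 : forall t j, \int[P]_w x t j w = 0.
Hypothesis x2 : forall t j, \int[P]_w x t j w ^+ 2 = 1.
Hypothesis x4 : forall t j, (\int[P]_w (x t j w ^+ 4)%:E <= b%:E)%E.
Hypothesis a2 : (\sum_(0 <= v <oo) (a v ^+ 2)%:E = 1)%E.
Hypothesis a1 : (\sum_(0 <= v <oo) `|a v|%:E <= c%:E)%E.
Hypothesis zE : forall t j, {ae P, forall w,
  (fun N => \sum_(0 <= v < N) a v * x (t - v%:Z) j w) @ \oo --> z t j w}.

Variables (T : nat) (K : finType) (s : K -> R) (j j' : K -> J).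
Hypothesis T0 : (0 < T)%N.
Hypothesis jj' : forall k l, k != l ->
  ~~ (((j k == j l) && (j' k == j' l)) || ((j k == j' l) && (j' k == j l))).

Let Q w := tavg T (fun t => \sum_k s k * (z t%:Z (j k) w * z t%:Z (j' k) w - (j k == j' k)%:R)).

Let zN N t i w := \sum_(0 <= v < N) a v * x (t - v%:Z) i w.
Let theta N := \sum_(0 <= v < N) a v ^+ 2.

(* Centring by [theta N], the variance of the truncated series, instead of 1
   makes [QN] an exact combination of centred products of innovations. *)
Let QN N w := tavg T (fun t => \sum_k s k *
  (zN N t%:Z (j k) w * zN N t%:Z (j' k) w - (j k == j' k)%:R * theta N)).

(** The contribution of one pair of lags. With both lags fixed, different [(t, k)] involve different
    unordered pairs of innovations, so the orthogonality of centred products applies. *)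
Let r v v' w := T%:R^-1 * \sum_(tk : 'I_T * K) s tk.2 *
  (x (tk.1.+1%:Z - v%:Z) (j tk.2) w * x (tk.1.+1%:Z - v'%:Z) (j' tk.2) w
     - ((v == v') && (j tk.2 == j' tk.2))%:R).

Let r_second_moment v v' : (\int[P]_w (r v v' w ^+ 2)%:E <= (b * \sum_k s k ^+ 2 / T%:R)%:E)%E.
Proof.
pose u (tk : 'I_T * K) := (tk.1.+1%:Z - v%:Z, j tk.2).
pose u' (tk : 'I_T * K) := (tk.1.+1%:Z - v'%:Z, j' tk.2).
have := @quadratic_sum_second_moment _ _ _ P _ (fun u : int * J => x u.1 u.2)
  (fun i => mx i.1 i.2) indx b (fun i => x1 i.1 i.2) (fun i => x2 i.1 i.2) (fun i => x4 i.1 i.2)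
  _ (fun tk : 'I_T * K => T%:R^-1 * s tk.2) u u'.
have -> : \sum_(tk : 'I_T * K) (T%:R^-1 * s tk.2) ^+ 2 = \sum_k s k ^+ 2 / T%:R.
  rewrite -(pair_bigA _ (fun _ k => (T%:R^-1 * s k) ^+ 2)) /= sumr_const card_ord.
  rewrite -sumrMnl; apply: eq_bigr => k _; rewrite -[_ *+ T]mulr_natl.
  by field; rewrite pnatr_eq0 -lt0n.
move=> h; apply: le_trans (h _).
  rewrite le_eqVlt; apply/orP; left; apply/eqP; apply: eq_integral => w _; congr (_ ^+ 2)%:E.
  rewrite /r mulr_sumr; apply: eq_bigr => -[t k] _ /=.
  rewrite -mulrA; congr (_ * (_ * (_ - _))).
  rewrite /u /u' /= xpair_eqE; congr (nat_of_bool (_ && _))%:R.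
  by apply/idP/idP => /eqP; lia.
move=> [t k] [t' k'] ne; rewrite /u /u' /= !xpair_eqE /=.
have [tt'|tt'] := eqVneq t t'.
  have kk' : k != k' by apply: contra ne => /eqP ->; rewrite tt'.
  apply: contra (jj' kk') => /orP[] /andP[/andP[_ ->] /andP[_ ->]] //.
  by rewrite orbT.
have tt0 : (t : nat) <> t' by move=> e; move/eqP: tt'; apply; exact: val_inj.
(* For different times a direct coincidence of the pairs is impossible, and a crossed one would make
   [t - t'] equal to both [v - v'] and [v' - v], hence zero. *)
by apply/negP => /orP[] /andP[/andP[/eqP e1 _] /andP[/eqP e2 _]]; lia.
Qed.

Let QN_r N w : QN N w = \sum_(v < N) \sum_(v' < N) a v * a v' * r v v' w.
Proof.
rewrite /QN /tavg big_add1 /= big_mkord mulr_sumr.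
transitivity (\sum_(t < T) \sum_k \sum_(v < N) \sum_(v' < N) T%:R^-1 * (s k * (a v * a v' *
    (x (t.+1%:Z - v%:Z) (j k) w * x (t.+1%:Z - v'%:Z) (j' k) w
      - (((v : nat) == v') && (j k == j' k))%:R)))).
  apply: eq_bigr => t _; rewrite mulr_sumr; apply: eq_bigr => k _.
  rewrite /zN /theta !big_mkord mulr_suml mulr_sumr -sumrB !mulr_sumr; apply: eq_bigr => v _.
  rewrite -[RHS]mulr_sumr -[X in _ = _ * X]mulr_sumr; congr (_ * (_ * _)).
  have -> : (j k == j' k)%:R * a v ^+ 2 =
      \sum_(v' < N) a v * a v' * (((v : nat) == v') && (j k == j' k))%:R.
    rewrite (bigD1 v) //= eqxx [X in _ = _ + X]big1 ?addr0; first by ring.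
    by move=> v' v'v; rewrite eq_sym (negPf (v'v : (v' : nat) != v)) mulr0.
  by rewrite ?mulr_sumr -sumrB; apply: eq_bigr => v' _; ring.
rewrite pair_bigA exchange_big /=; apply: eq_bigr => v _.
rewrite exchange_big /=; apply: eq_bigr => v' _.
rewrite /r !mulr_sumr; apply: eq_bigr => -[t k] _ /=.
by ring.
Qed.

Let c0 : 0 <= c.
Proof. by rewrite -lee_fin (le_trans _ a1) // nneseries_ge0 // => n _; rewrite lee_fin. Qed.

Let sum_abs_le N : \sum_(v < N) `|a v| <= c.
Proof.
rewrite -lee_fin; apply: le_trans a1; rewrite -sumEFin.
rewrite -(big_mkord predT (fun v => (`|a v|)%:E)).
by apply: nneseries_lim_ge => n _ _; rewrite lee_fin.
Qed.

Let mr v v' : measurable_fun setT (r v v').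
Proof.
apply: measurable_funM => //; apply: measurable_sum => tk; apply: measurable_funM => //.
by apply: measurable_funB => //; apply: measurable_funM.
Qed.

(** Jensen's inequality with weights [|a v * a v'|], whose total is [S ^+ 2], costs one factor
    [S ^+ 2]; summing the moment bounds over the lags costs another. With [S <= c] this gives
    [c ^+ 4], uniformly in [N]. *)
Let QN_second_moment N :
  (\int[P]_w (QN N w ^+ 2)%:E <= (c ^+ 4 * (b * \sum_k s k ^+ 2 / T%:R))%:E)%E.
Proof.
set B := b * _.
have B0 : 0 <= B.
  rewrite -lee_fin (le_trans _ (r_second_moment 0 0)) //; apply: integral_ge0 => w _.
  by rewrite lee_fin sqr_ge0.
pose S := \sum_(v < N) `|a v|.
have S0 : 0 <= S by apply: sumr_ge0.
have SE : \sum_(p : 'I_N * 'I_N) `|a p.1 * a p.2| = S ^+ 2.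
  rewrite -(pair_bigA _ (fun v v' : 'I_N => `|a v * a v'|)) /= expr2 mulr_suml.
  by apply: eq_bigr => v _; rewrite mulr_sumr; apply: eq_bigr => v' _; rewrite normrM.
have le1 w : QN N w ^+ 2 <= \sum_(p : 'I_N * 'I_N) (S ^+ 2 * `|a p.1 * a p.2|) * r p.1 p.2 w ^+ 2.
  rewrite QN_r pair_bigA /=.
  apply: le_trans (jensen_sum (fun p : 'I_N * 'I_N => a p.1 * a p.2) (fun p => r p.1 p.2 w)) _.
  by rewrite SE mulr_sumr; apply: ler_sum => p _; rewrite mulrA.
have mQ : measurable_fun setT (QN N).
  rewrite (_ : QN N = fun w => \sum_(v < N) \sum_(v' < N) a v * a v' * r v v' w); last first.
    by apply/funext => w; exact: QN_r.
  by apply: measurable_sum => v; apply: measurable_sum => v'; apply: measurable_funM.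
apply: (@le_trans _ _ (\int[P]_w (\sum_(p : 'I_N * 'I_N)
    (S ^+ 2 * `|a p.1 * a p.2|) * r p.1 p.2 w ^+ 2)%:E)%E).
  apply: ge0_le_integral => //.
  - by move=> w _; rewrite lee_fin sqr_ge0.
  - by apply/measurable_EFinP; exact: measurable_funX.
  - by apply/measurable_EFinP; apply: measurable_sum => p; apply: measurable_funM => //; exact: measurable_funX.
  - by move=> w _; rewrite lee_fin.
apply: le_trans (@integral_weighted_sum_le _ _ _ P _ (fun p : 'I_N * 'I_N => S ^+ 2 * `|a p.1 * a p.2|)
  (fun p w => r p.1 p.2 w ^+ 2) B _ _ _ (fun p => r_second_moment p.1 p.2)) _.
- by move=> p; rewrite mulr_ge0 ?sqr_ge0.
- by move=> p; exact: measurable_funX.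
- by move=> p w; exact: sqr_ge0.
rewrite lee_fin ler_wpM2r // -mulr_sumr SE -exprD lerXn2r ?nnegrE //.
exact: sum_abs_le.
Qed.

Let theta_cvg : theta @ \oo --> (1 : R).
Proof.
have c2 : (fun n => \sum_(0 <= v < n) (a v ^+ 2)%:E)%E @ \oo --> 1%E.
  rewrite -a2; apply: is_cvg_nneseries => n _ _; rewrite lee_fin sqr_ge0 //.
have -> : theta = fine \o (fun n => \sum_(0 <= v < n) (a v ^+ 2)%:E)%E.
  by apply/funext => n /=; rewrite sumEFin.
exact: fine_cvg c2.
Qed.

Lemma linear_process_second_moment :
  (\int[P]_w (Q w ^+ 2)%:E <= (c ^+ 4 * (b * \sum_k s k ^+ 2 / T%:R))%:E)%E.
Proof.
have mzN N t i : measurable_fun setT (zN N t i).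
  by apply: measurable_sum => v; apply: measurable_funM.
apply: (@ae_fatou_le _ _ _ P (fun N w => QN N w ^+ 2)) => //.
- move=> N; apply: measurable_funX; apply: measurable_funM => //; apply: measurable_sum => t.
  apply: measurable_sum => k; apply: measurable_funM => //.
  by apply: measurable_funB => //; apply: measurable_funM.
- apply: measurable_funX; apply: measurable_funM => //; apply: measurable_sum => t.
  apply: measurable_sum => k; apply: measurable_funM => //.
  by apply: measurable_funB => //; apply: measurable_funM.
- by move=> N w; exact: sqr_ge0.
- by move=> w; exact: sqr_ge0.
have aez : {ae P, forall w, forall tk : 'I_T * K,
    ((fun N => zN N tk.1.+1%:Z (j tk.2) w) @ \oo --> z tk.1.+1%:Z (j tk.2) w) /\
    ((fun N => zN N tk.1.+1%:Z (j' tk.2) w) @ \oo --> z tk.1.+1%:Z (j' tk.2) w)}.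
  apply: filter_forall => tk.
  by apply: filterS2 (zE tk.1.+1%:Z (j tk.2)) (zE tk.1.+1%:Z (j' tk.2)) => w.
apply: filterS aez => w hw.
suff QQ : (QN ^~ w) @ \oo --> Q w by under eq_fun do rewrite expr2; rewrite expr2; exact: cvgM.
rewrite /Q /QN /tavg; apply: cvgMr.
under eq_fun do rewrite big_add1 /= big_mkord; rewrite big_add1 /= big_mkord.
apply: cvg_seq_sum => t; apply: cvg_seq_sum => k; apply: cvgMr.
have [h1 h2] := hw (t, k); apply: cvgB; first exact: cvgM.
rewrite -[X in _ --> X]mulr1; apply: cvgMr; exact: theta_cvg.
Qed.

End LinearProcess.

(** * Boundedness in probability *)

Section BoundedInProbability.
Context {R : realType} {d : measure_display} {Omega : measurableType d}.
Variable P : probability Omega R.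

(* Outer probability, so that the measurability of eigenvalues is never needed. *)
Definition outer_le (A : set Omega) (e : R) :=
  exists B, [/\ measurable B, A `<=` B & (P B <= e%:E)%E].

(* [A K n] is the failure at stage [n] of an estimate with constant [K]. *)
Definition tight (A : R -> nat -> set Omega) :=
  forall e, 0 < e -> exists K0, forall K, K0 <= K ->
    \forall n \near \oo, outer_le (A K n) e.

Lemma tightU A B : tight A -> tight B -> tight (fun K n => A K n `|` B K n).
Proof.
move=> tA tB e e0; have e20 : 0 < e / 2 by rewrite divr_gt0.
have [KA hA] := tA _ e20; have [KB hB] := tB _ e20.
exists (Num.max KA KB) => K; rewrite ge_max => /andP[/hA nA /hB nB].
near=> n.
have [A' [mA sA PA]] : outer_le (A K n) (e / 2) by near: n.
have [B' [mB sB PB]] : outer_le (B K n) (e / 2) by near: n.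
exists (A' `|` B'); split; first exact: measurableU.
- by apply: setUSS.
- by rewrite (le_trans (measureU2 P mA mB)) // [e]splitr EFinD leeD.
Unshelve. all: by end_near. Qed.

Lemma tight_sub A B :
  (forall K, 1 <= K -> \forall n \near \oo, A K n `<=` B K n) -> tight B -> tight A.
Proof.
move=> AB tB e /tB [K0 hK]; exists (Num.max 1 K0) => K; rewrite ge_max => /andP[K1 /hK nK].
near=> n; have [C [mC sC PC]] : outer_le (B K n) e by near: n.
exists C; split => //; apply: subset_trans sC; near: n; exact: AB.
Unshelve. all: by end_near. Qed.

Lemma tight_forall (I : finType) (A : I -> R -> nat -> set Omega) :
  (forall i, tight (A i)) -> tight (fun K n => [set w | exists i, A i K n w]).
Proof.
move=> tA; suff : tight (fun K n => [set w | exists2 i, i \in enum I & A i K n w]).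
  by apply: tight_sub => K _; apply: nearW => n w [i Aw]; exists i => //; rewrite mem_enum.
elim: (enum I) => [|i s IH].
  move=> e e0; exists 0 => K _; apply: nearW => n; exists set0; split => //.
    by move=> w [k]; rewrite in_nil.
  by rewrite measure0 lee_fin ltW.
apply: tight_sub (tightU (tA i) IH) => K _; apply: nearW => n w [k].
by rewrite inE => /predU1P[->|ks] Aw; [left|right; exists k].
Qed.

Lemma tight_ae (A : nat -> set Omega) :
  (forall n, {ae P, forall w, ~ A n w}) -> tight (fun _ => A).
Proof.
move=> hA e e0; exists 0 => K _; apply: nearW => n.
have [N [mN N0 sN]] := hA n; exists N; split => //.
  by move=> w Aw; apply: sN => /= /(_ Aw).
by rewrite N0 lee_fin ltW.
Qed.

Lemma tight_markov (f : nat -> Omega -> R) (C : R) :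
  (forall n, measurable_fun setT (f n)) -> (forall n w, 0 <= f n w) ->
  (\forall n \near \oo, (\int[P]_w (f n w)%:E <= C%:E)%E) ->
  tight (fun K n => [set w | K < f n w]).
Proof.
move=> mf f0 hC e e0; exists (Num.max 1 (C / e)) => K.
rewrite ge_max => /andP[K1 CK]; have K0 : 0 < K by rewrite (lt_le_trans _ K1).
near=> n; exists (setT `&` [set w | (K%:E <= `|(f n w)%:E|)%E]).
have mfn : measurable_fun setT (EFin \o f n) by exact/measurable_EFinP.
split.
- apply: emeasurable_fun_c_infty => //.
  by apply: measurableT_comp mfn.
- by move=> w /= /ltW; split => //; rewrite lee_fin ger0_norm.
have := le_integral_abse P measurableT mfn K0.
under eq_integral do rewrite /= ger0_norm //.
have : (\int[P]_w (f n w)%:E <= C%:E)%E by near: n.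
move=> h1 h2; have := le_trans h2 h1; rewrite -lee_pdivlMl // => h3.
apply: (le_trans h3); rewrite -EFinM lee_fin.
by rewrite ler_pdivrMl // -ler_pdivrMr // mulrC.
Unshelve. all: by end_near. Qed.

(** [G k] says that the integer constant [k] works from stage [k] on. These events increase to an
    almost sure event, so one of them already has probability above [1 - e]. *)
Lemma tight_eventually (E : R -> nat -> set Omega) :
  (forall K n, measurable (E K n)) ->
  (forall K K' n, K <= K' -> E K n `<=` E K' n) ->
  {ae P, forall w, exists K, \forall n \near \oo, E K n w} ->
  tight (fun K n => ~` E K n).
Proof.
move=> mE ndE [N [mN N0 sN]] e e0.
pose G k := \bigcap_(n in [set n | (k <= n)%N]) E k%:R n.
have mG k : measurable (G k) by apply: bigcap_measurable => [|n _]; [by exists k => /=|exact: mE].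
have ndG : nondecreasing_seq G.
  move=> k l kl; apply/subsetPset => w Gw n /= ln; apply: (ndE k%:R); first by rewrite ler_nat.
  by apply: Gw => /=; rewrite (leq_trans kl).
have mUG : measurable (\bigcup_k G k) by apply: bigcup_measurable.
have PUG : (P (\bigcup_k G k) = 1)%E.
  apply/eqP; rewrite eq_le probability_le1 //=.
  rewrite -(probability_setT P) -[leRHS]adde0 -N0.
  apply: (@le_trans _ _ (P ((\bigcup_k G k) `|` N))); last by apply: measureU2.
  apply: le_measure; rewrite ?inE //; first exact: measurableU.
  move=> w _; have [Nw|Nw] := pselect (N w); [by right|left].
  have [K [n0 _ hn]] : exists K, \forall n \near \oo, E K n w.
    by apply: contrapT => h; apply: Nw; exact: sN.
  (* One integer dominates both the random starting index and the random constant. *)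
  exists (maxn n0 (Num.bound `|K|)) => // n /= hmax.
  apply: (ndE K); last by apply: hn => /=; rewrite (leq_trans _ hmax) // leq_maxl.
  rewrite (le_trans (ler_norm _)) // (le_trans (ltW (archi_boundP _))) //.
  by rewrite ler_nat leq_maxr.
have cvG' : P \o G @ \oo --> 1%E by rewrite -PUG; exact: nondecreasing_cvg_mu.
have cvG : (fine \o (P \o G)) @ \oo --> (1 : R) by exact: fine_cvg cvG'.
have : \forall k \near \oo, 1 - e < fine (P (G k)).
  have lt1 : 1 - e < 1 by rewrite ltrBlDr ltrDl.
  exact: cvgr_gt cvG _ lt1.
case=> k _ /(_ k (leqnn k)) hk; exists k%:R => K kK.
exists k => // n kn; exists (~` G k); split; first exact: measurableC.
- by apply: subsetC => w /(_ n kn); exact: ndE.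
- rewrite probability_setC // -[P (G k)]fineK ?fin_num_measure // -EFinB lee_fin.
  by rewrite lerBlDr -lerBlDl ltW.
Qed.

(** Tightness fixes [K] first, so the stage from which the inclusion holds may depend on [K]. *)
Lemma tight_consistent (khat : nat -> {RV P >-> nat}) (k : nat) A : tight A ->
  (forall K, 1 <= K -> \forall n \near \oo, [set w | khat n w <> k] `<=` A K n) ->
  consistent khat k.
Proof.
move=> tA hA.
have : tight (fun _ n => [set w | khat n w <> k]) by apply: tight_sub tA.
move=> tk e e0; pose D n := [set w | e <= `|(khat n w)%:R - k%:R|].
have mD n : measurable (D n).
  have := @measurable_funPT _ _ _ _ (khat n) measurableT [set m | e <= `|m%:R - k%:R|].
  by rewrite setTI; exact.
have Dk n : D n `<=` [set w | khat n w <> k].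
  by move=> w; rewrite /D /= => + kw; rewrite kw subrr normr0 leNgt e0.
rewrite -/(D _); apply/fine_cvgP; split; first by apply: nearW => n; apply: fin_num_measure; exact: mD.
apply/cvgr0Pnorm_le => eps eps0 /=.
have [K0 /(_ K0 (lexx _)) nK] := tk _ eps0.
near=> n; have [B [mB sB PB]] : outer_le [set w | khat n w <> k] eps by near: n.
have PD : (P (D n) <= eps%:E)%E.
  apply: le_trans PB; apply: le_measure; rewrite ?inE //.
  exact: subset_trans sB.
rewrite ger0_norm ?fine_ge0 // -lee_fin fineK //.
by apply: fin_num_measure; exact: mD.
Unshelve. all: by end_near. Qed.

End BoundedInProbability.

(** Serves to regroup the time and matrix indices, and to transpose the matrices. Indices outside
    the range of [f] receive the full set. *)
Lemma mutually_independent_inj (R : realType) (d : measure_display) (Omega : measurableType d)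
    (P : probability Omega R) (I I' : eqType) (f : I' -> I) (X : I -> Omega -> R) :
  injective f -> mutually_independent P X -> mutually_independent P (X \o f).
Proof.
move=> injf indX s B us mB.
pose B' i := if pselect (exists i', f i' = i) is left e then B (projT1 (cid e)) else setT.
have B'E i : B' (f i) = B i.
  rewrite /B'; case: pselect => [e|]; last by case; exists i.
  by rewrite (injf _ _ (projT2 (cid e))).
have mB' i : measurable (B' i) by rewrite /B'; case: pselect.
have us' : uniq (map f s) by rewrite map_inj_uniq.
have := indX _ _ us' mB'; rewrite !big_map.
under eq_bigr do rewrite B'E.
by under [X in _ = X -> _]eq_bigr do rewrite B'E.
Qed.

(** * Time averages of the matrix-valued series *)

Section ArrayEvents.
Context {R : realType} {d : measure_display} {Omega : measurableType d}.
Variable P : probability Omega R.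

Lemma standardized_moments (X : {RV P >-> R}) : standardized X ->
  [/\ \int[P]_w X w = 0, \int[P]_w X w ^+ 2 = 1 & (\int[P]_w (X w ^+ 2)%:E = 1)%E].
Proof.
move=> [E0 V1].
have E2 : (\int[P]_w (X w ^+ 2)%:E = 1)%E.
  move: V1; rewrite /variance covariance.unlock E0 /= expectation.unlock => <-.
  by apply: eq_integral => w _; rewrite -[X w in LHS]subr0 expr2.
split => //; last by rewrite /Rintegral E2.
by move: E0; rewrite unlock /Rintegral => ->.
Qed.

Lemma array_second_moment m n (X Z : int -> random_mx P m n) (a : nat -> R) (b c : R)
    (T : nat) (K : finType) (s : K -> R) (j j' : K -> 'I_m * 'I_n) :
  linear_process a X Z -> innovations X -> fourth_moment_le X b -> coefficients a c ->
  (0 < T)%N ->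
  (forall k l, k != l ->
    ~~ (((j k == j l) && (j' k == j' l)) || ((j k == j' l) && (j' k == j l)))) ->
  (\int[P]_w ((tavg T (fun t => \sum_k s k *
      (Z t%:Z (j k).1 (j k).2 w * Z t%:Z (j' k).1 (j' k).2 w - (j k == j' k)%:R))) ^+ 2)%:E
    <= (c ^+ 4 * (b * \sum_k s k ^+ 2 / T%:R))%:E)%E.
Proof.
move=> XZ [indX stX] X4 [a2 a1] T0 jj'.
apply: (@linear_process_second_moment _ _ _ P _ (fun t ij => X t ij.1 ij.2 : Omega -> R)
  (fun t ij => Z t ij.1 ij.2 : Omega -> R) a c b) => //.
- pose f (u : int * ('I_m * 'I_n)) := (u.1, u.2.1, u.2.2).
  have injf : injective f by move=> [t [i k]] [t' [i' k']] [-> -> ->].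
  exact: mutually_independent_inj injf indX.
- by move=> t ij; have [] := standardized_moments (stX t ij.1 ij.2).
- by move=> t ij; have [] := standardized_moments (stX t ij.1 ij.2).
- by move=> t ij; have := X4 t ij.1 ij.2; rewrite unlock.
Qed.

Lemma near_natr (T : nat -> nat) (x : R) : T @ \oo --> \oo ->
  \forall n \near \oo, x < (T n)%:R.
Proof. by move=> /(cvgrnyP (R := R)) /cvgryPgt. Qed.

Lemma near_gt0 (T : nat -> nat) : T @ \oo --> \oo -> \forall n \near \oo, (0 < T n)%N.
Proof. by move=> /cvgnyPgt. Qed.

Lemma bigO_near (f g : nat -> R) : f =O_\oo g ->
  exists2 K, 0 < K & \forall n \near \oo, `|f n| <= K * `|g n|.
Proof.
move=> /eqOP [K0 [_ h]]; exists (Num.max 1 (K0 + 1)).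
  by rewrite lt_max ltr01.
by apply: h; rewrite lt_max ltrDl ltr01 orbT.
Qed.

Lemma littleo_near (f g : nat -> R) : f =o_\oo g ->
  forall e, 0 < e -> \forall n \near \oo, `|f n| <= e * `|g n|.
Proof. by move=> /eqoP h e; exact: h. Qed.

Lemma measurable_tavg (T : nat) (f : nat -> Omega -> R) :
  (forall t, measurable_fun setT (f t)) -> measurable_fun setT (fun w => tavg T (f ^~ w)).
Proof. by move=> mf; apply: measurable_funM => //; apply: measurable_sum. Qed.

(** The mean of [T * Q ^+ 2] is bounded, so Markov's inequality gives [T * Q ^+ 2 <= K] with high
    probability, and the deviation is below [eta] once [T] exceeds [K / eta ^+ 2]. The fixed
    dimensions leave finitely many pairs of entries. *)
Lemma factor_tight m k (X Z : nat -> int -> random_mx P m k) (a : nat -> nat -> R) (b c : R)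
    (T : nat -> nat) (eta : R) :
  (forall n, linear_process (a n) (X n) (Z n)) -> (forall n, innovations (X n)) ->
  (forall n, fourth_moment_le (X n) b) -> (forall n, coefficients (a n) c) ->
  T @ \oo --> \oo -> 0 < eta ->
  tight P (fun _ n => [set w | ~ forall i j i' j',
    `|tavg (T n) (fun t => Z n t%:Z i j w * Z n t%:Z i' j' w) - ((i, j) == (i', j'))%:R| <= eta]).
Proof.
move=> XZ iX X4 ca Too eta0.
(* The sum over ['I_1] puts a single product into the shape of the general second moment bound. *)
pose Q (u : ('I_m * 'I_k) * ('I_m * 'I_k)) n w := tavg (T n) (fun t => \sum_(i0 < 1) 1 *
  (Z n t%:Z u.1.1 u.1.2 w * Z n t%:Z u.2.1 u.2.2 w - (u.1 == u.2)%:R)).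
have QE u n w : (0 < T n)%N -> Q u n w =
    tavg (T n) (fun t => Z n t%:Z u.1.1 u.1.2 w * Z n t%:Z u.2.1 u.2.2 w) - (u.1 == u.2)%:R.
  move=> T0; rewrite -[(_ == _)%:R](tavg_cst _ T0) -mulN1r -tavgZ -tavgD.
  by apply: eq_tavg => t _; rewrite big_ord1 mul1r mulN1r.
have mQ u n : measurable_fun setT (Q u n).
  apply: measurable_tavg => t; apply: measurable_sum => _; apply: measurable_funM => //.
  by apply: measurable_funB => //; apply: measurable_funM.
have tQ u : tight P (fun K n => [set w | K < (T n)%:R * Q u n w ^+ 2]).
  apply: (@tight_markov _ _ _ P _ (c ^+ 4 * b)).
  - by move=> n; apply: measurable_funM => //; exact: measurable_funX.
  - by move=> n w; rewrite mulr_ge0 ?sqr_ge0.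
  near=> n; have T0 : (0 < T n)%N by near: n; exact: near_gt0.
  have := @array_second_moment _ _ _ _ _ b c (T n) 'I_1 (fun=> 1) (fun=> u.1) (fun=> u.2)
    (XZ n) (iX n) (X4 n) (ca n) T0.
  have h1 : forall k l : 'I_1, k != l -> ~~ (((u.1 == u.1) && (u.2 == u.2)) || ((u.1 == u.2) && (u.2 == u.1))).
    by move=> k1 l; rewrite !ord1 eqxx.
  move=> /(_ h1); rewrite big_ord1 expr1n -/(Q u n _) => h2.
  under eq_integral do rewrite EFinM; rewrite ge0_integralZl_EFin //; first last.
  - by apply/measurable_EFinP; exact: measurable_funX.
  - by move=> w _; rewrite lee_fin sqr_ge0.
  apply: (le_trans (lee_wpmul2l _ h2)); first by rewrite lee_fin.
  by rewrite -EFinM lee_fin le_eqVlt; apply/orP; left; apply/eqP; field; rewrite pnatr_eq0 -lt0n.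
apply: tight_sub (tight_forall tQ) => K K1.
near=> n => w /= hw.
have T0 : (0 < T n)%N by near: n; exact: near_gt0.
have TK : K / eta ^+ 2 < (T n)%:R by near: n; exact: near_natr.
apply: contrapT => hQ; apply: hw => i j i' j'.
rewrite leNgt; apply/negP => lt_eta; apply: hQ; exists ((i, j), (i', j')).
rewrite QE //= ; rewrite ltr_pdivrMr ?exprn_gt0 // in TK; apply: (lt_le_trans TK).
rewrite ler_wpM2l // -[leRHS]real_normK ?num_real //.
by rewrite lerXn2r ?nnegrE ?(ltW lt_eta) ?(ltW eta0).
Unshelve. all: by end_near. Qed.

(** Each of the p^2 entries has second moment at most [c ^+ 4 * b * hi ^+ 4 * q / T]: for rows [i]
    and [i'], different columns [j] give different unordered pairs, and the weights
    [S n i j * S n i' j] are at most [hi ^+ 2]. Markov's inequality is applied to the total. *)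
Lemma idiosyncratic_tight (p q : nat -> nat) (X Z : forall n, int -> random_mx P (p n) (q n))
    (S : forall n, 'M[R]_(p n, q n)) (a : nat -> nat -> R) (b c hi : R) (T : nat -> nat) :
  (forall n, linear_process (a n) (X n) (Z n)) -> (forall n, innovations (X n)) ->
  (forall n, fourth_moment_le (X n) b) -> (forall n, coefficients (a n) c) ->
  (forall n i j, 0 <= S n i j <= hi) ->
  T @ \oo --> \oo -> p @ \oo --> \oo -> q @ \oo --> \oo ->
  tight P (fun K n => [set w | K * ((p n)%:R ^+ 2 * (q n)%:R / (T n)%:R) <
    \sum_i \sum_i' (tavg (T n) (fun t => \sum_j S n i j * S n i' j *
      (Z n t%:Z i j w * Z n t%:Z i' j w - (i == i')%:R))) ^+ 2]).
Proof.
move=> XZ iX X4 ca hS Too poo qoo.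
pose V n i i' w := tavg (T n) (fun t => \sum_j S n i j * S n i' j *
  (Z n t%:Z i j w * Z n t%:Z i' j w - (i == i')%:R)).
have mV n i i' : measurable_fun setT (V n i i').
  apply: measurable_tavg => t; apply: measurable_sum => j; apply: measurable_funM => //.
  by apply: measurable_funB => //; apply: measurable_funM.
pose r n : R := (p n)%:R ^+ 2 * (q n)%:R / (T n)%:R.
have hi0 n : (0 < p n)%N -> (0 < q n)%N -> 0 <= hi.
  move=> p0 q0; have := hS n (Ordinal p0) (Ordinal q0).
  by case/andP => h0 /(le_trans h0).
have tV : tight P (fun K n => [set w | K < \sum_(u : 'I_(p n) * 'I_(p n)) (r n)^-1 * V n u.1 u.2 w ^+ 2]).
  apply: (@tight_markov _ _ _ P _ (c ^+ 4 * b * hi ^+ 4)).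
  - move=> n; apply: measurable_sum => u; apply: measurable_funM => //; exact: measurable_funX.
  - move=> n w; apply: sumr_ge0 => u _; rewrite mulr_ge0 ?sqr_ge0 // invr_ge0.
    by rewrite !mulr_ge0 ?invr_ge0 ?sqr_ge0.
  near=> n.
  have T0 : (0 < T n)%N by near: n; exact: near_gt0.
  have p0 : (0 < p n)%N by near: n; exact: near_gt0.
  have q0 : (0 < q n)%N by near: n; exact: near_gt0.
  have b0 : 0 <= b.
    have := X4 n 0%R (Ordinal p0) (Ordinal q0); rewrite expectation.unlock => h.
    rewrite -lee_fin (le_trans _ h) //; apply: integral_ge0 => w _.
    by rewrite lee_fin exprn_even_ge0.
  have VB (u : 'I_(p n) * 'I_(p n)) : (\int[P]_w (V n u.1 u.2 w ^+ 2)%:E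
      <= (c ^+ 4 * (b * (hi ^+ 4 * (q n)%:R / (T n)%:R)))%:E)%E.
    have := @array_second_moment _ _ _ _ _ b c (T n) 'I_(q n) (fun j => S n u.1 j * S n u.2 j)
      (fun j => (u.1, j)) (fun j => (u.2, j)) (XZ n) (iX n) (X4 n) (ca n) T0.
    have h1 (k l : 'I_(q n)) : k != l -> ~~ ((((u.1, k) == (u.1, l)) && ((u.2, k) == (u.2, l)))
        || (((u.1, k) == (u.2, l)) && ((u.2, k) == (u.1, l)))).
      by move=> /negPf kl; rewrite !xpair_eqE kl !andbF.
    move=> /(_ h1) h2; apply: le_trans (le_trans _ h2) _.
      rewrite le_eqVlt; apply/orP; left; apply/eqP; apply: eq_integral => w _; congr (_ ^+ 2)%:E.
      apply: eq_tavg => t _; apply: eq_bigr => j _; congr (_ * (_ - _)).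
      by rewrite /= xpair_eqE eqxx andbT.
    rewrite lee_fin; apply: ler_wpM2l; first by rewrite exprn_even_ge0.
    apply: ler_wpM2l => //.
    rewrite -[q n in leRHS]card_ord mulrAC mulr_natr -sumr_const.
    apply: ler_sum => j _; rewrite ler_wpM2r ?invr_ge0 //.
    have /andP[? ?] := hS n u.1 j; have /andP[? ?] := hS n u.2 j.
    rewrite exprMn (_ : hi ^+ 4 = hi ^+ 2 * hi ^+ 2); last by rewrite -exprD.
    by rewrite ler_pM ?sqr_ge0 // lerXn2r // nnegrE // (hi0 n).
  apply: le_trans (@integral_weighted_sum_le _ _ _ P _ (fun _ : 'I_(p n) * 'I_(p n) => (r n)^-1)
    (fun u w => V n u.1 u.2 w ^+ 2) _ _ _ _ VB) _.
  - by move=> u; rewrite invr_ge0 !mulr_ge0 ?invr_ge0 ?sqr_ge0.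
  - by move=> u; exact: measurable_funX.
  - by move=> u w; exact: sqr_ge0.
  rewrite lee_fin sumr_const card_prod !card_ord -[_ *+ (_ * _)]mulr_natr natrM /r.
  rewrite le_eqVlt; apply/orP; left; apply/eqP; field.
  by rewrite !pnatr_eq0 -!lt0n T0 p0 q0.
apply: tight_sub tV => K K1; near=> n => w /=.
have T0 : (0 < T n)%N by near: n; exact: near_gt0.
have p0 : (0 < p n)%N by near: n; exact: near_gt0.
have q0 : (0 < q n)%N by near: n; exact: near_gt0.
have r0 : 0 < r n by rewrite divr_gt0 ?mulr_gt0 ?exprn_gt0 ?ltr0n.
move=> h; rewrite -mulr_sumr mulrC ltr_pdivlMr //; apply: (lt_le_trans h).
by rewrite pair_bigA.
Unshelve. all: by end_near. Qed.

End ArrayEvents.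

(** * The good event of the model *)

Section ModelEvents.
Context {R : realType} {d : measure_display} {Omega : measurableType d}.
Variable P : probability Omega R.

Lemma fro_norm1 m n (A : 'M[R]_(m, n)) : fro A <= n%:R * norm1_mx A ^+ 2.
Proof.
have n0 j : \sum_i `|A i j| <= norm1_mx A by exact: le_bigmax.
rewrite /fro exchange_big /= -[n in n%:R]card_ord mulr_natl -sumr_const.
apply: ler_sum => j _; apply: (@le_trans _ _ ((\sum_i `|A i j|) ^+ 2)).
  rewrite expr2 mulr_suml; apply: ler_sum => i _.
  rewrite -real_normK ?num_real // expr2 ler_wpM2l // (bigD1 i) //= lerDl.
  exact: sumr_ge0.
by rewrite lerXn2r // nnegrE ?sumr_ge0 // (le_trans _ (n0 j)) ?sumr_ge0.
Qed.

(** The entries have unit second moment, so the mean is [fro B * fro D] times the number of entries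
    of [Fe]. Everything here is of order one, because [fro] is at most the number of columns times
    the squared column-sum norm. *)
Lemma common_tight (p q k l : nat -> nat) (Fe : forall n, int -> random_mx P (k n) (l n))
    (B : forall n, 'M[R]_(p n, k n)) (D : forall n, 'M[R]_(q n, l n)) (T : nat -> nat) :
  (forall n t i j, standardized (Fe n t i j)) ->
  (fun n => norm1_mx (B n)) =O_\oo (fun=> 1 : R) ->
  (fun n => norm1_mx (D n)) =O_\oo (fun=> 1 : R) ->
  (fun n => (k n)%:R : R) =O_\oo (fun=> 1 : R) ->
  (fun n => (l n)%:R : R) =O_\oo (fun=> 1 : R) ->
  T @ \oo --> \oo ->
  tight P (fun K n => [set w | K < fro (B n) * fro (D n) *
    tavg (T n) (fun t => fro (mx_at (Fe n t%:Z) w))]).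
Proof.
move=> stF /bigO_near[K1 K10 h1] /bigO_near[K2 K20 h2] /bigO_near[K3 K30 h3] /bigO_near[K4 K40 h4] Too.
have tE n w : fro (B n) * fro (D n) * tavg (T n) (fun t => fro (mx_at (Fe n t%:Z) w)) =
    \sum_(u : 'I_(T n) * ('I_(k n) * 'I_(l n)))
      (fro (B n) * fro (D n) / (T n)%:R) * Fe n u.1.+1%:Z u.2.1 u.2.2 w ^+ 2.
  rewrite -mulr_sumr /tavg [LHS]mulrA; congr (_ * _); rewrite big_add1 /= big_mkord.
  rewrite -(pair_bigA _ (fun (t : 'I_(T n)) (u : 'I_(k n) * 'I_(l n)) => Fe n t.+1%:Z u.1 u.2 w ^+ 2)) /=.
  apply: eq_bigr => t _; rewrite -(pair_bigA _ (fun i j => Fe n t.+1%:Z i j w ^+ 2)) /=.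
  by apply: eq_bigr => i _; apply: eq_bigr => j _; rewrite mxE.
have w0 n : 0 <= fro (B n) * fro (D n) / (T n)%:R.
  by rewrite !mulr_ge0 ?invr_ge0 ?fro_ge0.
suff : tight P (fun K n => [set w | K < \sum_(u : 'I_(T n) * ('I_(k n) * 'I_(l n)))
      (fro (B n) * fro (D n) / (T n)%:R) * Fe n u.1.+1%:Z u.2.1 u.2.2 w ^+ 2]).
  by apply: tight_sub => K _; apply: nearW => n w /=; rewrite tE.
apply: (@tight_markov _ _ _ P _ ((K3 * K1 ^+ 2) * (K4 * K2 ^+ 2) * (K3 * K4))).
- move=> n; apply: measurable_sum => u; apply: measurable_funM => //; exact: measurable_funX.
- by move=> n w; apply: sumr_ge0 => u _; rewrite mulr_ge0 ?sqr_ge0.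
near=> n.
have T0 : (0 < T n)%N by near: n; exact: near_gt0.
have b1 : `|norm1_mx (B n)| <= K1 by rewrite -[K1]mulr1 -[X in _ * X]normr1; near: n.
have b2 : `|norm1_mx (D n)| <= K2 by rewrite -[K2]mulr1 -[X in _ * X]normr1; near: n.
have b3 : (k n)%:R <= K3.
  by rewrite -[leLHS]ger0_norm // -[K3]mulr1 -[X in _ * X]normr1; near: n.
have b4 : (l n)%:R <= K4.
  by rewrite -[leLHS]ger0_norm // -[K4]mulr1 -[X in _ * X]normr1; near: n.
apply: le_trans (@integral_weighted_sum_le _ _ _ P _
  (fun u : 'I_(T n) * ('I_(k n) * 'I_(l n)) => fro (B n) * fro (D n) / (T n)%:R)
  (fun u w => Fe n u.1.+1%:Z u.2.1 u.2.2 w ^+ 2) 1 _ _ _ _) _ => //.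
- by move=> u; exact: measurable_funX.
- by move=> u w; exact: sqr_ge0.
- by move=> u; have [_ _ ->] := standardized_moments (stF n u.1.+1%:Z u.2.1 u.2.2).
rewrite lee_fin mulr1 sumr_const !card_prod !card_ord -[_ *+ _]mulr_natr !natrM.
rewrite [X in X <= _](_ : _ = fro (B n) * fro (D n) * ((k n)%:R * (l n)%:R)); last first.
  by field; rewrite pnatr_eq0 -lt0n.
have f1 : fro (B n) <= K3 * K1 ^+ 2.
  rewrite (le_trans (fro_norm1 _)) // ler_pM ?sqr_ge0 //.
  by rewrite -real_normK ?num_real // lerXn2r ?nnegrE // ltW.
have f2 : fro (D n) <= K4 * K2 ^+ 2.
  rewrite (le_trans (fro_norm1 _)) // ler_pM ?sqr_ge0 //.
  by rewrite -real_normK ?num_real // lerXn2r ?nnegrE // ltW.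
by rewrite !ler_pM ?mulr_ge0 ?fro_ge0.
Unshelve. all: by end_near. Qed.

(** * Strength and nondegeneracy of random loadings *)

Section Loading.
Variables (k : nat) (s : nat -> nat) (A : forall n, random_mx P (s n) k) (delta : nat -> R).
Arguments A : clear implicits.
Hypothesis strA : loading_strength A delta.
Hypothesis soo : s @ \oo --> \oo.

Let gramE n w i j : ((mx_at (A n) w)^T *m mx_at (A n) w) i j = \sum_l A n l i w * A n l j w.
Proof. by rewrite mxE; apply: eq_bigr => l _; rewrite !mxE. Qed.

Let colsqE n w i : colsq (mx_at (A n) w) i = \sum_l A n l i w ^+ 2.
Proof. by apply: eq_bigr => l _; rewrite mxE. Qed.

Let diagE n w i : diag_part ((mx_at (A n) w)^T *m mx_at (A n) w) i i = colsq (mx_at (A n) w) i.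
Proof.
rewrite /diag_part mxE eqxx mulr1n mxE gramE colsqE.
by apply: eq_bigr => l _; rewrite expr2.
Qed.

Let colsq_ge0 n w i : 0 <= colsq (mx_at (A n) w) i.
Proof. by apply: sumr_ge0 => l _; exact: sqr_ge0. Qed.

Let mcolsq n i : measurable_fun setT (fun w => colsq (mx_at (A n) w) i).
Proof.
rewrite (_ : (fun w => _) = fun w => \sum_l A n l i w ^+ 2); last first.
  by apply/funext => w; exact: colsqE.
by apply: measurable_sum => l; exact: measurable_funX.
Qed.

Let sn n i : R := (s n)%:R `^ delta i.

Lemma loading_strength_tight :
  tight P (fun K n => [set w | ~ forall i : 'I_k,
    (s n)%:R `^ delta i.+1 <= K * colsq (mx_at (A n) w) i /\
    colsq (mx_at (A n) w) i <= K * (s n)%:R `^ delta i.+1]).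
Proof.
have [_ _ aeZ _] := strA.
pose E K n := [set w | forall i : 'I_k, sn n i.+1 <= K * colsq (mx_at (A n) w) i /\
    colsq (mx_at (A n) w) i <= K * sn n i.+1].
have mE K n : measurable (E K n).
  rewrite (_ : E K n = \bigcap_(i in [set: 'I_k])
     ([set w | sn n i.+1 <= K * colsq (mx_at (A n) w) i] `&`
      [set w | colsq (mx_at (A n) w) i <= K * sn n i.+1])); last first.
    by apply/seteqP; split => w h i; have := h i; [move=> ? _|move=> /(_ I)].
  apply: fin_bigcap_measurable => // i _; apply: measurableI.
    rewrite -[X in measurable X]setTI; apply: measurable_fun_le => //.
    exact: measurable_funM.
  by rewrite -[X in measurable X]setTI; apply: measurable_fun_le.
apply: (@tight_eventually _ _ _ P E) => //.
- move=> K K' n KK' w h i; have [h1 h2] := h i; split.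
    by apply: (le_trans h1); rewrite ler_wpM2r.
  by apply: (le_trans h2); rewrite ler_wpM2r ?powR_ge0.
apply: filterS aeZ => w hw.
have : forall i : 'I_k, exists K, forall K', K <= K' -> \forall n \near \oo,
    sn n i.+1 <= K' * colsq (mx_at (A n) w) i /\ colsq (mx_at (A n) w) i <= K' * sn n i.+1.
  move=> i; have [/bigO_near[K1 K10 h1] /bigO_near[K2 K20 h2]] := hw i.
  exists (Num.max K1 K2) => K'; rewrite ge_max => /andP[k1 k2].
  near=> n; split.
    have : `|(s n)%:R `^ delta i.+1| <= K2 * `|diag_part ((mx_at (A n) w)^T *m mx_at (A n) w) i i|.
      by near: n.
    rewrite diagE !ger0_norm ?powR_ge0 // => /le_trans; apply.
    by rewrite ler_wpM2r.
  have : `|diag_part ((mx_at (A n) w)^T *m mx_at (A n) w) i i| <= K1 * `|(s n)%:R `^ delta i.+1|.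
    by near: n.
  rewrite diagE !ger0_norm ?powR_ge0 // => /le_trans; apply.
  by rewrite ler_wpM2r ?powR_ge0.
move=> /choice[K hK]; exists (\big[Num.max/0]_i K i).
by apply: filter_forall => i; apply: hK; exact: le_bigmax.
Unshelve. all: by end_near. Qed.

(** Scaled by its column norms, the Gram matrix tends to [S], whose form is at least [lo] times the
    squared norm. Half of [lo] is reserved for the approximation error. *)
Lemma loading_gram_tight : exists2 c0 : R, 0 < c0 &
  tight P (fun _ n => [set w | ~ forall y : 'rV[R]_k,
    c0 * \sum_i y 0 i ^+ 2 * colsq (mx_at (A n) w) i <= sqn (y *m (mx_at (A n) w)^T)]).
Proof.
have [_ [S [[symS posS] [lo [hi [lo0 hS]]] cvS]] aeZ _] := strA.
exists (lo / 2); first by rewrite divr_gt0.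
(* An entrywise error [eta] costs at most [eta * k] in the quadratic form, hence at most [lo / 2];
   [k.+1] keeps the denominator nonzero. *)
pose eta := lo / (2 * k.+1%:R).
have eta0 : 0 < eta by rewrite divr_gt0.
pose G n w i j := \sum_l A n l i w * A n l j w.
pose r n w i := Num.sqrt (colsq (mx_at (A n) w) i).
(* The convergence is multiplied out by the column norms, so the event involves no division. It does
   not depend on the constant and is therefore trivially monotone in it. *)
pose E (_ : R) n := [set w | forall i j, `|G n w i j - S i j * (r n w i * r n w j)| <=
  eta * (r n w i * r n w j)].
have r0 n w i : 0 <= r n w i by exact: sqrtr_ge0.
have mr n i : measurable_fun setT (fun w => r n w i).
  apply: (measurableT_comp _ (mcolsq n i)).
  by apply: continuous_measurable_fun; exact: sqrt_continuous.
have mE K n : measurable (E K n).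
  rewrite (_ : E K n = \bigcap_(i in [set: 'I_k]) \bigcap_(j in [set: 'I_k])
     [set w | `|G n w i j - S i j * (r n w i * r n w j)| <= eta * (r n w i * r n w j)]); last first.
    by apply/seteqP; split => [w h i _ j _|w h i j]; [exact: h|exact: h].
  apply: fin_bigcap_measurable => // i _; apply: fin_bigcap_measurable => // j _.
  rewrite -[X in measurable X]setTI; apply: measurable_fun_le => //.
    apply: measurableT_comp => //; apply: measurable_funB.
      by apply: measurable_sum => l; apply: measurable_funM.
    by apply: measurable_funM => //; apply: measurable_funM.
  by apply: measurable_funM => //; apply: measurable_funM.
have tE : tight P (fun K n => ~` E K n).
  apply: (@tight_eventually _ _ _ P E mE) => [K K1 n _ w|]; first exact: id.
  apply: filterS2 aeZ cvS => w hw cw; exists 0.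
  apply: filter_forall => i; apply: filter_forall => j.
  have [_ /bigO_near[K1 K10 h1]] := hw i.
  have [_ /bigO_near[K2 K20 h2]] := hw j.
  have := cvg_comp _ _ cw (@coord_continuous R k k i j S).
  move=> /cvgrPdist_le /(_ eta eta0) h3.
  near=> n.
  have s0 : (0 < s n)%N by near: n; exact: near_gt0.
  have pos (a : R) i' K : `|(s n)%:R `^ a| <= K * `|diag_part ((mx_at (A n) w)^T *m mx_at (A n) w) i' i'| ->
      0 < r n w i'.
    rewrite diagE !ger0_norm ?powR_ge0 // => h; rewrite sqrtr_gt0 lt_neqAle colsq_ge0 andbT.
    apply/eqP => z0; move: h; rewrite -z0 mulr0 leNgt powR_gt0 ?ltr0n //.
  have ri : 0 < r n w i by apply: (pos (delta i.+1) i K1); near: n.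
  have rj : 0 < r n w j by apply: (pos (delta j.+1) j K2); near: n.
  have : `|S i j - (diag_inv_sqrt (diag_part ((mx_at (A n) w)^T *m mx_at (A n) w)) *m
      ((mx_at (A n) w)^T *m mx_at (A n) w) *m
      diag_inv_sqrt (diag_part ((mx_at (A n) w)^T *m mx_at (A n) w))) i j| <= eta by near: n.
  have -> : (diag_inv_sqrt (diag_part ((mx_at (A n) w)^T *m mx_at (A n) w)) *m
      ((mx_at (A n) w)^T *m mx_at (A n) w) *m
      diag_inv_sqrt (diag_part ((mx_at (A n) w)^T *m mx_at (A n) w))) i j =
      (r n w i)^-1 * G n w i j * (r n w j)^-1.
    by rewrite /diag_inv_sqrt mul_mx_diag mxE mul_diag_mx mxE gramE [X in X * _ * _]mxE [X in _ * X]mxE !diagE.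
  move=> h; rewrite distrC -(ler_pdivrMr _ _ (mulr_gt0 ri rj)).
  rewrite -[X in _ / X]gtr0_norm ?mulr_gt0 // -normf_div.
  rewrite mulrBl mulfK ?gt_eqF ?mulr_gt0 // (le_trans _ h) //.
  rewrite le_eqVlt; apply/orP; left; apply/eqP; congr `|_ - _|.
  by field; rewrite !gt_eqF.
apply: tight_sub tE => K K1; apply: nearW => n w /= hw Ew; apply: hw => y.
(* In the coordinates [z] the form of the limit [S] is directly comparable with the sum of
   [y 0 i ^+ 2 * colsq _ i], which is [sqn z]. *)
pose z : 'rV[R]_k := \row_i (y 0 i * r n w i).
have zE : sqn z = \sum_i y 0 i ^+ 2 * colsq (mx_at (A n) w) i.
  by apply: eq_bigr => i _; rewrite mxE exprMn sqr_sqrtr.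
have yE : sqn (y *m (mx_at (A n) w)^T) = \sum_i \sum_j y 0 i * y 0 j * G n w i j.
  rewrite sqnE trmx_mul trmxK !mulmxA -(mulmxA y) mxE exchange_big /=.
  apply: eq_bigr => j _; rewrite mxE mulr_suml; apply: eq_bigr => i _.
  by rewrite gramE mxE mulrAC.
have zS : qform S z = \sum_i \sum_j y 0 i * y 0 j * (S i j * (r n w i * r n w j)).
  rewrite /qform mxE exchange_big /=; apply: eq_bigr => j _; rewrite mxE mulr_suml.
  by apply: eq_bigr => i _; rewrite !mxE; ring.
have lo_z := eigen_qform_ge symS (fun x hx => proj1 (andP (hS x hx))) z.
have dev : qform S z - sqn (y *m (mx_at (A n) w)^T) <= eta * (k.+1%:R * sqn z).
  rewrite zS yE -sumrB.
  under eq_bigr => i _ do rewrite -sumrB.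
  apply: (@le_trans _ _ (eta * (\sum_i `|z 0 i|) ^+ 2)); last first.
    rewrite ler_wpM2l ?(ltW eta0) // (le_trans (sqr_sum_le _)) // card_ord.
    under eq_bigr do rewrite real_normK ?num_real //.
    by rewrite ler_wpM2r ?sqn_ge0 // ler_nat.
  rewrite expr2 mulr_suml mulr_sumr; apply: ler_sum => i _.
  rewrite !mulr_sumr; apply: ler_sum => j _.
  rewrite -mulrBr (le_trans (ler_norm _)) // normrM distrC.
  apply: (le_trans (ler_wpM2l _ (Ew i j))) => //.
  rewrite !mxE !normrM [`|r n w i|]ger0_norm // [`|r n w j|]ger0_norm //.
  by rewrite le_eqVlt; apply/orP; left; apply/eqP; ring.
rewrite -zE; have e : eta * (k.+1%:R * sqn z) = lo / 2 * sqn z.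
  by rewrite /eta; move: (k.+1%:R : R) (lt0r_neq0 (ltr0Sn R k)) => a0 a0n; field.
by rewrite e in dev; lra.
Unshelve. all: by end_near. Qed.

End Loading.
End ModelEvents.

(** * The eigenvalue-ratio criterion *)

Section RatioArgmin.
Variable R : realType.

(** [l] lists the eigenvalues and [U j] their order of magnitude. The constant [tau] solves
    [tau * D = c1 ^+ 2 / 8], where [D] is the constant in the upper bound of the cross-multiplied
    ratio inequality; half of the lower bound is then left over. The bound on [l] reaches [m.+1]
    because the ratio at [m] reads the next eigenvalue. *)
Lemma argmin_eig_ratio (l U : nat -> R) (xi K c1 C1 : R) (k m kh : nat) :
  let tau := c1 ^+ 2 / (8 * ((C1 + 2 * K + 1) * (2 * K + 1))) in
  (1 <= k <= m)%N -> 0 < xi -> 1 <= K -> 0 < c1 -> c1 <= 1 -> 0 <= C1 ->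
  (forall j, 0 <= l j) -> (forall j, 0 < U j) ->
  (forall j, (1 <= j <= k)%N -> U k <= U j) ->
  (forall j, (1 <= j <= k)%N -> c1 * U j - K * xi <= l j /\ l j <= C1 * U j + 2 * K * xi) ->
  (forall j, (k < j <= m.+1)%N -> l j <= 2 * K * xi) ->
  xi <= tau * U k ->
  (forall j, (1 <= j < k)%N -> xi * U j <= tau * (U j.+1 * U k)) ->
  is_argmin (fun j => (l j.+1 + xi) / (l j + xi)) m kh -> kh = k.
Proof.
move=> tau /andP[k1 km] xi0 K1 c10 c11 C10 l0 U0 Uk hl hl' xiU xiUU [/andP[kh1 khm] hmin].
have c1n : 0 <= c1 by exact: ltW.
set D := (C1 + 2 * K + 1) * (2 * K + 1) in tau xiU xiUU *.
have D1 : 2 * K + 1 <= D by rewrite /D; nra.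
have D0 : 0 < D by lra.
have tauD : tau * D = c1 ^+ 2 / 8 by rewrite /tau; field; rewrite gt_eqF.
have tau0 : 0 <= tau by rewrite /tau divr_ge0 ?sqr_ge0 // mulr_ge0 // ltW.
have c1sq : c1 ^+ 2 <= c1 by rewrite expr2 ler_piMl.
have tauK : tau * (2 * K + 1) <= c1 / 8.
  by apply: (@le_trans _ _ (tau * D)); [rewrite ler_wpM2l|rewrite tauD; lra].
have tau1 : tau <= 1.
  apply: (@le_trans _ _ (tau * (2 * K + 1))); last by lra.
  by rewrite ler_peMr //; lra.
have KxiU : K * xi <= c1 / 2 * U k.
  have : (2 * K + 1) * xi <= (2 * K + 1) * (tau * U k) by rewrite ler_wpM2l //; lra.
  have : (tau * (2 * K + 1)) * U k <= c1 / 8 * U k by rewrite ler_wpM2r // ltW.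
  rewrite mulrA [_ * tau]mulrC; have := U0 k => ? ? ?.
  have : 0 < c1 * U k by rewrite mulr_gt0.
  have : 0 < K * xi by rewrite mulr_gt0 //; lra.
  by lra.
have xiUk : xi <= U k by rewrite (le_trans xiU) // ler_piMl // ltW.
have low j : (1 <= j <= k)%N -> c1 / 2 * U j <= l j + xi.
  move=> jk; have [h _] := hl j jk; have := Uk j jk => hU.
  have : c1 / 2 * U k <= c1 / 2 * U j by rewrite ler_wpM2l // divr_ge0.
  by lra.
have hik : l k.+1 + xi <= (2 * K + 1) * xi.
  by have := hl' k.+1; rewrite ltnSn ltnS km => /(_ isT); lra.
have pos j : 0 < l j + xi by rewrite ltr_wpDl.
(* Minimality against the competitor [k], cleared of denominators. *)
have cross : (l kh.+1 + xi) * (l k + xi) <= (l k.+1 + xi) * (l kh + xi).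
  have := hmin k; rewrite k1 km => /(_ isT) /=.
  by rewrite ler_pdivrMr // mulrAC ler_pdivlMr // [X in _ <= X]mulrC.
have U0k := U0 k.
have c1U : 0 < c1 * U k by rewrite mulr_gt0.
case: (ltngtP kh k) => // khk; exfalso.
(* Underestimation: the left side of [cross] is at least [c1 ^+ 2 / 4 * (U kh.+1 * U k)], the right
   side at most [D * (xi * U kh)], half as large by the gap. *)
- have khk' : (1 <= kh <= k)%N by rewrite kh1 ltnW.
  have low1 := low kh.+1 khk; have low2 := low k; rewrite k1 leqnn in low2.
  have {}low2 := low2 isT.
  have [_ up] := hl kh khk'.
  have h1 : c1 / 2 * U kh.+1 * (c1 / 2 * U k) <= (l kh.+1 + xi) * (l k + xi).
    by apply: ler_pM => //; rewrite mulr_ge0 ?divr_ge0 // ltW.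
  have up2 : l kh + xi <= (C1 + 2 * K + 1) * U kh.
    have : xi <= U kh by rewrite (le_trans xiUk) // Uk.
    by have := U0 kh; nra.
  have h2 : (l k.+1 + xi) * (l kh + xi) <= (2 * K + 1) * xi * ((C1 + 2 * K + 1) * U kh).
    by apply: ler_pM => //; exact: ltW.
  have h3 : D * (xi * U kh) <= D * (tau * (U kh.+1 * U k)).
    by rewrite ler_wpM2l ?(ltW D0) // xiUU // kh1.
  have h4 : D * (tau * (U kh.+1 * U k)) = c1 ^+ 2 / 8 * (U kh.+1 * U k).
    by rewrite -tauD; ring.
  have h5 : (2 * K + 1) * xi * ((C1 + 2 * K + 1) * U kh) = D * (xi * U kh) by rewrite /D; ring.
  have h6 : c1 / 2 * U kh.+1 * (c1 / 2 * U k) = 2 * (c1 ^+ 2 / 8 * (U kh.+1 * U k)) by field.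
  have : 0 < c1 ^+ 2 / 8 * (U kh.+1 * U k) by rewrite !mulr_gt0 ?exprn_gt0 ?invr_gt0.
  by rewrite h5 in h2; rewrite h4 in h3; rewrite h6 in h1; lra.
(* Overestimation: both eigenvalues on the right of [cross] are of noise size, so it is of order
   [xi ^+ 2], whereas the left side keeps [xi * U k]. *)
- have up : l kh + xi <= (2 * K + 1) * xi.
    by have := hl' kh; rewrite khk (leq_trans khm) // => /(_ isT); lra.
  have low2 := low k; rewrite k1 leqnn in low2; have {}low2 := low2 isT.
  have h1 : xi * (c1 / 2 * U k) <= (l kh.+1 + xi) * (l k + xi).
    by apply: ler_pM => //; rewrite ?(ltW xi0) ?lerDr // mulr_ge0 ?divr_ge0 // ltW.
  have h2 : (l k.+1 + xi) * (l kh + xi) <= (2 * K + 1) * xi * ((2 * K + 1) * xi).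
    by apply: ler_pM => //; exact: ltW.
  have h3 : xi * (c1 / 2 * U k) <= xi * ((2 * K + 1) * ((2 * K + 1) * xi)).
    rewrite (le_trans h1) // (le_trans cross) // (le_trans h2) //.
    by rewrite le_eqVlt; apply/orP; left; apply/eqP; ring.
  rewrite ler_pM2l // in h3.
  have h4 : (2 * K + 1) * ((2 * K + 1) * xi) <= D * (tau * U k).
    rewrite mulrA; apply: ler_pM => //; rewrite ?(ltW xi0) //; first by nra.
    by rewrite /D ler_wpM2r //; lra.
  have h5 : D * (tau * U k) = c1 ^+ 2 / 8 * U k by rewrite -tauD; ring.
  have h6 : c1 ^+ 2 / 8 * U k <= c1 / 8 * U k by rewrite ler_wpM2r ?(ltW U0k) //; lra.
  by lra.
Qed.

(** * The noise size against the prescribed rate *)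

Section NoiseRate.
Variables (T p q : nat).
Hypotheses (T0 : (0 < T)%N) (p0 : (0 < p)%N) (q0 : (0 < q)%N).

Let powR_half (x : R) : 0 <= x -> x `^ (- (1 / 2)) = (Num.sqrt x)^-1.
Proof. by move=> x0; rewrite powRN div1r powR12_sqrt. Qed.

(** The second summand of the rate suffices: pq p^(-1/2) = q sqrt(p), and p is at least 1. *)
Lemma noise_rate_ge_q : q%:R <= p%:R * q%:R * noise_rate R T p q.
Proof.
rewrite /noise_rate !powR_half //.
have p1 : 1 <= Num.sqrt p%:R :> R by rewrite -[leLHS]sqrtr1 ler_wsqrtr // ler1n.
have q00 : 0 <= q%:R :> R by [].
have a0 : 0 <= (Num.sqrt (T%:R * q%:R))^-1 :> R by rewrite invr_ge0 sqrtr_ge0.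
apply: (@le_trans _ _ (q%:R * (p%:R * (Num.sqrt p%:R)^-1))).
  rewrite ler_peMr //; rewrite -[X in X / _](@sqr_sqrtr R p%:R) // expr2 mulfK //.
  by rewrite gt_eqF // (lt_le_trans _ p1).
by rewrite mulrDr mulrA [q%:R * _]mulrC lerDr mulr_ge0 // mulr_ge0.
Qed.

(** The left side is exactly pq (Tq)^(-1/2), the contribution of the first summand. *)
Lemma noise_rate_ge_sqrt :
  Num.sqrt (p%:R ^+ 2 * q%:R / T%:R) <= p%:R * q%:R * noise_rate R T p q.
Proof.
rewrite /noise_rate !powR_half // mulrDr.
have a0 : 0 <= (Num.sqrt p%:R)^-1 :> R by rewrite invr_ge0 sqrtr_ge0.
rewrite ler_wpDr ?mulr_ge0 //.
have s0 : 0 <= p%:R * q%:R / Num.sqrt (T%:R * q%:R) :> R.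
  by rewrite mulr_ge0 ?mulr_ge0 ?invr_ge0 ?sqrtr_ge0.
rewrite -[leRHS]ger0_norm // -sqrtr_sqr ler_wsqrtr // expr_div_n sqr_sqrtr ?mulr_ge0 //.
rewrite le_eqVlt; apply/orP; left; apply/eqP; field.
by rewrite !pnatr_eq0 -!lt0n T0 q0.
Qed.

End NoiseRate.

(** * From the gap condition to inequalities between eigenvalue orders *)

Section StrengthGap.
Variables (k : nat) (T p q : nat -> nat) (dr dc : nat -> R) (xi : nat -> R).
Hypothesis k1 : (1 <= k)%N.
Hypothesis poo : p @ \oo --> \oo.
Hypothesis qoo : q @ \oo --> \oo.
Hypothesis dr_dec : forall i j, (1 <= i <= j)%N -> (j <= k)%N -> dr j <= dr i.
Hypothesis xi_pos : forall n, 0 < xi n.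
Hypothesis xiO : xi =O_\oo (fun n => (p n)%:R * (q n)%:R * noise_rate R (T n) (p n) (q n)).
Hypothesis gap : strength_gap k T p q dr dc.

Let U j n : R := (q n)%:R `^ dc 1%N * (p n)%:R `^ dr j.
Let g n : R := (p n)%:R `^ (1 - dr k) * (q n)%:R `^ (1 - dc 1%N) * noise_rate R (T n) (p n) (q n).

Let rate_ge0 n : 0 <= noise_rate R (T n) (p n) (q n).
Proof. by rewrite addr_ge0 ?powR_ge0. Qed.

Let g_ge0 n : 0 <= g n.
Proof. by rewrite !mulr_ge0 ?powR_ge0. Qed.

(** The quantity [g] of the gap condition is the noise level relative to [U k], the order of the
    weakest factor eigenvalue. *)
Let gU n : (0 < p n)%N -> (0 < q n)%N ->
  (p n)%:R * (q n)%:R * noise_rate R (T n) (p n) (q n) = g n * U k n.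
Proof.
move=> p0 q0; rewrite /g /U.
have powE (m : nat) (a : R) : (0 < m)%N -> m%:R `^ (1 - a) * m%:R `^ a = m%:R :> R.
  move=> m0; rewrite -powRD ?subrK ?powRr1 //.
  by apply/implyP => _; rewrite pnatr_eq0 -lt0n.
rewrite -{1}(powE _ (dr k) p0) -{1}(powE _ (dc 1%N) q0); ring.
Qed.

(** Since [xi] is at most a constant times [g * U k], smallness of [g] gives the first bound. For
    the second, the power of p in the gap condition is exactly the ratio of [U j.+1] to [U j]. *)
Lemma strength_gap_bounds (tau : R) : 0 < tau -> \forall n \near \oo,
  xi n <= tau * U k n /\
  forall j, (1 <= j < k)%N -> xi n * U j n <= tau * (U j.+1 n * U k n).
Proof.
move=> tau0; have [K0 K00 xiK] := bigO_near xiO.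
have e0 : 0 < tau / K0 by rewrite divr_gt0.
have gsmall : \forall n \near \oo, g n <= tau / K0.
  have [k_1|k2] := eqVneq k 1%N.
    have [_ /(_ k_1)/littleo_near/(_ _ e0)] := gap.
    apply: filterS => n; rewrite normr1 mulr1 -{1}k_1 -/(g n) ger0_norm //.
  have k2' : (2 <= k)%N by rewrite ltn_neqAle eq_sym k2.
  (* With at least two factors the condition at [j = 1] suffices, because the strengths decrease and
     the power of p is then at most 1. *)
  have [/(_ k2' 1%N) + _] := gap; have k11 : (1 <= 1 <= k.-1)%N by case: (k) k2' => [|[]].
  move=> /(_ k11)/littleo_near/(_ _ e0) gs.
  near=> n; have p0 : (0 < p n)%N by near: n; exact: near_gt0.
  have : `|g n| <= tau / K0 * `|(p n)%:R `^ (dr 2%N - dr 1%N)| by near: n.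
  rewrite !ger0_norm ?powR_ge0 // => /le_trans; apply.
  rewrite ler_piMr ?(ltW e0) // -[leRHS](powRr0 (p n)%:R) ler_powR ?ler1n //.
  by rewrite subr_le0 dr_dec.
have gj : \forall n \near \oo, forall j : 'I_k, (1 <= j)%N ->
    g n <= tau / K0 * (p n)%:R `^ (dr j.+1 - dr j).
  apply: filter_forall => j; have [j1|] := boolP (1 <= j)%N; last by move=> _; apply: nearW.
  have jk := ltn_ord j.
  have k2' : (2 <= k)%N by rewrite (leq_ltn_trans j1).
  have [/(_ k2' j) + _] := gap.
  have jk1 : (1 <= j <= k.-1)%N by rewrite j1 -ltnS prednK.
  move=> /(_ jk1)/littleo_near/(_ _ e0); apply: filterS => n + _.
  by rewrite -/(g n) !ger0_norm ?powR_ge0.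
near=> n.
have p0 : (0 < p n)%N by near: n; exact: near_gt0.
have q0 : (0 < q n)%N by near: n; exact: near_gt0.
have U0 j : 0 < U j n by rewrite mulr_gt0 ?powR_gt0 ?ltr0n.
have xig : xi n <= K0 * (g n * U k n).
  rewrite -gU // -[leLHS]gtr0_norm // -[_ * _ * noise_rate _ _ _ _]ger0_norm; first by near: n.
  by rewrite !mulr_ge0.
split.
  apply: (le_trans xig); rewrite mulrA ler_wpM2r ?(ltW (U0 k)) //.
  by rewrite mulrC -ler_pdivlMr //; near: n.
move=> j /andP[j1 jk].
have gjn : g n <= tau / K0 * (p n)%:R `^ (dr j.+1 - dr j).
  have : forall j : 'I_k, (1 <= j)%N -> g n <= tau / K0 * (p n)%:R `^ (dr j.+1 - dr j) by near: n.
  by move=> /(_ (Ordinal jk) j1).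
have UjE : U j.+1 n = (p n)%:R `^ (dr j.+1 - dr j) * U j n.
  rewrite /U mulrCA -powRD ?subrK //.
  by apply/implyP => _; rewrite pnatr_eq0 -lt0n.
rewrite UjE; apply: (@le_trans _ _ (K0 * (g n * U k n) * U j n)).
  by rewrite ler_wpM2r // ltW.
apply: (@le_trans _ _ (K0 * (tau / K0 * (p n)%:R `^ (dr j.+1 - dr j) * U k n) * U j n)).
  by rewrite ler_wpM2r ?(ltW (U0 _)) // ler_wpM2l ?(ltW K00) // ler_wpM2r ?(ltW (U0 _)).
rewrite le_eqVlt; apply/orP; left; apply/eqP; field.
by rewrite gt_eqF.
Unshelve. all: by end_near. Qed.

End StrengthGap.
End RatioArgmin.

(** * Consistency for the rows *)

Section RowTheorem.
Context {R : realType} {d : measure_display} {Omega : measurableType d}.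
Variable P : probability Omega R.

Lemma centering_mul_const m n : (0 < m)%N ->
  centering_mx R m *m (const_mx 1 : 'M[R]_(m, n)) = 0.
Proof.
move=> m0; rewrite /centering_mx mulmxBl mul1mx -scalemxAl.
apply/matrixP => i j; rewrite !mxE; under eq_bigr do rewrite !mxE mulr1.
by rewrite sumr_const card_ord mulVf ?subrr // pnatr_eq0 -lt0n.
Qed.

Lemma const_mul_centering m n : (0 < m)%N ->
  (const_mx 1 : 'M[R]_(n, m)) *m centering_mx R m = 0.
Proof.
move=> m0; apply: trmx_inj; rewrite trmx_mul centering_tr trmx_const trmx0.
exact: centering_mul_const.
Qed.

Lemma centering_fix m n (A : 'M[R]_(m, n)) : (const_mx 1 : 'rV[R]_m) *m A = 0 ->
  centering_mx R m *m A = A.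
Proof.
move=> A0; rewrite /centering_mx mulmxBl mul1mx -scalemxAl.
have -> : (const_mx 1 : 'M[R]_m) = (const_mx 1 : 'cV[R]_m) *m (const_mx 1 : 'rV[R]_m).
  by apply/matrixP => i j; rewrite !mxE big_ord1 !mxE mulr1.
by rewrite -mulmxA A0 mulmx0 scaler0 subr0.
Qed.

Lemma sandwich_sum m n (U : 'M[R]_m) (V : 'M[R]_n) (X1 X2 X3 X4 X5 : 'M[R]_(m, n)) :
  U *m X1 *m V = 0 -> U *m X2 *m V = 0 -> U *m X3 *m V = 0 ->
  U *m (X1 + X2 + X3 + X4 + X5) *m V = U *m X4 *m V + U *m X5 *m V.
Proof. by rewrite !mulmxDr !mulmxDl => -> -> ->; rewrite !add0r. Qed.

(** All random estimates appear here as inequalities with one [K]. The factor form lies between 1/2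
    and 3/2 of [f * sqn y] with [f = fro C]. From [f >= v 1 / K] and columns of squared norm at
    least [u j / K] comes [s / (4 * K ^+ 2)]; the upper bounds [kc * K * v 1] and [kr * K * u j]
    give [C1]. The noise is at most [4 * K + 2 * hi ^+ 2] times the rate. The [min] and [max] with 1
    provide the normalization that [argmin_eig_ratio] expects. *)
Lemma scov_lambda_bounds (T p q kr kc k l : nat) (A : 'M[R]_(p, kr)) (C : 'M[R]_(q, kc))
    (F : nat -> 'M[R]_(kr, kc)) (L : nat -> 'M[R]_(p, q)) (B : 'M[R]_(p, k)) (D : 'M[R]_(q, l))
    (Fe : nat -> 'M[R]_(k, l)) (S : 'M[R]_(p, q)) (e : nat -> 'M[R]_(p, q))
    (K K5 s hi xi : R) (u v : nat -> R) :
  let nu := Num.max 1 ((4 * K + 2 * hi ^+ 2) * K5) in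
  let c1 := Num.min 1 (s / (4 * K ^+ 2)) in
  let C1 := 3 * kc%:R * kr%:R * K ^+ 2 in
  (0 < T)%N -> (0 < p)%N -> (0 < q)%N -> (0 < kr)%N -> (0 < kc)%N -> (kr <= p)%N ->
  1 <= K -> 0 < K5 -> 0 < s -> 0 < xi ->
  (forall j, 0 < u j) -> (forall j, 0 < v j) ->
  (forall i j, (1 <= i <= j)%N -> (j <= kr)%N -> u j <= u i) ->
  (forall i j, (1 <= i <= j)%N -> (j <= kc)%N -> v j <= v i) ->
  (forall t, (1 <= t <= T)%N -> L t = A *m F t *m C^T + centering_mx R p *m
     (B *m Fe t *m D^T + map2_mx *%R S (e t)) *m centering_mx R q) ->
  (forall i j i' j', `|tavg T (fun t => F t i j * F t i' j') - ((i, j) == (i', j'))%:R|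
     <= (2 * (kr * kc)%:R)^-1) ->
  (forall i : 'I_kr, u i.+1 <= K * colsq A i /\ colsq A i <= K * u i.+1) ->
  (forall i : 'I_kc, v i.+1 <= K * colsq C i /\ colsq C i <= K * v i.+1) ->
  (forall y : 'rV_kr, s * (\sum_i y 0 i ^+ 2 * colsq A i) <= sqn (y *m A^T)) ->
  fro B * fro D * tavg T (fun t => fro (Fe t)) <= K ->
  \sum_i \sum_i' (tavg T (fun t => \sum_j S i j * S i' j *
      (e t i j * e t i' j - (i == i')%:R))) ^+ 2 <= K * (p%:R ^+ 2 * q%:R / T%:R) ->
  (forall i j, 0 <= S i j <= hi) ->
  p%:R * q%:R * noise_rate R T p q <= K5 * xi ->
  (forall j, (1 <= j <= kr)%N ->
     c1 * (v 1%N * u j) - nu * xi <= lambda j (scov T L) /\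
     lambda j (scov T L) <= C1 * (v 1%N * u j) + 2 * nu * xi) /\
  (forall j, (kr < j <= p)%N -> lambda j (scov T L) <= 2 * nu * xi).
Proof.
move=> nu c1 C1 T0 p0 q0 kr0 kc0 krp K1 K50 s0 xi0 u0 v0 udec vdec hL hF hZr hZc hG hcom hid hS hrate.
have K0 : 0 < K by lra.
have hi2 : 0 <= hi ^+ 2 by exact: sqr_ge0.
set f := fro C.
have fE : f = \sum_l colsq C l by rewrite /f /fro exchange_big.
have csq0 (l' : 'I_kc) : 0 <= colsq C l' by apply: sumr_ge0 => a _; exact: sqr_ge0.
have asq0 (i : 'I_kr) : 0 <= colsq A i by apply: sumr_ge0 => a _; exact: sqr_ge0.
have f_lo : v 1%N <= K * f.
  have [h _] := hZc (Ordinal kc0); apply: (le_trans h).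
  by rewrite ler_wpM2l ?(ltW K0) // fE (bigD1 (Ordinal kc0)) //= lerDl sumr_ge0.
have f_hi : f <= kc%:R * (K * v 1%N).
  rewrite fE -[kc in kc%:R]card_ord mulr_natl -sumr_const; apply: ler_sum => l' _.
  have [_ h] := hZc l'; apply: (le_trans h); rewrite ler_wpM2l ?(ltW K0) //.
  exact: vdec.
have f0 : 0 <= f by exact: fro_ge0.
pose w := 4 * K + 2 * hi ^+ 2.
have w0 : 0 <= w by rewrite /w; lra.
have nuxi : w * (p%:R * q%:R * noise_rate R T p q) <= nu * xi.
  apply: (@le_trans _ _ (w * K5 * xi)); first by rewrite -(mulrA w) ler_wpM2l.
  by rewrite ler_wpM2r ?(ltW xi0) // le_max lexx orbT.
have hnoise x : tavg T (fun t => sqn (x *m (centering_mx R p *m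
     (B *m Fe t *m D^T + map2_mx *%R S (e t)) *m centering_mx R q))) <= nu * xi * sqn x.
  pose vv : R := Num.sqrt (K * (p%:R ^+ 2 * q%:R / T%:R)).
  have pq0 : 0 <= p%:R ^+ 2 * q%:R / T%:R :> R by rewrite !mulr_ge0 ?invr_ge0.
  have hV : \sum_i \sum_i' (tavg T (fun t => \sum_j S i j * S i' j *
      (e t i j * e t i' j - (i == i')%:R))) ^+ 2 <= vv ^+ 2.
    by rewrite sqr_sqrtr // mulr_ge0 // ltW.
  apply: (le_trans (noise_form_le B D Fe x T0 (sqrtr_ge0 _) hS hV)).
  rewrite ler_wpM2r ?sqn_ge0 // (le_trans _ nuxi) //.
  have r1 := noise_rate_ge_q R T q p0.
  have r2 := noise_rate_ge_sqrt R p T0 q0.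
  set r := p%:R * q%:R * noise_rate R T p q in r1 r2 *.
  have q1 : 1 <= q%:R :> R by rewrite ler1n.
  (* The square root of [K] is at most [K] because [1 <= K]. *)
  have vvr : vv <= K * r.
    rewrite /vv sqrtrM ?(ltW K0) //; apply: ler_pM => //; rewrite ?sqrtr_ge0 //.
    rewrite -[leRHS]ger0_norm ?(ltW K0) // -sqrtr_sqr ler_wsqrtr //.
    by rewrite expr2 ler_peMr // ltW.
  (* The common noise is only of order one and is absorbed through [1 <= q <= r]. *)
  have : K <= K * r by rewrite ler_peMr ?(ltW K0) // (le_trans q1).
  have : hi ^+ 2 * q%:R <= hi ^+ 2 * r by rewrite ler_wpM2l.
  have wr : w * r = 4 * (K * r) + 2 * (hi ^+ 2 * r) by rewrite /w; ring.
  rewrite wr -/vv; move: hcom vvr => {hV}.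
  move: (fro B * fro D * _) (K * r) (hi ^+ 2 * r) (hi ^+ 2 * q%:R) vv => a1 a2 a3 a4 a5; clear.
  by move=> *; lra.
have kk0 : 0 < (kr * kc)%:R :> R by rewrite ltr0n muln_gt0 kr0.
(* The tolerance [(2 * (kr * kc)%:R)^-1] makes the relative error exactly one half. *)
have near_f y : `|tavg T (fun t => sqn (y *m F t *m C^T)) - f * sqn y| <= 2^-1 * (f * sqn y).
  have eta0 : 0 <= (2 * (kr * kc)%:R)^-1 :> R by rewrite invr_ge0 mulr_ge0.
  rewrite (le_trans (factor_form_near C y eta0 hF)) //.
  by rewrite invfM divfK ?gt_eqF.
have lo0 : 0 <= f / 2 by rewrite divr_ge0.
have Flo y : f / 2 * sqn y <= tavg T (fun t => sqn (y *m F t *m C^T)).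
  by have := near_f y; rewrite ler_norml => /andP[+ _]; lra.
have hi0 : 0 <= 3 / 2 * f by rewrite mulr_ge0.
have Fhi y : tavg T (fun t => sqn (y *m F t *m C^T)) <= 3 / 2 * f * sqn y.
  by have := near_f y; rewrite ler_norml => /andP[_]; lra.
split=> [j /andP[j1 jk]|j /andP[krj jp]]; last first.
  have /(lambda_factor_le hL Fhi hnoise hi0) : (1 <= j <= p)%N by rewrite jp (leq_trans _ krj).
  rewrite big_pred0 ?mulr0 ?add0r ?mulrA // => i.
  by apply/negbTE; rewrite -ltnNge (leq_trans (ltn_ord i)) // -ltnS prednK // (leq_trans _ krj).
split.
  have m0 : 0 < u j / K by rewrite divr_gt0.
  have hm (i : 'I_kr) : (i < j)%N -> u j / K <= colsq A i.
    move=> ij; rewrite ler_pdivrMr // mulrC; have [h _] := hZr i.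
    by apply: le_trans h; apply: udec.
  have := lambda_factor_ge hL Flo hnoise (j := j) lo0 _ s0 m0 hm hG.
  rewrite j1 jk => /(_ isT); apply: le_trans; rewrite lerD2r.
  have vf : v 1%N / K <= f by rewrite ler_pdivrMr // mulrC.
  apply: (@le_trans _ _ (s / (4 * K ^+ 2) * (v 1%N * u j))).
    by rewrite ler_wpM2r ?ge_min ?lexx ?orbT // mulr_ge0 // ltW.
  apply: (@le_trans _ _ (2^-1 * (v 1%N / K / 2) * (s * (u j / K)))).
    by rewrite le_eqVlt; apply/orP; left; apply/eqP; field; rewrite gt_eqF.
  apply: ler_wpM2r; first by apply: mulr_ge0; exact: ltW.
  by apply: ler_wpM2l; rewrite ?invr_ge0 // ler_wpM2r // invr_ge0.
have /(lambda_factor_le hL Fhi hnoise hi0) : (1 <= j <= p)%N by rewrite j1 (leq_trans jk).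
move=> /le_trans; apply; rewrite (mulrA 2 nu xi) lerD2r.
have sumA : \sum_(i < kr | (j.-1 <= i)%N) colsq A i <= kr%:R * (K * u j).
  apply: (@le_trans _ _ (\sum_(i < kr) K * u j)); last first.
    by rewrite sumr_const card_ord mulr_natl.
  rewrite big_mkcond /=; apply: ler_sum => i _; case: ifP => [ij|_]; last first.
    by rewrite mulr_ge0 // ltW.
  have [_ h] := hZr i; apply: (le_trans h); rewrite ler_wpM2l ?(ltW K0) //.
  by apply: udec => //; rewrite j1 -(prednK j1) ltnS.
apply: (@le_trans _ _ (2 * (3 / 2 * (kc%:R * (K * v 1%N))) * (kr%:R * (K * u j)))).
  apply: ler_pM => //; rewrite ?mulr_ge0 //; first by apply: sumr_ge0.
  by rewrite ler_wpM2l // ler_wpM2l.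
by rewrite le_eqVlt /C1; apply/orP; left; apply/eqP; field.
Qed.

(** * From the model to the row estimator *)

Section Row.
Variables (kr kc : nat) (T p q : nat -> nat) (M : forall n, mefm P kr kc (p n) (q n)).
Arguments M : clear implicits.
Hypotheses (Mmodel : model_equation T M) (Mcenter : centering_assumption T M).
Hypothesis Mnoise : noise_decomposition_assumption M.

Definition projected_noise n t w : 'M[R]_(p n, q n) :=
  centering_mx R (p n) *m (Aer (M n) *m mx_at (Fe (M n) t%:Z) w *m (Aec (M n))^T
    + map2_mx *%R (Sigma_eps (M n)) (mx_at (eps (M n) t%:Z) w)) *m centering_mx R (q n).

Lemma Lhat_decomposition n : {ae P, forall w, (0 < p n)%N -> (0 < q n)%N ->
  forall t, (1 <= t <= T n)%N -> Lhat (M n) t w =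
    mx_at (Ar (M n)) w *m mx_at (F (M n) t%:Z) w *m (mx_at (Ac (M n)) w)^T + projected_noise n t w}.
Proof.
have [hE _ _ _ _] := Mnoise.
have aeY : {ae P, forall w, forall t, (1 <= t <= T n)%N ->
    mx_at (Y (M n) t) w =
      mu (M n) t w *: (const_mx 1 *m (const_mx 1 : 'cV[R]_(q n))^T)
      + mx_at (alpha (M n) t) w *m (const_mx 1 : 'cV[R]_(q n))^T
      + (const_mx 1 : 'cV[R]_(p n)) *m (mx_at (beta (M n) t) w)^T
      + mx_at (Ar (M n)) w *m mx_at (F (M n) t%:Z) w *m (mx_at (Ac (M n)) w)^T
      + mx_at (E (M n) t%:Z) w}.
  apply: ae_foralln => t; have [tT|tT] := boolP (1 <= t <= T n)%N.
    by apply: filterS (Mmodel tT) => w.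
  by apply: aeW => w.
have aeE : {ae P, forall w, forall t : nat, mx_at (E (M n) t%:Z) w =
    Aer (M n) *m mx_at (Fe (M n) t%:Z) w *m (Aec (M n))^T
      + map2_mx *%R (Sigma_eps (M n)) (mx_at (eps (M n) t%:Z) w)}.
  by apply: ae_foralln => t; exact: hE.
apply: filterS3 aeY aeE (Mcenter n) => w hY hEw [_ Ar0 Ac0] p0 q0 t tT.
have CMq : (mx_at (Ac (M n)) w)^T *m centering_mx R (q n) = (mx_at (Ac (M n)) w)^T.
  by apply: trmx_inj; rewrite trmx_mul trmxK centering_tr; exact: centering_fix.
rewrite /Lhat hY // /projected_noise -hEw sandwich_sum.
- congr (_ + _); rewrite !mulmxA centering_fix //.
  by rewrite -(mulmxA _ _ (centering_mx R (q n))) CMq.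
- by rewrite -scalemxAr -scalemxAl mulmxA centering_mul_const // !mul0mx scaler0.
- by rewrite trmx_const -!mulmxA const_mul_centering // !mulmx0.
- by rewrite mulmxA centering_mul_const // !mul0mx.
Qed.

Variables (delta_r delta_c xi : nat -> R) (khat : nat -> {RV P >-> nat}).
Hypotheses (kr0 : (0 < kr)%N) (kc0 : (0 < kc)%N).
Hypotheses (Too : T @ \oo --> \oo) (poo : p @ \oo --> \oo) (qoo : q @ \oo --> \oo).
Hypotheses (Mfactor : factor_assumption M) (Mloading : loading_assumption M delta_r delta_c).
Hypothesis Mdynamics : noise_dynamics_assumption M.
Hypothesis xi_pos : forall n, 0 < xi n.
Hypothesis xi_asymp : asymp xi
  (fun n => (p n)%:R * (q n)%:R * noise_rate R (T n) (p n) (q n)).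
Hypothesis khat_argmin : eig_ratio_estimator (fun n w => row_cov (T n) (M n) w) xi khat.
Hypothesis gap : strength_gap kr T p q delta_r delta_c.

Theorem row_consistent : consistent khat kr.
Proof.
have [Flin Fin [bf F4] [cf Fcoef]] := Mfactor.
have [_ strA strC] := Mloading.
have [_ stE _ [slo [shi [slo0 hS]]] [nB nD nk nl]] := Mnoise.
have [Elin _ Ein [be E4] [ce Ecoef]] := Mdynamics.
have [xiO Oxi] := xi_asymp.
have [s s0 tG] := loading_gram_tight strA poo.
have tA := loading_strength_tight strA.
have tC := loading_strength_tight strC.
pose eta : R := (2 * (kr * kc)%:R)^-1.
have eta0 : 0 < eta by rewrite invr_gt0 mulr_gt0 // ltr0n muln_gt0 kr0.
have tF := factor_tight Flin (fun n => (Fin n).1) F4 Fcoef Too eta0.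
have hS' n i j : 0 <= Sigma_eps (M n) i j <= shi.
  by have /andP[h1 ->] := hS n i j; rewrite andbT (le_trans _ h1) // ltW.
have tI := idiosyncratic_tight (fun n => (Elin n).2) (fun n => (Ein n).2)
  (fun n => (E4 n).2) (fun n => (Ecoef n).2) hS' Too poo qoo.
have stFe n t i j : standardized (Fe (M n) t i j) by have [_ h _ _] := stE n t.
have tX := common_tight stFe nB nD nk nl Too.
have tL : tight P (fun _ n => [set w | ~ ((0 < p n)%N -> (0 < q n)%N ->
    forall t, (1 <= t <= T n)%N -> Lhat (M n) t w =
    mx_at (Ar (M n)) w *m mx_at (F (M n) t%:Z) w *m (mx_at (Ac (M n)) w)^T
      + projected_noise n t w)]).
  apply: (@tight_ae _ _ _ P) => n; apply: filterS (Lhat_decomposition n) => w hw.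
  by move=> /=; exact.
have [K5 K50 hK5] := bigO_near Oxi.
have := tightU (tightU (tightU tL tF) (tightU tA tC)) (tightU tG (tightU tX tI)).
move=> /tight_consistent; apply=> K K1.
have [_ _ _ [_ dr_dec _]] := strA.
have [_ _ _ [_ dc_dec _]] := strC.
pose nu := Num.max 1 ((4 * K + 2 * shi ^+ 2) * K5).
pose c1 := Num.min 1 (s / (4 * K ^+ 2)).
pose C1 : R := 3 * kc%:R * kr%:R * K ^+ 2.
(* This tolerance depends on [K], which is fixed before [n] goes to infinity, so the gap condition
   can still be applied with it. *)
pose tau := c1 ^+ 2 / (8 * ((C1 + 2 * nu + 1) * (2 * nu + 1))).
have K0 : 0 < K by rewrite (lt_le_trans _ K1).
have nu1 : 1 <= nu by rewrite le_max lexx.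
have c10 : 0 < c1 by rewrite lt_min ltr01 divr_gt0 // mulr_gt0 // exprn_gt0.
have C10 : 0 <= C1 by rewrite !mulr_ge0 ?(ltW K0).
have tau0 : 0 < tau.
  by rewrite divr_gt0 ?exprn_gt0 // !mulr_gt0 //; lra.
have gapb := strength_gap_bounds kr0 poo qoo dr_dec xi_pos xiO gap tau0.
(* Outside the union of the failure events every estimate holds; below, each is recovered by
   contradiction from its own component of the union. *)
near=> n => w /= kw; apply: contrapT => good; apply: kw.
have T0 : (0 < T n)%N by near: n; exact: near_gt0.
have p0 : (0 < p n)%N by near: n; exact: near_gt0.
have q0 : (0 < q n)%N by near: n; exact: near_gt0.
(* Ensures that [kr] is an admissible candidate, at most half of [p n], and that [p n] is at least
   2. *)
have krp : (kr.*2.+2 <= p n)%N by near: n; move/cvgnyPge: poo; exact.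
have hrate : (p n)%:R * (q n)%:R * noise_rate R (T n) (p n) (q n) <= K5 * xi n.
  have : `|(p n)%:R * (q n)%:R * noise_rate R (T n) (p n) (q n)| <= K5 * `|xi n| by near: n.
  by rewrite (gtr0_norm (xi_pos n)); apply: le_trans; exact: ler_norm.
have [xiU xiUU] : xi n <= tau * ((q n)%:R `^ delta_c 1%N * (p n)%:R `^ delta_r kr) /\
    forall j, (1 <= j < kr)%N -> xi n * ((q n)%:R `^ delta_c 1%N * (p n)%:R `^ delta_r j)
      <= tau * (((q n)%:R `^ delta_c 1%N * (p n)%:R `^ delta_r j.+1)
            * ((q n)%:R `^ delta_c 1%N * (p n)%:R `^ delta_r kr)) by near: n.
have u0 j : 0 < (p n)%:R `^ delta_r j by rewrite powR_gt0 ?ltr0n.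
have v0 j : 0 < (q n)%:R `^ delta_c j by rewrite powR_gt0 ?ltr0n.
have udec i j : (1 <= i <= j)%N -> (j <= kr)%N -> (p n)%:R `^ delta_r j <= (p n)%:R `^ delta_r i.
  by move=> ij jk; rewrite ler_powR ?ler1n // dr_dec.
have vdec i j : (1 <= i <= j)%N -> (j <= kc)%N -> (q n)%:R `^ delta_c j <= (q n)%:R `^ delta_c i.
  by move=> ij jk; rewrite ler_powR ?ler1n // dc_dec.
have [] := @scov_lambda_bounds (T n) (p n) (q n) kr kc _ _ (mx_at (Ar (M n)) w) (mx_at (Ac (M n)) w)
  (fun t => mx_at (F (M n) t%:Z) w) (fun t => Lhat (M n) t w) (Aer (M n)) (Aec (M n))
  (fun t => mx_at (Fe (M n) t%:Z) w) (Sigma_eps (M n)) (fun t => mx_at (eps (M n) t%:Z) w)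
  K K5 s shi (xi n) (fun j => (p n)%:R `^ delta_r j) (fun j => (q n)%:R `^ delta_c j)
  T0 p0 q0 kr0 kc0 _ K1 K50 s0 (xi_pos n) u0 v0 udec vdec _ _ _ _ _ _ _ (hS' n) hrate.
- by rewrite (leq_trans _ krp) // -addnn -addn2 -addnA leq_addr.
- move=> t tT; apply: contrapT => h; apply: good; left; left; left => h'.
  by apply: h; exact: h'.
- move=> i j i' j'; apply: contrapT => h; apply: good; left; left; right => h'; apply: h.
  have -> : tavg (T n) (fun t => mx_at (F (M n) t%:Z) w i j * mx_at (F (M n) t%:Z) w i' j') =
      tavg (T n) (fun t => F (M n) t%:Z i j w * F (M n) t%:Z i' j' w).
    by apply: eq_tavg => t _; rewrite !mxE.
  exact: h'.
- move=> i; apply: contrapT => h; apply: good; left; right; left => h'; apply: h.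
  exact: h'.
- move=> i; apply: contrapT => h; apply: good; left; right; right => h'; apply: h.
  exact: h'.
- move=> y; apply: contrapT => h; apply: good; right; left => h'; apply: h.
  exact: h'.
- by rewrite leNgt; apply/negP => h; apply: good; right; right; left.
- rewrite leNgt; apply/negP => h; apply: good; right; right; right.
  apply: (etrans _ h); congr (_ < _); apply: eq_bigr => i _; apply: eq_bigr => i' _.
  by congr (_ ^+ 2); apply: eq_tavg => t _; apply: eq_bigr => j _; rewrite !mxE.
move=> hl hl'.
have p2 : (2 <= p n)%N by rewrite (leq_trans _ krp).
apply: (@argmin_eig_ratio R (fun j => lambda j (scov (T n) (fun t => Lhat (M n) t w)))
  (fun j => (q n)%:R `^ delta_c 1%N * (p n)%:R `^ delta_r j) (xi n) nu c1 C1 kr (p n)./2 (khat n w)) => //.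
- by rewrite kr0 -[kr]doubleK half_leq // (leq_trans _ krp) // -addn2 leq_addr.
- by rewrite ge_min lexx.
- by move=> j; exact: lambda_scov_ge0.
- by move=> j; rewrite mulr_gt0.
- by move=> j jk; rewrite ler_wpM2l ?(ltW (v0 _)) // udec.
(* The last eigenvalue read has index [(p n)./2.+1], which is at most [p n] since [p n] is
   positive. *)
- move=> j /andP[krj jp]; apply: hl'; rewrite krj (leq_trans jp) //.
  by rewrite -divn2 ltn_Pdiv.
- exact: khat_argmin.
Unshelve. all: by end_near. Qed.

End Row.
End RowTheorem.

(** * Columns by transposition *)

Section Transposition.
Context {R : realType} {d : measure_display} {Omega : measurableType d}.
Variable P : probability Omega R.

Definition rmx_tr m n (X : random_mx P m n) : random_mx P n m := fun i j => X j i.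

Lemma mx_at_tr m n (X : random_mx P m n) w : mx_at (rmx_tr X) w = (mx_at X w)^T.
Proof. by apply/matrixP => i j; rewrite !mxE. Qed.

Section Series.
Variables (m n : nat) (X Z : int -> random_mx P m n).

Lemma series_entries_tr : series_entries (fun t => rmx_tr (X t)) = series_entries X.
Proof.
by apply/seteqP; split => f [t _ [i [j ->]]]; exists t => //; exists j, i.
Qed.

Lemma linear_process_tr a : linear_process a X Z ->
  linear_process a (fun t => rmx_tr (X t)) (fun t => rmx_tr (Z t)).
Proof. by move=> XZ t i j; exact: XZ. Qed.

Lemma innovations_tr : innovations X -> innovations (fun t => rmx_tr (X t)).
Proof.
move=> [indX stX]; split=> [|t i j]; last exact: stX.
pose f (u : int * 'I_n * 'I_m) := (u.1.1, u.2, u.1.2).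
have injf : injective f by move=> [[t i] k] [[t' i'] k'] [-> -> ->].
exact: (mutually_independent_inj injf indX).
Qed.

Lemma fourth_moment_le_tr b : fourth_moment_le X b -> fourth_moment_le (fun t => rmx_tr (X t)) b.
Proof. by move=> X4 t i j; exact: X4. Qed.

End Series.

Lemma mutually_independent_tr m n (X : random_mx P m n) :
  mutually_independent P (fun u : 'I_m * 'I_n => X u.1 u.2 : Omega -> R) ->
  mutually_independent P (fun u : 'I_n * 'I_m => rmx_tr X u.1 u.2 : Omega -> R).
Proof.
move=> indX; pose f (u : 'I_n * 'I_m) := (u.2, u.1).
have injf : injective f by move=> [i k] [i' k'] [-> ->].
exact: (mutually_independent_inj injf indX).
Qed.

(** Row and column effects, loadings and dimensions are exchanged while the scalar series and
    coefficients stay, so each assumption becomes its own mirror image and the column estimator is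
    the row estimator of this model. *)
Definition mefm_tr kr kc p q (M : mefm P kr kc p q) : mefm P kc kr q p :=
  Mefm (fun t => rmx_tr (Y M t)) (mu M) (beta M) (alpha M) (Ac M) (Ar M)
    (fun t => rmx_tr (F M t)) (fun t => rmx_tr (E M t)) (af M) (fun t => rmx_tr (Xf M t))
    (Aec M) (Aer M) (fun t => rmx_tr (Fe M t)) (Sigma_eps M)^T (fun t => rmx_tr (eps M t))
    (ae M) (fun t => rmx_tr (Xe M t)) (aeps M) (fun t => rmx_tr (Xeps M t)).

Variables (kr kc : nat) (T p q : nat -> nat) (M : forall n, mefm P kr kc (p n) (q n)).
Arguments M : clear implicits.
Let M' n := mefm_tr (M n).

Lemma model_equation_tr : model_equation T M -> model_equation T M'.
Proof.
move=> hM n t tT; apply: filterS (hM n t tT) => w e.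
rewrite /= (mx_at_tr (Y (M n) t)) (mx_at_tr (F (M n) t%:Z)) (mx_at_tr (E (M n) t%:Z)) e.
rewrite !linearD /= linearZ /= !trmx_mul !trmxK !mulmxA.
(* Transposition brings the row and column effects in the opposite order, which commutativity
   repairs. *)
congr (_ + _ + _); rewrite -!addrA; congr (_ + _); exact: addrC.
Qed.

Lemma centering_assumption_tr : centering_assumption T M -> centering_assumption T M'.
Proof.
move=> hM n; apply: filterS (hM n) => w [h1 h2 h3]; split=> // t /h1 [? ?]; by split.
Qed.

Lemma factor_assumption_tr : factor_assumption M -> factor_assumption M'.
Proof.
move=> [h1 h2 [b h3] h4]; split => //.
- by move=> n; exact: (linear_process_tr (h1 n)).
- move=> n; have [h5 h6] := h2 n; split; first exact: (innovations_tr h5).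
  by move=> t i j t' i' j' B mB; exact: h6.
- by exists b => n; exact: (fourth_moment_le_tr (h3 n)).
Qed.

Lemma loading_assumption_tr delta_r delta_c :
  loading_assumption M delta_r delta_c -> loading_assumption M' delta_c delta_r.
Proof.
move=> [h1 h2 h3]; split => // n.
by rewrite /= (series_entries_tr (F (M n))) (series_entries_tr (E (M n))) setUC; exact: h1.
Qed.

Lemma noise_decomposition_assumption_tr :
  noise_decomposition_assumption M -> noise_decomposition_assumption M'.
Proof.
move=> [h1 h2 h3 [lo [hi [lo0 h4]]] [h5 h6 h7 h8]]; split => //.
- move=> n t; apply: filterS (h1 n t) => w e.
  rewrite /= (mx_at_tr (E (M n) t)) (mx_at_tr (Fe (M n) t)) (mx_at_tr (eps (M n) t)) e.
  rewrite linearD /= !trmx_mul trmxK mulmxA; congr (_ + _).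
  by apply/matrixP => i j; rewrite !mxE.
- move=> n t; have [i1 i2 i3 i4] := h2 n t.
  split; [exact: (mutually_independent_tr i1)|by move=> i j; exact: i2|
    exact: (mutually_independent_tr i3)|by move=> i j; exact: i4].
- by move=> n; rewrite /= (series_entries_tr (eps (M n))) (series_entries_tr (Fe (M n))); exact: h3.
- by exists lo, hi; split => // n i j; rewrite mxE.
Qed.

Lemma noise_dynamics_assumption_tr :
  noise_dynamics_assumption M -> noise_dynamics_assumption M'.
Proof.
move=> [h1 h2 h3 [b h4] h5]; split => //.
- by move=> n; have [l1 l2] := h1 n; split; [exact: (linear_process_tr l1)|exact: (linear_process_tr l2)].
- move=> n; rewrite /= (series_entries_tr (Xe (M n))) (series_entries_tr (Xeps (M n))).
  by rewrite (series_entries_tr (Xf (M n))); exact: h2.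
- by move=> n; have [l1 l2] := h3 n; split; [exact: (innovations_tr l1)|exact: (innovations_tr l2)].
- by exists b => n; have [l1 l2] := h4 n; split; [exact: (fourth_moment_le_tr l1)|exact: (fourth_moment_le_tr l2)].
Qed.

Lemma row_cov_tr n w : row_cov (T n) (M' n) w = col_cov (T n) (M n) w.
Proof.
congr (_ *: _); apply: eq_bigr => t _.
have -> : Lhat (M' n) t w = (Lhat (M n) t w)^T.
  by rewrite /Lhat /= (mx_at_tr (Y (M n) t)) !trmx_mul !centering_tr mulmxA.
by rewrite trmxK.
Qed.

End Transposition.

Theorem theorem9 (R : realType) (d : measure_display) (Omega : measurableType d)
    (P : probability Omega R) (kr kc : nat) (T p q : nat -> nat)
    (M : forall n, mefm P kr kc (p n) (q n))
    (delta_r delta_c xi_r xi_c : nat -> R)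
    (khat_r khat_c : nat -> {RV P >-> nat}) :
  (1 <= kr)%N -> (1 <= kc)%N ->
  T @ \oo --> \oo -> p @ \oo --> \oo -> q @ \oo --> \oo ->
  model_equation T M ->
  centering_assumption T M ->
  mixing_assumption M ->
  factor_assumption M ->
  loading_assumption M delta_r delta_c ->
  noise_decomposition_assumption M ->
  noise_dynamics_assumption M ->
  rate_assumption kr kc T p q delta_r delta_c ->
  (forall n, 0 < xi_r n) ->
  asymp xi_r
    (fun n => (p n)%:R * (q n)%:R * noise_rate R (T n) (p n) (q n)) ->
  (forall n, 0 < xi_c n) ->
  asymp xi_c
    (fun n => (p n)%:R * (q n)%:R * noise_rate R (T n) (q n) (p n)) ->
  eig_ratio_estimator (fun n w => row_cov (T n) (M n) w) xi_r khat_r ->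
  eig_ratio_estimator (fun n w => col_cov (T n) (M n) w) xi_c khat_c ->
  (strength_gap kr T p q delta_r delta_c -> consistent khat_r kr) /\
  (strength_gap kc T q p delta_c delta_r -> consistent khat_c kc).
Proof.
move=> kr1 kc1 Too poo qoo hmodel hcent _ hfac hload hdec hdyn _ xir0 xir xic0 xic hr hc.
split=> gap.
  exact: (row_consistent hmodel hcent hdec kr1 kc1 Too poo qoo hfac hload hdyn xir0 xir hr gap).
have hc' : eig_ratio_estimator (fun n w => row_cov (T n) (mefm_tr (M n)) w) xi_c khat_c.
  by move=> n w /(hc n w); rewrite row_cov_tr.
have xic' : asymp xi_c (fun n => (q n)%:R * (p n)%:R * noise_rate R (T n) (q n) (p n)).
  by move: xic; under eq_fun do rewrite [_%:R * _%:R]mulrC.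
exact: (row_consistent (model_equation_tr hmodel) (centering_assumption_tr hcent)
  (noise_decomposition_assumption_tr hdec) kc1 kr1 Too qoo poo (factor_assumption_tr hfac)
  (loading_assumption_tr hload) (noise_dynamics_assumption_tr hdyn) xic0 xic' hc' gap).
Qed.
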